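(* Let $K\ge1$ be fixed and let $\boldsymbol{\beta}_0=(\beta_{1,0},\dots,\beta_{k_0,0},0,\dots,0)^t\in\mathbb{R}^K$ with $\beta_{1,0},\dots,\beta_{k_0,0}$ all nonzero, $1\le k_0\le K$. For each $n>K$ let the $n\times K$ design matrix $\mathbf{X}$ with rows $\mathbf{x}_i$ satisfy: (i) $\sum_{i=1}^n x_{i,k}=0$ and $\sum_{i=1}^n x_{i,k}^2=n$ for each $k$; (ii) $\max_i\|\mathbf{x}_i\|/\sqrt n\to0$; (iii) $\mathbf{X}^t\mathbf{X}$ positive definite; (iv) $\mathbf{X}^t\mathbf{X}/n\to\boldsymbol{\Sigma}_0$ positive definite. Suppose $Y_i=\mathbf{x}_i^t\boldsymbol{\beta}_0+\varepsilon_i$ with $\varepsilon_i$ independent, $\mathbb{E}(\varepsilon_i)=0$, $\mathbb{E}(\varepsilon_i^2)=\sigma_0^2>0$, $\mathbb{E}(\varepsilon_i^4)\le M<\infty$. Fix $\alpha_1,\dots,\alpha_K\in(0,1)$ and set $\alpha_{K+1}=0$. Then for each $1\le k\le K$, as $n\to\infty$: (a) $\mathbb{P}\{\hat k_B=k\}\to 0$ if $k<k_0$; $\to(1-\alpha_{k_0+1})\cdots(1-\alpha_K)$ if $k=k_0$; $\to\alpha_k(1-\alpha_{k+1})\cdots(1-\alpha_K)$ if $k>k_0$. Moreover, if $\mathbf{X}^t\mathbf{X}/n=\boldsymbol{\Sigma}_0=\mathbf{I}$ for all $n$: (b) $\mathbb{P}\{\hat k_F=k\}\to0$ if $k<k_0$;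 $\to 1-\alpha_{k_0+1}$ if $k=k_0$; $\to(1-\alpha_{k+1})\alpha_{k_0+1}\cdots\alpha_k$ if $k>k_0$; (c) $\mathbb{P}\{\hat k_O=k\}\to0$ if $k<k_0$; $\to\mathbb{P}\{B_{k_0+1}+\cdots+B_K=k-k_0\}$ if $k\ge k_0$, where $B_{k_0+1},\dots,B_K$ are independent with $B_j\sim\mathrm{Bernoulli}(\alpha_j)$. (Empty products equal $1$.)
   Context: $\mathbf{Y}=(Y_1,\dots,Y_n)^t$, OLS $\widehat{\boldsymbol{\beta}}_n^\circ=(\mathbf{X}^t\mathbf{X})^{-1}\mathbf{X}^t\mathbf{Y}=(\widehat\beta_{1,n}^\circ,\dots,\widehat\beta_{K,n}^\circ)^t$, $\widehat\sigma_n^2=\|\mathbf{Y}-\mathbf{X}\widehat{\boldsymbol{\beta}}_n^\circ\|^2/(n-K)$; $z_{a}$ denotes the $100(1-a)$ percentile of $N(0,1)$, with $z_0=+\infty$. For $1\le k\le K$ let $\mathbf{X}[k]$ be the first $k$ columns of $\mathbf{X}$, $\widehat{\boldsymbol{\beta}}^\circ[k]=(\mathbf{X}[k]^t\mathbf{X}[k])^{-1}\mathbf{X}[k]^t\mathbf{Y}$ with last coordinate $\widehat\beta_k^\circ[k]$, $s_{kk}[k]$ the $k$th diagonal entry of $(\mathbf{X}[k]^t\mathbf{X}[k]/n)^{-1}$, and $\tilde Z_{k,n}=n^{1/2}\widehat\beta_k^\circ[k]/(\widehat\sigma_n s_{kk}[k]^{1/2})$; set $\tilde Z_{0,n}=0$,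 $z_{\alpha_0/2}=0$, $\tilde Z_{K+1,n}=0$. Backward estimator: $\hat k_B=\max\{k\in\{0,\dots,K\}:|\tilde Z_{k,n}|\ge z_{\alpha_k/2}\}$. Forward estimator: $\hat k_F=\min\{k-1: k\in\{1,\dots,K+1\},\ |\tilde Z_{k,n}|<z_{\alpha_k/2}\}$. OLS-hard estimator: with $s_{kk}$ the $k$th diagonal entry of $(\mathbf{X}^t\mathbf{X}/n)^{-1}$ and $\widehat Z_{k,n}=n^{1/2}\widehat\beta_{k,n}^\circ/(\widehat\sigma_n s_{kk}^{1/2})$, $\hat k_O=\#\{k\le K:|\widehat Z_{k,n}|\ge z_{\alpha_k/2}\}$. *)

(* Defs.v *)
From HB Require Import structures.
From mathcomp Require Import all_boot all_order all_algebra.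
From mathcomp Require Import all_classical all_reals all_analysis.
From mathcomp Require Import normal_distribution.

Set Implicit Arguments.
Unset Strict Implicit.
Unset Printing Implicit Defensive.

Import Order.TTheory GRing.Theory Num.Theory.
Import numFieldNormedType.Exports.

Local Open Scope classical_set_scope.
Local Open Scope ring_scope.

Section defs.
Context {R : realType}.

Definition Phi (x : R) : R := fine (normal_prob 0 1 `]-oo, x]).

(** z_a = 100(1-a) percentile of N(0,1), as an extended real:
    inf {x | Phi x >= 1 - a}; for a = 0 this is +oo (z_0 = +oo). *)
Definition zq (a : R) : \bar R :=
  ereal_inf [set x%:E | x in [set x : R | 1 - a <= Phi x]].

Definition posdefmx (p : nat) (A : 'M[R]_p) : Prop :=
  forall v : 'cV[R]_p, v != 0 -> 0 < (v^T *m A *m v) 0 0.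

Definition mutual_indep d (T : measurableType d) (P : probability T R)
    (I : set nat) (X : nat -> T -> R) : Prop :=
  forall (s : seq nat) (B : nat -> set R), uniq s -> (forall i, i \in s -> I i) ->
    (forall i, measurable (B i)) ->
    P (\bigcap_(i in [set j | j \in s]) (X i @^-1` B i)) =
    (\prod_(i <- s) P (X i @^-1` B i))%E.

Definition firstcols n K (X : 'M[R]_(n, K)) (k : nat) : 'M[R]_(n, k) :=
  \matrix_(i < n, j < k) oapp (X i) 0 (insub (nat_of_ord j) : option 'I_K).

Definition ols n p (X : 'M[R]_(n, p)) (Y : 'cV[R]_n) : 'cV[R]_p :=
  invmx (X^T *m X) *m X^T *m Y.

Definition sigma2hat n K (X : 'M[R]_(n, K)) (Y : 'cV[R]_n) : R :=
  (\sum_(i < n) ((Y - X *m ols X Y) i 0) ^+ 2) / (n - K)%:R.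

Definition lastcoord p (v : 'cV[R]_p) : R :=
  oapp (fun i : 'I_p => v i 0) 0 (insub p.-1).

Definition lastdiag p (A : 'M[R]_p) : R :=
  oapp (fun i : 'I_p => A i i) 0 (insub p.-1).

Definition Ztilde n K (X : 'M[R]_(n, K)) (Y : 'cV[R]_n) (k : nat) : R :=
  if (k == 0)%N || (K < k)%N then 0 else
  let Xk := firstcols X k in
  Num.sqrt n%:R * lastcoord (ols Xk Y) /
    (Num.sqrt (sigma2hat X Y) *
     Num.sqrt (lastdiag (invmx (n%:R^-1 *: (Xk^T *m Xk))))).

(** hat Z_{k,n} for the full model, index i : 'I_K stands for k = i+1. *)
Definition Zhat n K (X : 'M[R]_(n, K)) (Y : 'cV[R]_n) (i : 'I_K) : R :=
  Num.sqrt n%:R * ols X Y i 0 /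
    (Num.sqrt (sigma2hat X Y) *
     Num.sqrt ((invmx (n%:R^-1 *: (X^T *m X))) i i)).

Definition thr (alpha : nat -> R) (k : nat) : \bar R :=
  if (k == 0)%N then 0%E else zq (alpha k / 2).

Definition khatB (alpha : nat -> R) n K (X : 'M[R]_(n, K)) (Y : 'cV[R]_n) : nat :=
  \big[maxn/0%N]_(k < K.+1 | (thr alpha k <= (`|Ztilde X Y k|)%:E)%E) k.

Definition khatF (alpha : nat -> R) n K (X : 'M[R]_(n, K)) (Y : 'cV[R]_n) : nat :=
  \big[minn/K]_(k < K.+2 | (0 < k)%N && ((`|Ztilde X Y k|)%:E < thr alpha k)%E) k.-1.

Definition khatO (alpha : nat -> R) n K (X : 'M[R]_(n, K)) (Y : 'cV[R]_n) : nat :=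
  #|[set i : 'I_K | (zq (alpha i.+1 / 2) <= (`|Zhat X Y i|)%:E)%E]|.

Definition Yvec d (T : measurableType d) n K (X : 'M[R]_(n, K)) (beta0 : 'cV[R]_K)
    (eps : nat -> T -> R) (w : T) : 'cV[R]_n :=
  X *m beta0 + \col_(i < n) eps i w.

End defs.

(* Main.v *)
(**
For k = 1, ..., K let u_k be the normalised residual of the k-th column of X on the previous
ones.  The u_k are orthonormal, their entries tend to 0 uniformly, and Ztilde_k is the inner
product of u_k and Y divided by sigmahat.  The mean of the numerator vanishes for k > k0 and
diverges like sqrt n for k = k0 (for all k <= k0 when the design is orthonormal, where moreover
Zhat = Ztilde).

The vector of the sums <u_k, eps> / sigma is asymptotically N(0, I).  Only functions of |Z_k|
matter, so it is enough to show that E cos (c + sum_k t_k Z_k) tends to cos c exp (- |t|^2 / 2),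
which follows factor by factor from the Taylor expansions of cos and sin, and then to sandwich
the indicator of |x| < z between cosine polynomials of the form
(1 - ((1 - cos (pi x / L)) / 2)^n)^m, the error beyond L being controlled by the second moments.
Consistency of sigmahat and a squeeze transfer the limits to the studentized scores; inclusion
and exclusion gives the limit of the probability of every pattern of acceptances and rejections,
and the three estimators are functions of that pattern.
*)
Require Import Defs.
From HB Require Import structures.
From mathcomp Require Import all_boot all_order all_algebra.
From mathcomp Require Import all_classical all_reals all_analysis.
From mathcomp Require Import normal_distribution measurable_realfun.
From mathcomp Require Import ring lra zify.
Set Implicit Arguments.
Unset Strict Implicit.
Unset Printing Implicit Defensive.
Import Order.TTheory GRing.Theory Num.Theory.
Import numFieldNormedType.Exports.

Local Open Scope classical_set_scope.
Local Open Scope ring_scope.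

(** * Real-valued probabilities and expectations *)

Section prob.
Context d (T : measurableType d) (R : realType) (P : probability T R).

Definition pr (A : set T) : R := fine (P A).

Lemma prE A : measurable A -> P A = (pr A)%:E.
Proof. by move=> mA; rewrite fineK// fin_num_measure. Qed.

Lemma pr_ge0 A : 0 <= pr A. Proof. exact: fine_ge0. Qed.

Lemma pr_le A B : measurable A -> measurable B -> A `<=` B -> pr A <= pr B.
Proof.
by move=> mA mB AB; rewrite -lee_fin -!prE// le_measure// inE.
Qed.

Lemma pr_setT : pr setT = 1. Proof. by rewrite /pr probability_setT. Qed.

Lemma pr_le1 A : measurable A -> pr A <= 1.
Proof. by move=> mA; rewrite -pr_setT pr_le. Qed.

Lemma pr_setC A : measurable A -> pr (~` A) = 1 - pr A.
Proof. by move=> mA; rewrite {1}/pr probability_setC// prE. Qed.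

Lemma pr_setU A B : measurable A -> measurable B -> A `&` B = set0 ->
  pr (A `|` B) = pr A + pr B.
Proof. by move=> mA mB AB; rewrite {1}/pr measureU// fineD// fin_num_measure. Qed.

Lemma pr_setID A B : measurable A -> measurable B ->
  pr A = pr (A `&` B) + pr (A `\` B).
Proof.
move=> mA mB; rewrite -pr_setU ?setUIDK//; [exact: measurableI|exact: measurableD|].
by rewrite setDE setIACA setICr setI0.
Qed.

Lemma pr_setU_le A B : measurable A -> measurable B -> pr (A `|` B) <= pr A + pr B.
Proof.
move=> mA mB; have -> : A `|` B = A `|` (B `\` A) by rewrite setUDr setDv setD0.
have mBA := measurableD mB mA.
rewrite pr_setU ?lerD2l ?pr_le//.
by rewrite setDE setICA setICr setI0.
Qed.

Definition Ex (X : T -> R) : R := \int[P]_w X w.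

Lemma Ex_indic A : measurable A -> Ex \1_A = pr A.
Proof. by move=> mA; rewrite /Ex /Rintegral integral_indic// setIT. Qed.

Lemma Ex_cst c : Ex (fun=> c) = c.
Proof. by rewrite /Ex Rintegral_cst//= probability_setT/= mulr1. Qed.

Definition itg (X : T -> R) := P.-integrable setT (EFin \o X).

Lemma itg_meas (X : T -> R) : itg X -> measurable_fun setT X.
Proof. by move/measurable_int/measurable_EFinP. Qed.

Lemma itg_bounded (X : T -> R) C : measurable_fun setT X -> (forall w, `|X w| <= C) -> itg X.
Proof.
move=> mX XC; apply: measurable_bounded_integrable => //.
  by rewrite -ge0_fin_numE//; exact: fin_num_measure.
exists C; split; first exact: num_real.
by move=> x Cx w _; apply: le_trans (XC w) (ltW Cx).
Qed.

Lemma itg_le (X Y : T -> R) : measurable_fun setT X -> itg Y -> (forall w, `|X w| <= Y w) -> itg X.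
Proof.
move=> mX iY XY; apply: le_integrable iY => //; first exact/measurable_EFinP.
by move=> w _ /=; rewrite lee_fin (le_trans (XY w))// ler_norm.
Qed.

Lemma itg_cst c : itg (fun=> c).
Proof. by apply: (@itg_bounded _ `|c|) => // ; exact: measurable_cst. Qed.

Lemma itgD (X Y : T -> R) : itg X -> itg Y -> itg (fun w => X w + Y w).
Proof. by move=> iX iY; have := integrableD measurableT iX iY; rewrite /itg; under eq_fun do rewrite -EFinD. Qed.

Lemma itgB (X Y : T -> R) : itg X -> itg Y -> itg (fun w => X w - Y w).
Proof. by move=> iX iY; have := integrableB measurableT iX iY; rewrite /itg; under eq_fun do rewrite -EFinB. Qed.

Lemma itgZ c (X : T -> R) : itg X -> itg (fun w => c * X w).
Proof. by move=> iX; have := @integrableZl _ _ _ P setT measurableT c _ iX; rewrite /itg; under eq_fun do rewrite -EFinM. Qed.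

Lemma itg_sum I (s : seq I) (F : I -> T -> R) : (forall i, itg (F i)) ->
  itg (fun w => \sum_(i <- s) F i w).
Proof.
move=> iF; elim: s => [|i s IH].
  by under eq_fun do rewrite big_nil; exact: itg_cst.
by under eq_fun do rewrite big_cons; exact: itgD.
Qed.

Lemma ExD (X Y : T -> R) : itg X -> itg Y -> Ex (fun w => X w + Y w) = Ex X + Ex Y.
Proof. by move=> iX iY; rewrite /Ex RintegralD. Qed.

Lemma ExB (X Y : T -> R) : itg X -> itg Y -> Ex (fun w => X w - Y w) = Ex X - Ex Y.
Proof. by move=> iX iY; rewrite /Ex RintegralB. Qed.

Lemma ExZ c (X : T -> R) : itg X -> Ex (fun w => c * X w) = c * Ex X.
Proof. by move=> iX; rewrite /Ex RintegralZl. Qed.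

Lemma Ex_sum I (s : seq I) (F : I -> T -> R) : (forall i, itg (F i)) ->
  Ex (fun w => \sum_(i <- s) F i w) = \sum_(i <- s) Ex (F i).
Proof.
move=> iF; elim: s => [|i s IH].
  by rewrite big_nil; under eq_fun do rewrite big_nil; exact: Ex_cst.
rewrite big_cons -IH; under eq_fun do rewrite big_cons.
by rewrite ExD//; exact: itg_sum.
Qed.

Lemma le_Ex (X Y : T -> R) : itg X -> itg Y -> (forall w, X w <= Y w) -> Ex X <= Ex Y.
Proof. by move=> iX iY XY; apply: le_Rintegral => // w _. Qed.

Lemma Ex_ge0 (X : T -> R) : (forall w, 0 <= X w) -> 0 <= Ex X.
Proof. by move=> X0; apply: Rintegral_ge0. Qed.

Lemma normr_Ex (X : T -> R) : itg X -> `|Ex X| <= Ex (fun w => `|X w|).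
Proof. by move=> iX; apply: le_normr_Rintegral. Qed.

Lemma itg_norm (X : T -> R) : itg X -> itg (fun w => `|X w|).
Proof. by move=> iX; have := integrable_norm iX. Qed.

Lemma itg_indic A : measurable A -> itg \1_A.
Proof.
move=> mA; apply: (@itg_bounded _ 1) => [|w]; first exact: measurable_indic.
by rewrite indicE normr_nat lern1 leq_b1.
Qed.

Lemma measurable_ge_fun (f : T -> R) a :
  measurable_fun setT f -> measurable [set w | a <= f w].
Proof.
move=> mf; rewrite (_ : [set _ | _] = f @^-1` `[a, +oo[).
  by rewrite -[X in measurable X]setTI; exact: mf.
by apply/seteqP; split => w /=; rewrite in_itv/= andbT.
Qed.

Lemma pr_markov (X : T -> R) a : itg X -> (forall w, 0 <= X w) -> 0 < a ->
  pr [set w | a <= X w] <= Ex X / a.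
Proof.
move=> iX X0 a0.
have mA := measurable_ge_fun a (itg_meas iX).
rewrite ler_pdivlMr// mulrC -Ex_indic// -ExZ; last exact: itg_indic.
apply: le_Ex => //; first exact/itgZ/itg_indic.
by move=> w; rewrite indicE; have [|_] := boolP (w \in _); rewrite ?inE ?mulr1 ?mulr0.
Qed.

End prob.

(** * Cosine transform of the standard normal law *)

Section gauss.
Context {R : realType}.
Notation mu := (@lebesgue_measure R).
Notation phi := (@normal_pdf R 0 1).

Lemma stdpdfE x : phi x = normal_peak 1 * expR (- (x ^+ 2) / 2).
Proof.
rewrite normal_pdfE ?oner_eq0//= /normal_fun subr0 expr1n.
by congr (_ * expR (- _ / _)).
Qed.

Lemma stdpdf_even x : phi (- x) = phi x.
Proof. by rewrite !stdpdfE sqrrN. Qed.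

Lemma is_derive_mulrl (c : R) (f : R -> R) (x df : R) :
  is_derive x 1 f df -> is_derive x 1 (fun y => c * f y) (c * df).
Proof. by move=> H; exact: (@is_deriveZ _ _ _ f c x 1 df H). Qed.

Lemma is_derive_half_sqr (x : R) : is_derive x 1 (fun y => y ^+ 2 / 2) x.
Proof.
have H : is_derive x 1 (fun y : R => 2^-1 * (y ^+ 2)) (2^-1 * (2 * x)).
  apply: (@is_derive_mulrl 2^-1 (fun y => y ^+ 2)) => /=.
  have h := @is_deriveM R R id id x 1 1 1 (is_derive_id x 1) (is_derive_id x 1).
  by apply: (is_derive_eq h); rewrite /GRing.scale/= !mulr1 mulr_natl mulr2n.
have -> : (fun y : R => y ^+ 2 / 2) = (fun y => 2^-1 * (y ^+ 2)).
  by apply/funext => y; rewrite mulrC.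
by apply: is_derive_eq H _; field.
Qed.

Lemma is_derive_stdpdf (x : R) : is_derive x 1 phi (- x * phi x).
Proof.
have -> : phi = (fun y => normal_peak 1 * (@expR R \o (fun x => - 1 * (x ^+ 2 / 2))) y).
  by apply/funext => y; rewrite stdpdfE mulNr -mulN1r.
rewrite [X in is_derive _ _ _ X](_ : _ = normal_peak 1 * (expR (- 1 * (x ^+ 2 / 2)) * (- 1 * x))); last first.
  by rewrite /=; ring.
apply: (@is_derive_mulrl (normal_peak 1)); apply: is_derive1_comp.
exact: (@is_derive_mulrl (- 1) (fun y => y ^+ 2 / 2) _ _ (is_derive_half_sqr _)).
Qed.

Lemma integrable_stdpdf_bounded (f : R -> R) (C : R) :
  measurable_fun setT f -> (forall x, `|f x| <= C) ->
  mu.-integrable setT (EFin \o (fun x => f x * phi x)).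
Proof.
move=> mf fC.
apply: (@le_integrable _ _ _ mu setT measurableT _ (EFin \o (fun x => C * phi x))).
- by apply/measurable_EFinP; apply: measurable_funM => //; exact: measurable_normal_pdf.
- move=> x _ /=; rewrite lee_fin normrM [leRHS]ger0_norm.
    by rewrite (ger0_norm (normal_pdf_ge0 _ _ _)) ler_wpM2r ?normal_pdf_ge0.
  by rewrite mulr_ge0 ?normal_pdf_ge0// (le_trans _ (fC x)).
- have := @integrableZl _ _ _ mu setT measurableT C _ (integrable_normal_pdf 0 1).
  by under eq_fun do rewrite -EFinM.
Qed.

Lemma abs_stdpdf_le x :
  `|x| * phi x <= (normal_peak 1 / normal_peak (Num.sqrt 2)) * normal_pdf 0 (Num.sqrt 2) x.
Proof.
have s0 : Num.sqrt 2 != 0 :> R by rewrite gt_eqF// sqrtr_gt0.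
rewrite stdpdfE (normal_pdfE _ s0) /= /normal_fun subr0 sqr_sqrtr//.
rewrite mulrA divfK; last by rewrite gt_eqF// normal_peak_gt0.
rewrite mulrCA ler_wpM2l ?normal_peak_ge0//.
have -> : - x ^+ 2 / 2 = (- x ^+ 2 / (2 *+ 2)) + (- (x ^+ 2 / 4)) :> R.
  by rewrite (_ : 2 *+ 2 = 4 :> R); [field|rewrite -mulr_natr; ring].
rewrite expRD mulrCA ler_piMr ?expR_ge0//.
rewrite expRN ler_pdivrMr ?expR_gt0// mul1r.
have := expR_ge1Dx (x ^+ 2 / 4); apply: le_trans.
rewrite -(real_normK (num_real x)).
have := sqr_ge0 (`|x| / 2 - 1); set y := `|x|; nra.
Qed.

Lemma integrable_abs_stdpdf : mu.-integrable setT (EFin \o (fun x => `|x| * phi x)).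
Proof.
apply: (@le_integrable _ _ _ mu setT measurableT _
  (EFin \o (fun x => (normal_peak 1 / normal_peak (Num.sqrt 2)) * normal_pdf 0 (Num.sqrt 2) x))).
- apply/measurable_EFinP; apply: measurable_funM => //; last exact: measurable_normal_pdf.
- move=> x _ /=; rewrite lee_fin.
  rewrite ger0_norm ?mulr_ge0 ?normal_pdf_ge0//.
  by apply: le_trans (abs_stdpdf_le x) (ler_norm _).
- set c := (_ / _).
  have := @integrableZl _ _ _ mu setT measurableT c _ (integrable_normal_pdf 0 (Num.sqrt 2)).
  by under eq_fun do rewrite -EFinM.
Qed.

Lemma measurable_cosM (t : R) : measurable_fun setT (fun x => cos (t * x)).
Proof.
apply: continuous_measurable_fun => x.
apply: continuous_comp; [exact: mulrl_continuous|exact: continuous_cos].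
Qed.

Lemma measurable_sinM (t : R) : measurable_fun setT (fun x => sin (t * x)).
Proof.
apply: continuous_measurable_fun => x.
apply: continuous_comp; [exact: mulrl_continuous|exact: continuous_sin].
Qed.

Lemma integrable_id_stdpdf (g : R -> R) : measurable_fun setT g -> (forall x, `|g x| <= 1) ->
  mu.-integrable setT (EFin \o (fun x => x * g x * phi x)).
Proof.
move=> mg g1.
apply: le_integrable integrable_abs_stdpdf => //.
  apply/measurable_EFinP; apply: measurable_funM; last exact: measurable_normal_pdf.
  by apply: measurable_funM.
move=> x _ /=; rewrite lee_fin [leRHS]ger0_norm ?mulr_ge0 ?normal_pdf_ge0//.
rewrite normrM (ger0_norm (normal_pdf_ge0 _ _ _)) ler_wpM2r ?normal_pdf_ge0//.
by rewrite normrM ler_piMr.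
Qed.

Lemma is_derive_cosM (x t : R) : is_derive t 1 (fun t => cos (x * t)) (- (x * sin (x * t))).
Proof.
have H := is_derive_mulrl x (is_derive_id t 1).
have : is_derive t 1 (cos \o (fun t => x * t)) (- sin (x * t) * (x * 1)).
  exact: is_derive1_comp.
by move=> {}H; apply: is_derive_eq H _; ring.
Qed.

Lemma is_derive_sinM (x t : R) : is_derive t 1 (fun t => sin (x * t)) (x * cos (x * t)).
Proof.
have H := is_derive_mulrl x (is_derive_id t 1).
have : is_derive t 1 (sin \o (fun t => x * t)) (cos (x * t) * (x * 1)).
  exact: is_derive1_comp.
by move=> {}H; apply: is_derive_eq H _; ring.
Qed.

Definition gaussE (f : R -> R) := \int[mu]_x (f x * phi x).

Lemma is_derive_gaussE_cos (t : R) :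
  is_derive t 1 (fun t => gaussE (fun x => cos (t * x)))
    (- gaussE (fun x => x * sin (t * x))).
Proof.
pose f (t x : R) := cos (t * x) * phi x.
have D (s x : R) : is_derive s 1 (f ^~ x) (- (x * sin (s * x) * phi x)).
  have H := is_derive_cosM x s.
  have -> : f ^~ x = (fun t : R => phi x * cos (x * t)).
    by apply/funext => u; rewrite /f/= mulrC (mulrC u).
  apply: is_derive_eq (is_derive_mulrl (phi x) H) _; rewrite [s * x]mulrC; ring.
have E s x : partial1of2 f s x = - (x * sin (s * x) * phi x).
  by rewrite partial1of2E; have [_ ->] := D s x.
have tI : [set` `]t - 1, t + 1[] t.
  by rewrite /= in_itv/= ltrDl gtrDl ltrN10 ltr01.
have intf s : [set` `]t - 1, t + 1[] s -> mu.-integrable setT (EFin \o f s).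
  move=> _; apply: (@integrable_stdpdf_bounded _ 1) => [|x]; last exact: cos_max.
  exact: measurable_cosM.
have derf s x : [set` `]t - 1, t + 1[] s -> setT x -> derivable (f ^~ x) s 1.
  by move=> _ _; have [] := D s x.
have G0 x : 0 <= `|x| * phi x by rewrite mulr_ge0 ?normal_pdf_ge0.
have Gub s x : [set` `]t - 1, t + 1[] s -> setT x -> `|partial1of2 f s x| <= `|x| * phi x.
  move=> _ _; rewrite E normrN normrM (ger0_norm (normal_pdf_ge0 _ _ _)).
  by rewrite ler_wpM2r ?normal_pdf_ge0// normrM ler_piMr ?sin_max.
apply: DeriveDef.
  exact: (derivable_under_integral measurableT tI intf derf G0 integrable_abs_stdpdf Gub).
rewrite -derive1E.
rewrite (differentiation_under_integral measurableT tI intf derf G0 integrable_abs_stdpdf Gub).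
rewrite /gaussE -mulN1r -RintegralZl//; last first.
  by apply: integrable_id_stdpdf; [exact: measurable_sinM|move=> x; exact: sin_max].
by apply: eq_Rintegral => x _; rewrite E mulN1r.
Qed.

(* The integral over R of the derivative of sin (t x) phi x vanishes. *)
Lemma gaussE_stein (t : R) :
  gaussE (fun x => x * sin (t * x)) = t * gaussE (fun x => cos (t * x)).
Proof.
pose F x := sin (t * x) * phi x.
pose F' x := t * (cos (t * x) * phi x) - x * sin (t * x) * phi x.
have DF (x : R) : is_derive x 1 F (F' x).
  have H1 := is_derive_stdpdf x.
  have H2 := is_derive_sinM t x.
  apply: is_derive_eq (is_deriveM H2 H1) _; rewrite /GRing.scale/= /F'; ring.
have cF' : continuous F'.
  have cphi := @continuous_normal_pdf R 0 1 (oner_neq0 _).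
  move=> x; apply: cvgB.
    apply: cvgM; first exact: cvg_cst.
    apply: cvgM; last exact: cphi.
    by apply: continuous_comp; [exact: mulrl_continuous|exact: continuous_cos].
  apply: cvgM; last exact: cphi.
  apply: cvgM; first exact: cvg_id.
  by apply: continuous_comp; [exact: mulrl_continuous|exact: continuous_sin].
have mF' : measurable_fun setT F' by exact: continuous_measurable_fun.
have i1 : mu.-integrable setT (EFin \o (fun x => cos (t * x) * phi x)).
  by apply: (@integrable_stdpdf_bounded _ 1); [exact: measurable_cosM|move=> x; exact: cos_max].
have i1' : mu.-integrable setT (EFin \o (fun x => t * (cos (t * x) * phi x))).
  by have := @integrableZl _ _ _ mu setT measurableT t _ i1; under eq_fun do rewrite /= -EFinM.
have i2 : mu.-integrable setT (EFin \o (fun x => x * sin (t * x) * phi x)).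
  by apply: integrable_id_stdpdf; [exact: measurable_sinM|move=> x; exact: sin_max].
have iF' : mu.-integrable setT (EFin \o F').
  by have := integrableB measurableT i1' i2; under eq_fun do rewrite /= -EFinB.
suff I0 : \int[mu]_x F' x = 0.
  move: I0; rewrite /F' RintegralB// RintegralZl// => /eqP.
  by rewrite subr_eq0 => /eqP; rewrite /gaussE => ->.
have FTC (n : nat) : \int[mu]_x ((F' \_ `[- n.+1%:R, n.+1%:R]) x) = F n.+1%:R - F (- n.+1%:R).
  rewrite -Rintegral_mkcond /Rintegral (@continuous_FTC2 _ F' F)//.
  - by rewrite gtrN.
  - exact: continuous_subspaceT.
  - have cF x : {for x, continuous F}.
      by apply: differentiable_continuous; apply/derivable1_diffP; have [] := DF x.
    split; first by move=> x _; have [] := DF x.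
      exact/cvg_at_right_filter/cF.
    exact/cvg_at_left_filter/cF.
  - by move=> x _; rewrite derive1E; have [_ ->] := DF x.
have C1 : (fun n : nat => \int[mu]_x ((F' \_ `[- n.+1%:R, n.+1%:R]) x)) @ \oo --> \int[mu]_x F' x.
  apply: fine_cvg; rewrite fineK; last exact: integrable_fin_num.
  apply: (@dominated_cvg _ _ _ mu setT measurableT _ _ (fun x => (`|F' x|)%:E)) => //.
  - by move=> n; apply/measurable_EFinP/measurable_restrict => //; exact: measurable_funTS.
  - move=> x _; apply/cvg_EFin; first exact: nearW.
    apply: cvg_near_cst; near=> n.
    rewrite /= patchE ifT// inE/= in_itv/= -ler_norml.
    apply: (@le_trans _ _ n%:R); last by rewrite ler_nat.
    by near: n; exact: nbhs_infty_ger.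
  - exact: integrable_norm.
  - by move=> n x _; rewrite /= lee_fin patchE; case: ifP => // _; rewrite normr0.
have C2 : (fun n : nat => F n.+1%:R - F (- n.+1%:R)) @ \oo --> 0.
  have cp : (fun n : nat => 2 * normal_peak 1 * n.+1%:R^-1 : R) @ \oo --> 0.
    by rewrite -[X in _ --> X](mulr0 (2 * normal_peak 1)); apply: cvgMr; exact: cvg_harmonic.
  apply/norm_cvg0P; apply: (squeeze_cvgr _ (cvg_cst 0) cp); near=> n.
  rewrite normr_ge0/=.
  have B x : `|x| = n.+1%:R -> `|F x| <= normal_peak 1 * n.+1%:R^-1.
    move=> xn; rewrite /F normrM (ger0_norm (normal_pdf_ge0 _ _ _)).
    apply: (@le_trans _ _ (phi x)); first by rewrite ler_piMl ?normal_pdf_ge0// sin_max.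
    rewrite stdpdfE ler_wpM2l ?normal_peak_ge0// mulNr expRN lef_pV2 ?posrE ?expR_gt0//.
    apply: le_trans (expR_ge1Dx _); rewrite -(real_normK (num_real x)) xn.
    have := sqr_ge0 (n.+1%:R - 1 : R); set y := n.+1%:R; nra.
  have b1 := B n.+1%:R (normr_nat _ _).
  have b2 : `|F (- n.+1%:R)| <= normal_peak 1 * n.+1%:R^-1.
    by apply: B; rewrite normrN normr_nat.
  apply: le_trans (ler_normB _ _) _.
  by apply: le_trans (lerD b1 b2) _; rewrite -mulr2n -[in leRHS]mulrA mulr_natl.
have C1' : (fun n : nat => F n.+1%:R - F (- n.+1%:R)) @ \oo --> \int[mu]_x F' x.
  by under eq_fun do rewrite -FTC.
exact: (cvg_unique _ C1' C2).
Unshelve. all: by end_near. Qed.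

Lemma gaussE_cos (t : R) : gaussE (fun x => cos (t * x)) = expR (- (t ^+ 2) / 2).
Proof.
pose g := (fun t => gaussE (fun x => cos (t * x))) * (@expR R \o (fun t => t ^+ 2 / 2)).
have Dg (s : R) : is_derive s 1 g 0.
  have H1 := is_derive_gaussE_cos s.
  have H2 : is_derive s 1 (@expR R \o (fun t => t ^+ 2 / 2)) (expR (s ^+ 2 / 2) * s).
    by apply: is_derive1_comp; exact: is_derive_half_sqr.
  apply: is_derive_eq; rewrite gaussE_stein /GRing.scale/=; ring.
have := is_derive_0_is_cst t 0 Dg; rewrite /g !fctE /= expr0n/= mul0r expR0 mulr1.
have -> : gaussE (fun x => cos (0 * x)) = 1.
  rewrite /gaussE; under eq_Rintegral do rewrite mul0r cos0 mul1r.
  by rewrite /Rintegral integral_normal_pdf.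
by move=> E; rewrite mulNr expRN; apply: (mulIf (lt0r_neq0 (expR_gt0 (t ^+ 2 / 2)))); rewrite E mulVf// gt_eqF ?expR_gt0.
Qed.

End gauss.

(** * Standard normal quantiles *)

Section gauss2.
Context {R : realType}.
Notation mu := (@lebesgue_measure R).
Notation phi := (@normal_pdf R 0 1).
Notation G := (@normal_prob R 0 1).

Lemma pr_gaussE A : measurable A -> pr G A = gaussE \1_A.
Proof.
move=> mA; rewrite /pr /gaussE /normal_prob.
rewrite -[LHS]/(\int[mu]_(x in A) phi x) Rintegral_mkcond.
apply: eq_Rintegral => x _; rewrite patchE indicE.
by case: ifP; rewrite ?mul1r ?mul0r.
Qed.

Lemma gaussE_le (f g : R -> R) C : measurable_fun setT f -> measurable_fun setT g ->
  (forall x, `|f x| <= C) -> (forall x, `|g x| <= C) -> (forall x, f x <= g x) ->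
  gaussE f <= gaussE g.
Proof.
move=> mf mg fC gC fg; apply: le_Rintegral => //.
- exact: (@integrable_stdpdf_bounded _ _ C).
- exact: (@integrable_stdpdf_bounded _ _ C).
- by move=> x _; rewrite ler_wpM2r ?normal_pdf_ge0.
Qed.

Lemma pr_gauss_itv_le (a b : R) : a <= b -> pr G `]a, b] <= normal_peak 1 * (b - a).
Proof.
move=> ab; rewrite -lee_fin -prE//.
apply: (@le_trans _ _ (\int[mu]_(x in `]a, b]) (normal_peak 1)%:E)%E).
  apply: ge0_le_integral => //.
  - by move=> x _; rewrite lee_fin normal_pdf_ge0.
  - by apply/measurable_EFinP/measurable_funTS; exact: measurable_normal_pdf.
  - by move=> x _; rewrite lee_fin normal_pdf_ub// oner_neq0.
rewrite integral_cst//= lebesgue_measure_itv/= lte_fin.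
move: ab; rewrite le_eqVlt => /predU1P[->|ab]; first by rewrite ltxx subrr mulr0 mule0.
by rewrite ab EFinM EFinB.
Qed.

Lemma Phi_sub (a b : R) : a <= b -> Phi b - Phi a = pr G `]a, b].
Proof.
move=> ab; rewrite -[Phi b]/(pr G _) -[Phi a]/(pr G _).
rewrite (@itv_bndbnd_setU _ _ -oo%O (BRight a) (BRight b))//.
rewrite pr_setU//; first by rewrite addrC addKr.
apply/seteqP; split => // x [] /=; rewrite !in_itv/= => xa /andP[].
by rewrite ltNge xa.
Qed.

Lemma Phi_le (a b : R) : a <= b -> Phi a <= Phi b.
Proof. by move=> ab; rewrite -subr_ge0 Phi_sub// pr_ge0. Qed.

Lemma pr_gauss1 (a : R) : pr G [set a] = 0.
Proof. by rewrite -[LHS]/(\int[mu]_(x in [set a]) phi x) Rintegral_set1. Qed.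

Lemma Phi_opp (x : R) : Phi (- x) = 1 - Phi x.
Proof.
have E : Phi (- x) = pr G `[x, +oo[.
  rewrite /Phi /pr /normal_prob ge0_integration_by_substitutionNy.
  - by congr fine; apply: eq_integral => y _ /=; rewrite stdpdf_even.
  - by apply: continuous_subspaceT; apply: continuous_normal_pdf; exact: oner_neq0.
  - by move=> y _; exact: normal_pdf_ge0.
rewrite E -[Phi x]/(pr G _) -pr_setC// setCitvl.
rewrite -(@setU1itv _ _ +oo%O x false)// pr_setU// ?pr_gauss1 ?add0r//.
by apply/seteqP; split => // y [/= ->]; rewrite in_itv/= ltxx.
Qed.

Lemma pr_gauss_sym (z : R) : 0 < z -> pr G `]-z, z[ = 2 * Phi z - 1.
Proof.
move=> z0; have zz : - z < z by rewrite gtrN.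
have := Phi_sub (ltW zz); rewrite Phi_opp -(@setUitv1 _ _ (BRight (- z)) z true)//.
rewrite pr_setU// ?pr_gauss1; first by lra.
by apply/seteqP; split => // y [/= + yz]; rewrite yz in_itv/= ltxx andbF.
Qed.

Definition gauss_abs1 : R := \int[mu]_x (`|x| * phi x).

Lemma gauss_abs1_ge0 : 0 <= gauss_abs1.
Proof. by apply: Rintegral_ge0 => x _; rewrite mulr_ge0// normal_pdf_ge0. Qed.

Lemma measurable_abs_ge (L : R) : measurable [set x : R | L <= `|x|].
Proof. by apply: (@measurable_ge_fun _ _ R (fun x : R => `|x|)); exact: normr_measurable. Qed.

Lemma pr_gauss_tail (L : R) : 0 < L -> pr G [set x | L <= `|x|] <= gauss_abs1 / L.
Proof.
move=> L0.
have mA := measurable_abs_ge L.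
rewrite ler_pdivlMr// mulrC pr_gaussE// /gaussE -RintegralZl//; last first.
  apply: (@integrable_stdpdf_bounded _ _ 1); first exact: measurable_indic.
  by move=> x; rewrite indicE normr_nat lern1 leq_b1.
apply: le_Rintegral => //.
- have : mu.-integrable setT (EFin \o (fun x => (L * \1_[set x : R | L <= `|x|] x) * phi x)).
    apply: (@integrable_stdpdf_bounded _ _ L) => [|x].
      by apply: measurable_funM => //; exact: measurable_indic.
    rewrite indicE; case: (_ \in _); rewrite ?mulr1 ?mulr0 ?normr0 ?gtr0_norm//; exact: ltW.
  by apply: eq_integrable => // x _ /=; rewrite mulrA.
- exact: integrable_abs_stdpdf.
move=> x _; rewrite mulrA ler_wpM2r ?normal_pdf_ge0//.
by rewrite indicE; have [|_] := boolP (x \in _); rewrite ?inE ?mulr1 ?mulr0.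
Qed.

Lemma Phi_lt1 (x : R) : Phi x < 1.
Proof.
apply: (@lt_le_trans _ _ (Phi (x + 1))); last by apply: pr_le1.
rewrite -subr_gt0 Phi_sub ?lerDl//.
set c := normal_peak 1 * expR (- ((`|x| + 1) ^+ 2) / 2) : R.
have c0 : 0 < c by rewrite mulr_gt0 ?expR_gt0// normal_peak_gt0// oner_neq0.
apply: (lt_le_trans c0); rewrite -lee_fin -prE//.
apply: (@le_trans _ _ (\int[mu]_(x in `]x, (x + 1)%R]) c%:E)%E).
  rewrite integral_cst//= lebesgue_measure_itv/= lte_fin ltrDl ltr01.
  by rewrite -EFinB -EFinM addrAC subrr add0r mulr1.
apply: ge0_le_integral => //.
- by move=> y _; rewrite lee_fin ltW.
- by apply/measurable_EFinP/measurable_funTS; exact: measurable_normal_pdf.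
- move=> y /=; rewrite in_itv/= => /andP[xy yx]; rewrite lee_fin stdpdfE.
  rewrite ler_wpM2l ?normal_peak_ge0// ler_expR !mulNr lerN2.
  rewrite ler_pM2r ?invr_gt0// -(real_normK (num_real y)).
  rewrite lerXn2r ?nnegrE ?addr_ge0//.
  rewrite ler_norml; have := ler_norm x; have := ler_norm (- x); rewrite normrN; lra.
Qed.

Lemma zq0 : zq (0 : R) = +oo%E.
Proof.
rewrite /zq (_ : [set _ | _] = set0) ?image_set0 ?ereal_inf0//.
apply/seteqP; split => // x /=; rewrite subr0 leNgt.
by rewrite Phi_lt1.
Qed.

Lemma zqP (a : R) : 0 < a < 1 ->
  exists z, [/\ 0 < z, zq (a / 2) = z%:E & pr G `]-z, z[ = 1 - a].
Proof.
move=> /andP[a0 a1].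
pose S := [set x : R | 1 - a / 2 <= Phi x].
have Phi0 : Phi (0 : R) = 1 / 2 by have := Phi_opp 0; rewrite oppr0; lra.
have Slb : lbound S 0.
  move=> x /=; rewrite /S/= => Sx; rewrite leNgt; apply/negP => x0.
  by have := Phi_le (ltW x0); lra.
have C0 : 0 < normal_peak 1 :> R by rewrite normal_peak_gt0// oner_neq0.
have g0 := gauss_abs1_ge0.
have S0 : S !=set0.
  pose b := (2 * gauss_abs1 / a) + 1.
  have b0 : 0 < b by rewrite ltr_wpDl// divr_ge0// ?mulr_ge0// ltW.
  exists b; rewrite /S/=.
  suff : 1 - Phi b <= a / 2 by lra.
  apply: (@le_trans _ _ (gauss_abs1 / b)); last first.
    rewrite ler_pdivrMr// mulrDr mulr1 mulrA.
    rewrite (_ : a / 2 * (2 * gauss_abs1) / a = gauss_abs1); first by lra.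
    by field; exact: lt0r_neq0.
  apply: le_trans (pr_gauss_tail b0).
  rewrite -[Phi b]/(pr G _) -pr_setC//; apply: pr_le; first exact: measurableC.
    exact: measurable_abs_ge.
  move=> y /=; rewrite in_itv/= => /negP; rewrite -ltNge => /ltW yb.
  by rewrite (le_trans yb)// ler_norm.
have hS : has_inf S by split => //; exists 0.
pose z := inf S.
have Ez : zq (a / 2) = z%:E.
  by rewrite /zq ereal_inf_EFin//; exists 0.
have z0 : 0 <= z by exact: lb_le_inf.
have lip (x y : R) : x <= y -> Phi y - Phi x <= normal_peak 1 * (y - x).
  by move=> xy; rewrite Phi_sub// pr_gauss_itv_le.
have Pz : Phi z = 1 - a / 2.
  apply/eqP; rewrite eq_le; apply/andP; split; apply/ler_addgt0Pr => e e0.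
    have e1 : 0 < e / normal_peak 1 by rewrite divr_gt0.
    have : Phi (z - e / normal_peak 1) < 1 - a / 2.
      rewrite ltNge; apply/negP => zS.
      have := inf_lbound (proj2 hS) zS; rewrite -/z; lra.
    have := lip (z - e / normal_peak 1) z; rewrite gerBl => /(_ (ltW e1)).
    rewrite (_ : normal_peak 1 * _ = e); last by field; exact: lt0r_neq0.
    lra.
  have e1 : 0 < e / normal_peak 1 by rewrite divr_gt0.
  have [x Sx xz] := inf_adherent e1 hS.
  have zx : z <= x by exact: (inf_lbound (proj2 hS)).
  have := lip _ _ zx; have : normal_peak 1 * (x - z) <= e.
    by rewrite mulrC -ler_pdivlMr// lerBlDl ltW.
  by move: Sx; rewrite /S/=; lra.
have zp : 0 < z.
  rewrite lt_neqAle z0 andbT; apply/eqP => zE; move: Pz; rewrite -zE Phi0; lra.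
by exists z; split=> //; rewrite pr_gauss_sym// Pz; lra.
Qed.

Lemma pr_gauss_sym_le (z z' : R) : 0 < z -> z <= z' ->
  pr G `]-z', z'[ <= pr G `]-z, z[ + 2 * normal_peak 1 * (z' - z).
Proof.
move=> z0 zz; rewrite !pr_gauss_sym//; last exact: lt_le_trans zz.
have : Phi z' - Phi z <= normal_peak 1 * (z' - z).
  by rewrite Phi_sub// pr_gauss_itv_le.
lra.
Qed.

End gauss2.

(** * Taylor bounds *)

Section taylor.
Context {R : realType}.

Lemma pow4_norm (x : R) : x ^+ 4 = `|x| ^+ 4.
Proof. by rewrite (_ : 4 = 2 * 2)%N// !exprM real_normK// num_real. Qed.

Lemma ge0_is_derive (f f' : R -> R) : (forall x : R, is_derive x 1 f (f' x)) ->
  (forall x, 0 <= x -> 0 <= f' x) -> f 0 = 0 -> forall x, 0 <= x -> 0 <= f x.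
Proof.
move=> D f'0 f0 x x0; rewrite -f0.
apply: (@ger0_derive1_ndecr R f 0 x) => //.
- move=> y; rewrite in_itv/= => /andP[/ltW y0 _].
  by rewrite derive1E; have [_ ->] := D y; exact: f'0.
- apply: continuous_subspaceT => y; apply: differentiable_continuous.
  by apply/derivable1_diffP; have [] := D y.
Qed.

Lemma is_derive_monomial (n : nat) (x : R) :
  is_derive x 1 (fun y : R => y ^+ n.+1) (n.+1%:R * x ^+ n).
Proof.
elim: n => [|n IH].
  by rewrite expr0 mulr1; exact: is_derive_id.
have -> : (fun y : R => y ^+ n.+2) = id * (fun y : R => y ^+ n.+1).
  by apply/funext => y; rewrite exprS.
apply: is_derive_eq (is_deriveM (is_derive_id x 1) IH) _.
rewrite /GRing.scale/= mulr1 mulrCA -exprS -[in RHS]natr1 mulrDl mul1r//.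
Qed.

Lemma is_derive_addf (f g : R -> R) (x df dg : R) :
  is_derive x 1 f df -> is_derive x 1 g dg ->
  is_derive x 1 (fun y => f y + g y) (df + dg).
Proof. exact: is_deriveD. Qed.

Lemma is_derive_oppf (f : R -> R) (x df : R) :
  is_derive x 1 f df -> is_derive x 1 (fun y => - f y) (- df).
Proof. exact: is_deriveN. Qed.

Lemma is_derive_cstf (c x : R) : is_derive x 1 (fun=> c) (0 : R).
Proof. exact: is_derive_cst. Qed.

Lemma sin_le (x : R) : 0 <= x -> sin x <= x.
Proof.
move=> x0; rewrite -subr_ge0.
apply: (@ge0_is_derive (fun x => x - sin x) (fun x => 1 - cos x)) => //.
- by rewrite sin0 subr0.
Qed.

Lemma cos_ge (x : R) : 0 <= x -> 1 - x ^+ 2 / 2 <= cos x.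
Proof.
move=> x0; suff : 0 <= cos x + (-1 + 2^-1 * x ^+ 2) by lra.
apply: (@ge0_is_derive (fun x => cos x + (-1 + 2^-1 * x ^+ 2))
  (fun x => - sin x + (0 + 2^-1 * (2 * x ^+ 1))) _ _ _ x x0).
- move=> y; exact: (is_derive_addf (is_derive_cos y) (is_derive_addf (is_derive_cstf (-1) y)
    (is_derive_mulrl 2^-1 (is_derive_monomial 1 y)))).
- by move=> y y0; have := sin_le y0; rewrite expr1; lra.
- by rewrite cos0 expr0n/= mulr0 addr0 subrr.
Qed.

Lemma sin_ge (x : R) : 0 <= x -> x - x ^+ 3 / 6 <= sin x.
Proof.
move=> x0; suff : 0 <= sin x + (- x + 6^-1 * x ^+ 3) by lra.
apply: (@ge0_is_derive (fun x => sin x + (- x + 6^-1 * x ^+ 3))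
  (fun x => cos x + (- 1 + 6^-1 * (3 * x ^+ 2))) _ _ _ x x0).
- move=> y; exact: (is_derive_addf (is_derive_sin y) (is_derive_addf (is_derive_oppf (is_derive_id y 1))
    (is_derive_mulrl 6^-1 (is_derive_monomial 2 y)))).
- by move=> y y0; have := cos_ge y0; lra.
- by rewrite sin0 oppr0 expr0n/= mulr0 !addr0.
Qed.

Lemma cos_le (x : R) : 0 <= x -> cos x <= 1 - x ^+ 2 / 2 + x ^+ 4 / 24.
Proof.
move=> x0; suff : 0 <= - cos x + (1 + (- 2^-1 * x ^+ 2 + 24^-1 * x ^+ 4)) by lra.
apply: (@ge0_is_derive (fun x => - cos x + (1 + (- 2^-1 * x ^+ 2 + 24^-1 * x ^+ 4)))
  (fun x => - - sin x + (0 + (- 2^-1 * (2 * x ^+ 1) + 24^-1 * (4 * x ^+ 3)))) _ _ _ x x0).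
- move=> y; exact: (is_derive_addf (is_derive_oppf (is_derive_cos y)) (is_derive_addf (is_derive_cstf 1 y)
      (is_derive_addf (is_derive_mulrl (- 2^-1) (is_derive_monomial 1 y))
  (is_derive_mulrl 24^-1 (is_derive_monomial 3 y))))).
- by move=> y y0; have := sin_ge y0; rewrite expr1; lra.
- by rewrite cos0 !expr0n/= !mulr0 !addr0 addNr.
Qed.

Lemma expRN_le (x : R) : 0 <= x -> expR (- x) <= 1 - x + x ^+ 2 / 2.
Proof.
move=> x0; suff : 0 <= - expR (- x) + (1 + (- x + 2^-1 * x ^+ 2)) by lra.
have D (y : R) : is_derive y 1 (fun x => expR (- x)) (- expR (- y)).
  have H : is_derive y 1 (@GRing.opp R) (-1) by exact: (is_derive_oppf (is_derive_id y 1)).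
  have : is_derive y 1 (expR \o (fun x => - x)) (expR (- y) * - 1) by exact: is_derive1_comp.
  by move=> h; apply: is_derive_eq h _; rewrite mulrN1.
apply: (@ge0_is_derive (fun x => - expR (- x) + (1 + (- x + 2^-1 * x ^+ 2)))
  (fun x => - - expR (- x) + (0 + (- 1 + 2^-1 * (2 * x ^+ 1)))) _ _ _ x x0).
- move=> y; exact: (is_derive_addf (is_derive_oppf (D y)) (is_derive_addf (is_derive_cstf 1 y)
    (is_derive_addf (is_derive_oppf (is_derive_id y 1)) (is_derive_mulrl 2^-1 (is_derive_monomial 1 y))))).
- by move=> y y0; have := expR_ge1Dx (- y); rewrite expr1; lra.
- by rewrite oppr0 expR0 expr0n/= mulr0 !addr0 addNr.
Qed.

Lemma cos_taylor (x : R) : `|cos x - (1 - x ^+ 2 / 2)| <= x ^+ 4 / 24.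
Proof.
rewrite -cos_norm -(real_normK (num_real x)) pow4_norm.
have := cos_ge (normr_ge0 x); have := cos_le (normr_ge0 x).
have : 0 <= `|x| ^+ 4 by rewrite exprn_ge0.
rewrite ler_norml; lra.
Qed.

Lemma sin_taylor (x : R) : `|sin x - x| <= `|x| ^+ 3.
Proof.
wlog x0 : x / 0 <= x.
  move=> H; have [/H//|/ltW x0] := leP 0 x.
  have := H (- x); rewrite oppr_ge0 => /(_ x0).
  by rewrite sinN -opprD !normrN.
rewrite (ger0_norm x0).
have := sin_ge x0; have := sin_le x0; have : 0 <= x ^+ 3 by rewrite exprn_ge0.
rewrite ler_norml; lra.
Qed.

Lemma expRN_taylor (x : R) : 0 <= x -> `|expR (- x) - (1 - x)| <= x ^+ 2 / 2.
Proof.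
move=> x0; have := expRN_le x0; have := expR_ge1Dx (- x).
have : 0 <= x ^+ 2 by rewrite exprn_ge0.
rewrite ler_norml; lra.
Qed.

End taylor.

(** * Products of independent variables *)

Section step_approx.
Context {R : realType}.

(* [h] is uniformly approximated by the step functions obtained by rounding (h + 1) N down. *)
Lemma step_approx (h : R -> R) (N : nat) : measurable_fun setT h ->
  (forall x, `|h x| <= 1) -> (0 < N)%N ->
  exists (a : nat -> R) (B : nat -> set R), (forall j, measurable (B j)) /\
    forall x, `|h x - \sum_(j < (2 * N).+1) a j * \1_(B j) x| <= N%:R^-1.
Proof.
move=> mh h1 N0.
have NR : 0 < N%:R :> R by rewrite ltr0n.
exists (fun j => j%:R / N%:R - 1).
exists (fun j => (fun x => (h x + 1) * N%:R) @^-1` `[j%:R, j.+1%:R[).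
split=> [j|x].
  rewrite -[X in measurable X]setTI.
  have mf : measurable_fun setT (fun x => (h x + 1) * N%:R).
    by apply: measurable_funM => //; apply: measurable_funD.
  exact: mf.
set y := (h x + 1) * N%:R.
have y0 : 0 <= y.
  apply: mulr_ge0; last exact: ltW.
  by have := h1 x; rewrite ler_norml => /andP[+ _]; lra.
have yN : y < (2 * N).+1%:R.
  rewrite -natr1 natrM; apply: (@le_lt_trans _ _ (2 * N%:R)); last by rewrite ltrDl.
  rewrite /y ler_pM2r//; have := h1 x; rewrite ler_norml => /andP[_]; lra.
have /andP[t1 t2] := truncn_itv y0.
set t := Num.truncn y in t1 t2 *.
have tN : (t < (2 * N).+1)%N.
  by rewrite -(ltr_nat R); apply: le_lt_trans yN.
rewrite (bigD1 (Ordinal tN))//= big1 ?addr0 => [|j jt].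
  rewrite indicE mem_set ?mulr1; last by rewrite /= in_itv/= t1.
  have -> : h x - (t%:R / N%:R - 1) = (y - t%:R) / N%:R.
    by rewrite /y; field; exact: lt0r_neq0.
  rewrite normrM normfV (ger0_norm (ltW NR)) ler_piMl ?invr_ge0 ?(ltW NR)//.
  by rewrite ger0_norm ?subr_ge0// lerBlDl; rewrite -natr1 in t2; exact: ltW.
rewrite indicE memNset ?mulr0//= in_itv/= => /andP[j1 j2].
move/negP: jt; apply; rewrite -val_eqE/= eqn_leq.
apply/andP; split.
  by rewrite -ltnS -(ltr_nat R); apply: le_lt_trans t2.
by rewrite -ltnS -(ltr_nat R); apply: le_lt_trans j2.
Qed.

End step_approx.

Section indep.
Context d (T : measurableType d) (R : realType) (P : probability T R).
Notation Ex := (Ex P).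
Notation itg := (itg P).

Lemma measT_comp (f : R -> R) (X : T -> R) : measurable_fun setT f ->
  measurable_fun setT X -> measurable_fun setT (fun w => f (X w)).
Proof. by move=> mf mX; exact: measurableT_comp. Qed.

(* Both sides are linear in [h] and continuous for the uniform norm: step functions suffice. *)
Lemma indep_step (X W : T -> R) (c : R) : measurable_fun setT X ->
  measurable_fun setT W -> (forall w, `|W w| <= 1) -> `|c| <= 1 ->
  (forall B : set R, measurable B ->
    Ex (fun w => \1_B (X w) * W w) = Ex (fun w => \1_B (X w)) * c) ->
  forall h : R -> R, measurable_fun setT h -> (forall x, `|h x| <= 1) ->
  Ex (fun w => h (X w) * W w) = Ex (fun w => h (X w)) * c.
Proof.
move=> mX mW W1 c1 H h mh h1.
have mhX := measT_comp mh mX.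
have iW : itg W by exact: itg_bounded W1.
have ihX : itg (fun w => h (X w)) by apply: (@itg_bounded _ _ _ P _ 1).
have ihW : itg (fun w => h (X w) * W w).
  apply: (@itg_bounded _ _ _ P _ 1); first exact: measurable_funM.
  by move=> w; rewrite normrM mulr_ile1.
suff K (N : nat) : (0 < N)%N ->
    `|Ex (fun w => h (X w) * W w) - Ex (fun w => h (X w)) * c| <= 2 * N%:R^-1.
  apply/eqP; rewrite -subr_eq0 -normr_le0; apply/ler_addgt0Pr => e e0; rewrite add0r.
  pose N := (Num.truncn (2 / e)).+1.
  apply: le_trans (K N isT) _.
  have : 2 / e < N%:R by exact: truncnS_gt.
  by rewrite ltr_pdivrMr// mulrC => /ltW; rewrite -ler_pdivrMr// ltr0n.
move=> N0; have NR : 0 <= N%:R^-1 :> R by rewrite invr_ge0.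
have [a [B [mB hB]]] := step_approx mh h1 N0.
pose f x := \sum_(j < (2 * N).+1) a j * \1_(B j) x.
have iB j : itg (fun w => \1_(B j) (X w)).
  apply: (@itg_bounded _ _ _ P _ 1).
    by apply: (measT_comp _ mX); exact: measurable_indic.
  by move=> w; rewrite indicE normr_nat lern1 leq_b1.
have iBW j : itg (fun w => \1_(B j) (X w) * W w).
  apply: (@itg_bounded _ _ _ P _ 1).
    by apply: measurable_funM => //; exact: itg_meas (iB j).
  by move=> w; rewrite indicE normrM mulr_ile1// normr_nat lern1 leq_b1.
have ifX : itg (fun w => f (X w)) by apply: itg_sum => j; exact/itgZ/iB.
have E1 : (fun w => f (X w) * W w) = (fun w => \sum_(j < (2 * N).+1) a j * (\1_(B j) (X w) * W w)).
  by apply/funext => w; rewrite /f mulr_suml; under eq_bigr do rewrite -mulrA.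
have ifW : itg (fun w => f (X w) * W w).
  by rewrite E1; apply: itg_sum => j; exact/itgZ/iBW.
have Ef : Ex (fun w => f (X w) * W w) = Ex (fun w => f (X w)) * c.
  rewrite E1 Ex_sum => [|j]; last exact/itgZ/iBW.
  rewrite Ex_sum => [|j]; last exact/itgZ/iB.
  rewrite mulr_suml; apply: eq_bigr => j _.
  by rewrite !ExZ// H// mulrA.
have -> : Ex (fun w => h (X w) * W w) - Ex (fun w => h (X w)) * c =
   Ex (fun w => h (X w) * W w - f (X w) * W w) - Ex (fun w => h (X w) - f (X w)) * c.
  by rewrite !ExB// Ef; ring.
apply: le_trans (ler_normB _ _) _; rewrite mulr_natl mulr2n; apply: lerD.
  apply: le_trans (normr_Ex (itgB ihW ifW)) _.
  rewrite -[leRHS](Ex_cst P); apply: le_Ex; first exact/itg_norm/itgB.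
    exact: itg_cst.
  by move=> w; rewrite -mulrBl normrM -[leRHS]mulr1 ler_pM.
rewrite normrM -[leRHS]mulr1 ler_pM//.
apply: le_trans (normr_Ex (itgB ihX ifX)) _.
rewrite -[leRHS](Ex_cst P); apply: le_Ex; first exact/itg_norm/itgB.
  exact: itg_cst.
by move=> w.
Qed.

Variables (I : set nat) (X : nat -> T -> R).
Hypothesis mX : forall i, I i -> measurable_fun setT (X i).
Hypothesis indX : mutual_indep P I X.

Let prod_bound (s : seq nat) (g : nat -> T -> R) w :
  (forall i, `|g i w| <= 1) -> `|\prod_(i <- s) g i w| <= 1.
Proof.
move=> g1; rewrite normr_prod; elim: s => [|i s IH]; first by rewrite big_nil.
by rewrite big_cons mulr_ile1// prodr_ge0.
Qed.

Lemma meas_prod (s : seq nat) (g : nat -> T -> R) :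
  (forall i, i \in s -> measurable_fun setT (g i)) ->
  measurable_fun setT (fun w => \prod_(i <- s) g i w).
Proof.
elim: s => [|i s IH] mg.
  by under eq_fun do rewrite big_nil; exact: measurable_cst.
under eq_fun do rewrite big_cons.
apply: measurable_funM; first by apply: mg; rewrite mem_head.
by apply: IH => j js; apply: mg; rewrite inE js orbT.
Qed.

Lemma indep_indic (s : seq nat) (B : nat -> set R) : uniq s ->
  (forall i, i \in s -> I i) -> (forall i, measurable (B i)) ->
  Ex (fun w => \prod_(i <- s) \1_(B i) (X i w)) =
  \prod_(i <- s) Ex (fun w => \1_(B i) (X i w)).
Proof.
move=> us sI mB.
have mXB i : i \in s -> measurable (X i @^-1` B i).
  by move=> /sI Ii; rewrite -[X in measurable X]setTI; apply: (mX Ii).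
have -> : (fun w => \prod_(i <- s) \1_(B i) (X i w)) =
    \1_(\bigcap_(i in [set j | j \in s]) (X i @^-1` B i)) :> (T -> R).
  apply/funext => w; rewrite indicE.
  have [/[!inE] wI|/negP wI] := boolP (w \in _).
    rewrite big_seq big1// => i si; rewrite indicE mem_set//; exact: wI.
  have : ~~ all (fun i => `[<B i (X i w)>]) s.
    apply/negP => /allP H; apply: wI; rewrite inE => i/= /H /asboolP; exact.
  rewrite -has_predC => /hasP[i si /= /asboolP nB].
  by rewrite (big_rem i)//= indicE memNset ?mul0r.
rewrite Ex_indic; last first.
  by rewrite bigcap_seq big_seq; apply: bigsetI_measurable => i /mXB.
rewrite /pr indX// -[LHS]/(fine _).
have -> : (\prod_(i <- s) P (X i @^-1` B i))%E =
    (\prod_(i <- s) Ex (fun w => \1_(B i) (X i w)))%:E.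
  rewrite -prodEFin big_seq [RHS]big_seq; apply: eq_bigr => i si.
  have -> : (fun w => \1_(B i) (X i w)) = \1_(X i @^-1` B i) :> (T -> R).
    by apply/funext => w; rewrite !indicE; congr ((_ : bool)%:R); apply/idP/idP; rewrite !inE.
  by rewrite Ex_indic ?prE//; exact: mXB.
by [].
Qed.

(* The indicators in [s2] are turned one by one into arbitrary functions by [indep_step]. *)
Lemma indep_mixed (s1 s2 : seq nat) (h : nat -> R -> R) (B : nat -> set R) :
  uniq (s1 ++ s2) -> (forall i, i \in s1 ++ s2 -> I i) ->
  (forall i, measurable_fun setT (h i)) -> (forall i x, `|h i x| <= 1) ->
  (forall i, measurable (B i)) ->
  Ex (fun w => \prod_(i <- s1) h i (X i w) * \prod_(i <- s2) \1_(B i) (X i w)) =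
  \prod_(i <- s1) Ex (fun w => h i (X i w)) *
  \prod_(i <- s2) Ex (fun w => \1_(B i) (X i w)).
Proof.
move=> us sI mh h1.
elim: s1 s2 us sI B => [|i s1 IH] s2 us sI B mB.
  rewrite big_nil mul1r -indep_indic//.
  by congr Ex; apply/funext => w; rewrite big_nil mul1r.
have ind1 (A : set R) (x : R) : `|\1_A x : R| <= 1.
  by rewrite indicE normr_nat lern1 leq_b1.
have mI j : j \in s1 ++ s2 -> measurable_fun setT (X j).
  by move=> js; apply: mX; apply: sI; rewrite inE js orbT.
pose W w := \prod_(j <- s1) h j (X j w) * \prod_(j <- s2) \1_(B j) (X j w).
pose c := \prod_(j <- s1) Ex (fun w => h j (X j w)) *
  \prod_(j <- s2) Ex (fun w => \1_(B j) (X j w)).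
have mhX j : j \in s1 -> measurable_fun setT (fun w => h j (X j w)).
  by move=> js; apply: measT_comp (mh j) _; apply: mI; rewrite mem_cat js.
have mBX j : j \in s2 -> measurable_fun setT (fun w => \1_(B j) (X j w) : R).
  by move=> js; apply: measT_comp; [exact: measurable_indic|apply: mI; rewrite mem_cat js orbT].
have mW : measurable_fun setT W by apply: measurable_funM; exact: meas_prod.
have W1 w : `|W w| <= 1.
  rewrite normrM mulr_ile1//.
    by apply: (@prod_bound s1 (fun j w => h j (X j w)) w) => j.
  by apply: (@prod_bound s2 (fun j w => \1_(B j) (X j w)) w) => j.
have EW : Ex W = c.
  apply: IH => //; first by case/andP: us.
  by move=> j js; apply: sI; rewrite inE js orbT.
have c1 : `|c| <= 1.
  have iW : itg W by exact: itg_bounded W1.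
  rewrite -EW; apply: le_trans (normr_Ex iW) _.
  rewrite -[leRHS](Ex_cst P); apply: le_Ex => //; first exact: itg_norm.
  exact: itg_cst.
have mXi : measurable_fun setT (X i) by apply: mX; apply: sI; rewrite mem_head.
have step := @indep_step (X i) W c mXi mW W1 c1 _ (h i) (mh i) (h1 i).
transitivity (Ex (fun w => h i (X i w) * W w)).
  by congr Ex; apply/funext => w; rewrite big_cons /W -mulrA.
rewrite step; first by rewrite /c big_cons mulrA.
move=> B0 mB0.
pose B' j := if j == i then B0 else B j.
have nis2 j : j \in s2 -> (j == i) = false.
  move=> js; apply: contraTF us => /eqP ji.
  by rewrite /= -ji mem_cat js orbT.
have B'i : B' i = B0 by rewrite /B' eqxx.
transitivity (Ex (fun w => \prod_(j <- s1) h j (X j w) * \prod_(j <- i :: s2) \1_(B' j) (X j w))).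
  congr Ex; apply/funext => w; rewrite /W big_cons B'i [RHS]mulrCA; congr (_ * (_ * _)).
  by apply: eq_big_seq => j /nis2 ji; rewrite /B' ji.
rewrite IH.
- rewrite big_cons B'i mulrCA /c; congr (_ * (_ * _)).
  by apply: eq_big_seq => j /nis2 ji; rewrite /B' ji.
- by rewrite -[i :: s2]cat1s uniq_catCA.
- by move=> j; rewrite mem_cat inE orbCA -mem_cat -in_cons; exact: sI.
- by move=> j; rewrite /B'; case: ifP.
Qed.

Lemma indep_prod (s : seq nat) (h : nat -> R -> R) :
  uniq s -> (forall i, i \in s -> I i) ->
  (forall i, measurable_fun setT (h i)) -> (forall i x, `|h i x| <= 1) ->
  Ex (fun w => \prod_(i <- s) h i (X i w)) = \prod_(i <- s) Ex (fun w => h i (X i w)).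
Proof.
move=> us sI mh h1.
have := @indep_mixed s [::] h (fun=> setT); rewrite cats0 big_nil mulr1 => <- //.
by congr Ex; apply/funext => w; rewrite big_nil mulr1.
Qed.

Lemma Ex_cvg (Y_ : nat -> T -> R) (Y Z : T -> R) :
  (forall n, measurable_fun setT (Y_ n)) -> itg Z ->
  (forall n w, `|Y_ n w| <= Z w) -> (forall w, \forall n \near \oo, Y_ n w = Y w) ->
  (fun n => Ex (Y_ n)) @ \oo --> Ex Y.
Proof.
move=> mY iZ YZ Yc.
have cv w : (EFin \o Y_ ^~ w) @ \oo --> (Y w)%:E.
  by apply/cvg_EFin; [exact: nearW|apply: cvg_near_cst; exact: Yc].
have YZ' w : `|Y w| <= Z w.
  have [n _ /(_ n (leqnn n)) <-] := Yc w; exact: YZ.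
have mYl : measurable_fun setT (EFin \o Y).
  by apply: (@emeasurable_fun_cvg _ _ _ _ (fun n => EFin \o Y_ n)) => [n|w _];
    [exact/measurable_EFinP|exact: cv].
have iY : itg Y by apply: itg_le YZ' => //; exact/measurable_EFinP.
apply: fine_cvg; rewrite fineK; last exact: integrable_fin_num.
apply: (@dominated_cvg _ _ _ P setT measurableT _ _ (EFin \o Z)) => //.
- by move=> n; exact/measurable_EFinP.
- by move=> w _; exact: cv.
- by move=> n w _; rewrite /= lee_fin.
Qed.

Lemma indep_mul (i j : nat) (f g : R -> R) : i != j -> I i -> I j ->
  measurable_fun setT f -> measurable_fun setT g ->
  itg (fun w => f (X i w) ^+ 2) -> itg (fun w => g (X j w) ^+ 2) ->
  Ex (fun w => f (X i w) * g (X j w)) = Ex (fun w => f (X i w)) * Ex (fun w => g (X j w)).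
Proof.
move=> ij Ii Ij mf mg if2 ig2.
pose t (f : R -> R) (n : nat) (x : R) := (if `|f x| <= n.+1%:R then f x else 0).
have mt (f' : R -> R) n : measurable_fun setT f' -> measurable_fun setT (t f' n).
  move=> mf'; apply: measurable_fun_ifT => //.
  by apply: measurable_fun_ler => //; exact: measurableT_comp.
have t_le f' n x : `|t f' n x| <= `|f' x| by rewrite /t; case: ifP; rewrite ?normr0.
have t_bd f' n x : `|n.+1%:R^-1 * t f' n x| <= 1.
  rewrite normrM ger0_norm ?invr_ge0// mulrC ler_pdivrMr ?ltr0n// mul1r.
  by rewrite /t; case: ifP => //; rewrite normr0.
have t_cv f' x : \forall n \near \oo, t f' n x = f' x.
  near=> n; rewrite /t ifT//; apply: (@le_trans _ _ n%:R); last by rewrite ler_nat.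
  by near: n; exact: nbhs_infty_ger.
have mXi := mX Ii; have mXj := mX Ij.
have sq_le (a : R) : `|a| <= 1 + a ^+ 2.
  by rewrite -(real_normK (num_real a)); have := sqr_ge0 (`|a| - 1); have := normr_ge0 a; set y := `|a|; nra.
have dom (f' : R -> R) k : measurable_fun setT f' -> measurable_fun setT (X k) ->
    itg (fun w => f' (X k w) ^+ 2) ->
    (fun n => Ex (fun w => t f' n (X k w))) @ \oo --> Ex (fun w => f' (X k w)).
  move=> mf' mXk if'; apply: (@Ex_cvg _ _ (fun w => 1 + f' (X k w) ^+ 2)) => //.
  - by move=> n; exact: measT_comp (mt _ _ mf') mXk.
  - exact: itgD (itg_cst P 1) if'.
  - by move=> n w; apply: le_trans (t_le _ _ _) _.
have C1 : (fun n => Ex (fun w => t f n (X i w)) * Ex (fun w => t g n (X j w))) @ \oo -->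
    Ex (fun w => f (X i w)) * Ex (fun w => g (X j w)).
  exact: cvgM (dom f i mf mXi if2) (dom g j mg mXj ig2).
have C2 : (fun n => Ex (fun w => t f n (X i w) * t g n (X j w))) @ \oo -->
    Ex (fun w => f (X i w) * g (X j w)).
  apply: (@Ex_cvg _ _ (fun w => f (X i w) ^+ 2 + g (X j w) ^+ 2)) => //.
  - by move=> n; apply: measurable_funM; [exact: measT_comp (mt _ _ mf) mXi|exact: measT_comp (mt _ _ mg) mXj].
  - exact: itgD.
  - move=> n w; rewrite normrM.
    apply: (@le_trans _ _ (`|f (X i w)| * `|g (X j w)|)); first by rewrite ler_pM.
    rewrite -(real_normK (num_real (f (X i w)))) -(real_normK (num_real (g (X j w)))).
    have := sqr_ge0 (`|f (X i w)| - `|g (X j w)|).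
    have := normr_ge0 (f (X i w)); have := normr_ge0 (g (X j w)).
    set a := `|_|; set b := `|_|; nra.
  - move=> w; near=> n; congr (_ * _); near: n; exact: t_cv.
suff E n : Ex (fun w => t f n (X i w) * t g n (X j w)) =
    Ex (fun w => t f n (X i w)) * Ex (fun w => t g n (X j w)).
  move: C2; rewrite (funext E) => C2; exact: (cvg_unique _ C2 C1).
pose h k x := n.+1%:R^-1 * t (if k == i then f else g) n x.
have hi : (if i == i then f else g) = f by rewrite eqxx.
have hj : (if j == i then f else g) = g by rewrite eq_sym (negbTE ij).
have := @indep_prod [:: i; j] h; rewrite /= inE ij => /(_ isT).
have iT (f' : R -> R) k : measurable_fun setT f' -> measurable_fun setT (X k) ->
    itg (fun w => t f' n (X k w)).
  move=> mf' mXk; apply: (@itg_bounded _ _ _ P _ n.+1%:R).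
    exact: measT_comp (mt _ _ mf') mXk.
  by move=> w; rewrite /t; case: ifP => //; rewrite normr0.
have H1 k : k \in [:: i; j] -> I k by rewrite !inE => /orP[] /eqP ->.
have H2 k : measurable_fun setT (h k).
  by apply: measurable_funM => //; apply: mt; case: ifP.
move=> /(_ H1 H2 (fun k x => t_bd _ n x)).
under eq_fun do rewrite !big_cons big_nil mulr1 /h hi hj mulrACA.
rewrite !big_cons big_nil mulr1 /h hi hj.
have iTi := iT _ _ mf mXi; have iTj := iT _ _ mg mXj.
rewrite !ExZ//; last first.
  apply: (@itg_bounded _ _ _ P _ (n.+1%:R * n.+1%:R)).
    by apply: measurable_funM; [exact: (itg_meas iTi)|exact: (itg_meas iTj)].
  move=> w; rewrite normrM ler_pM//.
    by rewrite /t; case: ifP => //; rewrite normr0.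
  by rewrite /t; case: ifP => //; rewrite normr0.
rewrite mulrACA => /mulfI; apply.
by rewrite mulf_neq0// invr_neq0// pnatr_eq0.
Unshelve. all: by end_near. Qed.

End indep.

(** * Cosine transform of a weighted sum of errors *)

Lemma cosD_shift (R : realType) (c s u : R) :
  cos (c + (s + u)) = cos (c + s) * cos u - cos (c - pi / 2 + s) * sin u.
Proof. by rewrite [c - _ + s]addrAC cosBpihalf addrA (cosD (c + s)). Qed.

Section cos_sum.
Context d (T : measurableType d) (R : realType) (P : probability T R).
Notation Ex := (Ex P).
Notation itg := (itg P).
Variable eps : nat -> T -> R.
Hypothesis meps : forall i, measurable_fun setT (eps i).
Hypothesis ieps : mutual_indep P setT eps.

Lemma meas_lincomb (t : nat -> R) n :
  measurable_fun setT (fun w => \sum_(j < n) t j * eps j w).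
Proof. by apply: measurable_sum => j; apply: measurable_funM. Qed.

Lemma meas_cos (f : T -> R) : measurable_fun setT f -> measurable_fun setT (fun w => cos (f w)).
Proof. by move=> mf; apply: measurableT_comp mf; apply: continuous_measurable_fun; exact: continuous_cos. Qed.

Lemma meas_sin (f : T -> R) : measurable_fun setT f -> measurable_fun setT (fun w => sin (f w)).
Proof. by move=> mf; apply: measurableT_comp mf; apply: continuous_measurable_fun; exact: continuous_sin. Qed.

Lemma itg_cos (f : T -> R) : measurable_fun setT f -> itg (fun w => cos (f w)).
Proof. by move=> mf; apply: (@itg_bounded _ _ _ P _ 1); [exact: meas_cos|move=> w; exact: cos_max]. Qed.

Lemma itg_sin (f : T -> R) : measurable_fun setT f -> itg (fun w => sin (f w)).
Proof. by move=> mf; apply: (@itg_bounded _ _ _ P _ 1); [exact: meas_sin|move=> w; exact: sin_max]. Qed.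

Lemma normr_Ex_cos_le1 (f : T -> R) : measurable_fun setT f -> `|Ex (fun w => cos (f w))| <= 1.
Proof.
move=> mf; have i := itg_cos mf; apply: le_trans (normr_Ex i) _.
rewrite -[leRHS](Ex_cst P); apply: le_Ex; [exact: itg_norm|exact: itg_cst|].
by move=> w; exact: cos_max.
Qed.

Section lincomb.
Variable t : nat -> R.
Let S n w := \sum_(j < n) t j * eps j w.

Let mcS (c : R) n : measurable_fun setT (fun w => c + S n w).
Proof. by apply: measurable_funD => //; exact: meas_lincomb. Qed.

(* As sin is a shifted cos, the addition formula keeps the induction on [n] within cosines. *)
Lemma cos_sum_indep n (c : R) (s : seq nat) (h : nat -> R -> R) :
  uniq s -> (forall i, i \in s -> (n <= i)%N) ->
  (forall i, measurable_fun setT (h i)) -> (forall i x, `|h i x| <= 1) ->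
  Ex (fun w => cos (c + S n w) * \prod_(i <- s) h i (eps i w)) =
  Ex (fun w => cos (c + S n w)) * \prod_(i <- s) Ex (fun w => h i (eps i w)).
Proof.
have mcos (a : R) : measurable_fun setT (fun x : R => cos (a * x)) by exact: measurable_cosM.
have msin (a : R) : measurable_fun setT (fun x : R => sin (a * x)) by exact: measurable_sinM.
elim: n c s h => [|n IH] c s h us sn mh h1.
  have S0 w : c + S 0 w = c by rewrite /S big_ord0 addr0.
  under eq_fun do rewrite S0; under [in RHS]eq_fun do rewrite S0.
  rewrite Ex_cst -(indep_prod (P := P) (I := setT))// ExZ//.
  apply: (@itg_bounded _ _ _ P _ 1).
    by apply: meas_prod => i _; exact: measT_comp (mh i) (meps i).
  move=> w; rewrite normr_prod; elim: (s) => [|i l IHl]; first by rewrite big_nil.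
  by rewrite big_cons mulr_ile1// prodr_ge0.
have cs w : cos (c + S n.+1 w) = cos (c + S n w) * cos (t n * eps n w)
    - cos ((c - pi / 2) + S n w) * sin (t n * eps n w).
  by rewrite [S n.+1 w]big_ord_recr/= -/(S n w) cosD_shift.
pose hc (k : nat) (x : R) := if k == n then cos (t n * x) else h k x.
pose hs (k : nat) (x : R) := if k == n then sin (t n * x) else h k x.
have mhc k : measurable_fun setT (hc k) by rewrite /hc; case: eqP.
have mhs k : measurable_fun setT (hs k) by rewrite /hs; case: eqP.
have hc1 k x : `|hc k x| <= 1 by rewrite /hc; case: eqP => // _; exact: cos_max.
have hs1 k x : `|hs k x| <= 1 by rewrite /hs; case: eqP => // _; exact: sin_max.
have ns k : k \in s -> (k == n) = false.
  by move=> /sn nk; apply/negbTE; rewrite gtn_eqF.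
have key (l : seq nat) : uniq l -> (forall i, i \in l -> (n.+1 <= i)%N) ->
  Ex (fun w => cos (c + S n.+1 w) * \prod_(i <- l) h i (eps i w)) =
  (Ex (fun w => cos (c + S n w)) * Ex (fun w => cos (t n * eps n w))
   - Ex (fun w => cos (c - pi / 2 + S n w)) * Ex (fun w => sin (t n * eps n w))) *
  \prod_(i <- l) Ex (fun w => h i (eps i w)).
  move=> ul ln.
  have nl k : k \in l -> (k == n) = false.
    by move=> /ln nk; apply/negbTE; rewrite gtn_eqF.
  have E (g : nat -> R -> R) w : (forall k, k != n -> g k = h k) ->
      \prod_(i <- n :: l) g i (eps i w) = g n (eps n w) * \prod_(i <- l) h i (eps i w).
    move=> gh; rewrite big_cons; congr (_ * _); apply: eq_big_seq => k kl.
    by rewrite gh// nl.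
  have E' (g : nat -> R -> R) : (forall k, k != n -> g k = h k) ->
      \prod_(i <- n :: l) Ex (fun w => g i (eps i w)) =
      Ex (fun w => g n (eps n w)) * \prod_(i <- l) Ex (fun w => h i (eps i w)).
    move=> gh; rewrite big_cons; congr (_ * _); apply: eq_big_seq => k kl.
    by rewrite gh// nl.
  have gc k : k != n -> hc k = h k.
    by move=> /negbTE kn; apply/funext => x; rewrite /hc kn.
  have gs k : k != n -> hs k = h k.
    by move=> /negbTE kn; apply/funext => x; rewrite /hs kn.
  have unl : uniq (n :: l).
    by rewrite /= ul andbT; apply/negP => /ln; rewrite ltnn.
  have nle i : i \in n :: l -> (n <= i)%N.
    by rewrite inE => /predU1P[->//|/ln/ltnW].
  have := IH c (n :: l) hc unl nle mhc hc1; rewrite (E' _ gc).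
  have := IH (c - pi / 2) (n :: l) hs unl nle mhs hs1; rewrite (E' _ gs).
  under eq_fun do rewrite (E _ _ gs); move=> Hs.
  under eq_fun do rewrite (E _ _ gc); move=> Hc.
  have hcn x : hc n x = cos (t n * x) by rewrite /hc eqxx.
  have hsn x : hs n x = sin (t n * x) by rewrite /hs eqxx.
  under eq_fun do rewrite cs mulrBl -!mulrA -hcn -hsn.
  rewrite ExB ?Hc ?Hs; first last.
  - apply: (@itg_bounded _ _ _ P _ 1).
      apply: measurable_funM; first exact/meas_cos/mcS.
      apply: measurable_funM; first exact: measT_comp (mhs n) (meps n).
      by apply: meas_prod => i _; exact: measT_comp (mh i) (meps i).
    move=> w; rewrite normrM mulr_ile1 ?cos_max//= normrM mulr_ile1// normr_prod.
    elim: (l) => [|i l' IHl]; first by rewrite big_nil.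
    by rewrite big_cons mulr_ile1// prodr_ge0.
  - apply: (@itg_bounded _ _ _ P _ 1).
      apply: measurable_funM; first exact/meas_cos/mcS.
      apply: measurable_funM; first exact: measT_comp (mhc n) (meps n).
      by apply: meas_prod => i _; exact: measT_comp (mh i) (meps i).
    move=> w; rewrite normrM mulr_ile1 ?cos_max//= normrM mulr_ile1// normr_prod.
    elim: (l) => [|i l' IHl]; first by rewrite big_nil.
    by rewrite big_cons mulr_ile1// prodr_ge0.
  have -> : (fun w => hc n (eps n w)) = (fun w => cos (t n * eps n w)) by apply/funext.
  have -> : (fun w => hs n (eps n w)) = (fun w => sin (t n * eps n w)) by apply/funext.
  by rewrite mulrBl !mulrA.
rewrite key//; congr (_ * _).
have := key [::]; rewrite !big_nil mulr1 => <- //.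
by congr Ex; apply/funext => w; rewrite big_nil mulr1.
Qed.

Lemma Ex_cos_sumS n (c : R) :
  Ex (fun w => cos (c + S n.+1 w)) =
  Ex (fun w => cos (c + S n w)) * Ex (fun w => cos (t n * eps n w))
   - Ex (fun w => cos (c - pi / 2 + S n w)) * Ex (fun w => sin (t n * eps n w)).
Proof.
have cs w : cos (c + S n.+1 w) = cos (c + S n w) * cos (t n * eps n w)
    - cos ((c - pi / 2) + S n w) * sin (t n * eps n w).
  by rewrite [S n.+1 w]big_ord_recr/= -/(S n w) cosD_shift.
have mtn : measurable_fun setT (fun w => t n * eps n w) by apply: measurable_funM.
have H (a : R) (g : R -> R) : measurable_fun setT g -> (forall x, `|g x| <= 1) ->
    Ex (fun w => cos (a + S n w) * g (eps n w)) =
    Ex (fun w => cos (a + S n w)) * Ex (fun w => g (eps n w)).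
  move=> mg g1.
  have := @cos_sum_indep n a [:: n] (fun=> g) isT _ (fun=> mg) (fun=> g1).
  rewrite big_seq1 => <-.
    by congr Ex; apply/funext => w; rewrite big_seq1.
  by move=> i; rewrite inE => /eqP ->.
under eq_fun do rewrite cs.
rewrite ExB; first last.
- apply: (@itg_bounded _ _ _ P _ 1).
    by apply: measurable_funM; [exact/meas_cos/mcS|exact: meas_sin].
  by move=> w; rewrite normrM mulr_ile1 ?cos_max ?sin_max.
- apply: (@itg_bounded _ _ _ P _ 1).
    by apply: measurable_funM; [exact/meas_cos/mcS|exact: meas_cos].
  by move=> w; rewrite normrM mulr_ile1 ?cos_max.
rewrite (H _ (fun x => cos (t n * x))); [|exact: measurable_cosM|by move=> x; exact: cos_max].
rewrite (H _ (fun x => sin (t n * x))); [|exact: measurable_sinM|by move=> x; exact: sin_max].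
by [].
Qed.

End lincomb.

Variables (sigma M : R).
Hypothesis eps1 : forall i, Ex (eps i) = 0.
Hypothesis eps2 : forall i, Ex (fun w => eps i w ^+ 2) = sigma ^+ 2.
Hypothesis eps4 : forall i, Ex (fun w => eps i w ^+ 4) <= M.
Hypothesis ieps4 : forall i, itg (fun w => eps i w ^+ 4).

Lemma itg_eps_le k i : (k <= 4)%N -> itg (fun w => eps i w ^+ k).
Proof.
move=> k4; apply: (@itg_le _ _ _ P _ (fun w => 1 + eps i w ^+ 4)).
- exact: measurable_funX.
- exact: itgD (itg_cst P 1) (ieps4 i).
- move=> w; rewrite normrX; have [e1|e1] := leP `|eps i w| 1.
    apply: (@le_trans _ _ 1); first by rewrite exprn_ile1.
    by rewrite lerDl exprn_even_ge0.
  rewrite pow4_norm.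
  by apply: (@le_trans _ _ (`|eps i w| ^+ 4)); [rewrite ler_weXn2l// ltW|rewrite lerDr].
Qed.

Definition taylor_cst : R := 1 + M + sigma ^+ 4.

Lemma M_ge0 : 0 <= M.
Proof. by apply: le_trans (eps4 0); apply: Ex_ge0 => w; rewrite exprn_even_ge0. Qed.

Lemma taylor_cst_ge0 : 0 <= taylor_cst.
Proof.
have := M_ge0; have : 0 <= sigma ^+ 4 by rewrite exprn_even_ge0.
rewrite /taylor_cst; lra.
Qed.

Lemma Ex_sin_le i (t : R) : `|Ex (fun w => sin (t * eps i w))| <= taylor_cst * `|t| ^+ 3.
Proof.
have mt : measurable_fun setT (fun w => t * eps i w) by apply: measurable_funM.
have ie := itg_eps_le i (isT : 1 <= 4)%N.
have i1 : itg (fun w => t * eps i w) by apply: itgZ.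
have -> : Ex (fun w => sin (t * eps i w)) = Ex (fun w => sin (t * eps i w) - t * eps i w).
  by rewrite ExB//; [rewrite ExZ// eps1 mulr0 subr0|exact: itg_sin].
have i2 : itg (fun w => sin (t * eps i w) - t * eps i w) by apply: itgB => //; exact: itg_sin.
apply: le_trans (normr_Ex i2) _.
have i3 : itg (fun w => `|t| ^+ 3 * (1 + eps i w ^+ 4)).
  exact/itgZ/(itgD (itg_cst P 1) (ieps4 i)).
apply: (@le_trans _ _ (Ex (fun w => `|t| ^+ 3 * (1 + eps i w ^+ 4)))).
  apply: le_Ex => //; first exact: itg_norm.
  move=> w; apply: le_trans (sin_taylor _) _.
  rewrite normrM exprMn ler_wpM2l ?exprn_ge0//.
  rewrite pow4_norm.
  have [e1|e1] := leP `|eps i w| 1.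
    apply: (@le_trans _ _ 1); first by rewrite exprn_ile1.
    by rewrite lerDl exprn_ge0.
  by apply: (@le_trans _ _ (`|eps i w| ^+ 4)); [rewrite ler_weXn2l// ltW|rewrite lerDr].
rewrite ExZ; last exact: (itgD (itg_cst P 1) (ieps4 i)).
rewrite ExD//; last exact: itg_cst.
rewrite Ex_cst mulrC ler_wpM2r ?exprn_ge0// /taylor_cst -addrA lerD2l.
by apply: le_trans (eps4 i) _; rewrite lerDl exprn_even_ge0.
Qed.

Lemma Ex_cos_le i (t : R) : `|t| <= 1 ->
  `|Ex (fun w => cos (t * eps i w)) - expR (- (sigma ^+ 2 * t ^+ 2 / 2))| <= taylor_cst * `|t| ^+ 3.
Proof.
move=> t1.
have mt : measurable_fun setT (fun w => t * eps i w) by apply: measurable_funM.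
have i2 : itg (fun w => (t * eps i w) ^+ 2 / 2).
  have := itgZ (t ^+ 2 / 2) (itg_eps_le i (isT : 2 <= 4)%N).
  by congr itg; apply/funext => w; rewrite exprMn; ring.
have i4 : itg (fun w => (t * eps i w) ^+ 4 / 24).
  have := itgZ (t ^+ 4 / 24) (ieps4 i).
  by congr itg; apply/funext => w; rewrite exprMn; ring.
have i12 := itgB (itg_cst P 1) i2.
have E : Ex (fun w => 1 - (t * eps i w) ^+ 2 / 2) = 1 - sigma ^+ 2 * t ^+ 2 / 2.
  rewrite ExB//; last exact: itg_cst.
  rewrite Ex_cst; congr (_ - _).
  have -> : (fun w => (t * eps i w) ^+ 2 / 2) = (fun w => (t ^+ 2 / 2) * eps i w ^+ 2).
    by apply/funext => w; rewrite exprMn; ring.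
  by rewrite ExZ ?eps2; [ring|exact: (itg_eps_le i (isT : 2 <= 4)%N)].
have ic := itg_cos mt.
have B1 : `|Ex (fun w => cos (t * eps i w)) - (1 - sigma ^+ 2 * t ^+ 2 / 2)| <= t ^+ 4 * M / 24.
  rewrite -E -ExB//; apply: le_trans (normr_Ex (itgB ic i12)) _.
  apply: (@le_trans _ _ (Ex (fun w => (t * eps i w) ^+ 4 / 24))).
    apply: le_Ex => //; first exact/itg_norm/itgB.
    by move=> w; exact: cos_taylor.
  have -> : (fun w => (t * eps i w) ^+ 4 / 24) = (fun w => (t ^+ 4 / 24) * eps i w ^+ 4).
    by apply/funext => w; rewrite exprMn; ring.
  by rewrite ExZ// [leRHS]mulrAC ler_wpM2l// divr_ge0// exprn_even_ge0.
have B2 := @expRN_taylor R (sigma ^+ 2 * t ^+ 2 / 2).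
have u0 : 0 <= sigma ^+ 2 * t ^+ 2 / 2 by rewrite divr_ge0// mulr_ge0// sqr_ge0.
have {}B2 := B2 u0.
have t43 : t ^+ 4 <= `|t| ^+ 3.
  rewrite pow4_norm.
  by rewrite exprS ler_piMl// exprn_ge0.
have t40 : 0 <= t ^+ 4 by rewrite exprn_even_ge0.
have s40 : 0 <= sigma ^+ 4 by rewrite exprn_even_ge0.
have m0 := M_ge0.
have -> : Ex (fun w => cos (t * eps i w)) - expR (- (sigma ^+ 2 * t ^+ 2 / 2)) =
  (Ex (fun w => cos (t * eps i w)) - (1 - sigma ^+ 2 * t ^+ 2 / 2))
  - (expR (- (sigma ^+ 2 * t ^+ 2 / 2)) - (1 - sigma ^+ 2 * t ^+ 2 / 2)) by ring.
apply: le_trans (ler_normB _ _) _; apply: le_trans (lerD B1 B2) _.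
apply: (@le_trans _ _ (taylor_cst * t ^+ 4)); last by rewrite ler_wpM2l// taylor_cst_ge0.
rewrite /taylor_cst.
have -> : (sigma ^+ 2 * t ^+ 2 / 2) ^+ 2 / 2 = sigma ^+ 4 * t ^+ 4 / 8 by field.
have := mulr_ge0 s40 t40; have := mulr_ge0 m0 t40; nra.
Qed.

Lemma cos_sum_approx (t : nat -> R) n (c : R) : (forall j, (j < n)%N -> `|t j| <= 1) ->
  `|Ex (fun w => cos (c + \sum_(j < n) t j * eps j w))
    - expR (- (sigma ^+ 2 * (\sum_(j < n) t j ^+ 2) / 2)) * cos c|
  <= 2 * taylor_cst * \sum_(j < n) `|t j| ^+ 3.
Proof.
elim: n c => [|n IH] c t1.
  rewrite !big_ord0 !mulr0 mul0r oppr0 expR0 mul1r.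
  under eq_fun do rewrite big_ord0 addr0.
  by rewrite Ex_cst subrr normr0.
rewrite Ex_cos_sumS !big_ord_recr/=.
have {}IH := IH c (fun j jn => t1 j (ltnW jn)).
have x1 := Ex_cos_le n (t1 n (leqnn _)).
have y1 := Ex_sin_le n (t n).
set a := Ex (fun w => cos (c + _)) in IH *.
have a1 : `|a| <= 1.
  by apply: normr_Ex_cos_le1; apply: measurable_funD => //; exact: meas_lincomb.
set b := Ex (fun w => cos (c - pi / 2 + _)).
have b1 : `|b| <= 1.
  by apply: normr_Ex_cos_le1; apply: measurable_funD => //; exact: meas_lincomb.
set x := Ex _ in x1 *; set y := Ex _ in y1 *.
have -> : expR (- (sigma ^+ 2 * (\sum_(i < n) t i ^+ 2 + t n ^+ 2) / 2)) =
    expR (- (sigma ^+ 2 * t n ^+ 2 / 2)) * expR (- (sigma ^+ 2 * (\sum_(i < n) t i ^+ 2) / 2)).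
  by rewrite -expRD; congr expR; ring.
set e := expR _ in x1 *; set E := expR _ in IH *.
have e1 : `|e| <= 1.
  rewrite ger0_norm ?expR_ge0// -[leRHS]expR0 ler_expR oppr_le0 divr_ge0//.
  by rewrite mulr_ge0// sqr_ge0.
have -> : a * x - b * y - e * E * cos c = a * (x - e) + e * (a - E * cos c) - b * y by ring.
apply: le_trans (ler_normB _ _) _.
set Sg := \sum_(i < n) `|t i| ^+ 3 in IH *.
have -> : 2 * taylor_cst * (Sg + `|t n| ^+ 3) =
  2 * taylor_cst * Sg + taylor_cst * `|t n| ^+ 3 + taylor_cst * `|t n| ^+ 3 by ring.
apply: lerD; last by rewrite normrM -[leRHS]mul1r ler_pM.
apply: le_trans (ler_normD _ _) _; rewrite addrC; apply: lerD.
  by rewrite normrM -[leRHS]mul1r ler_pM.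
by rewrite normrM -[leRHS]mul1r ler_pM.
Qed.

End cos_sum.

(** * From cosine transforms to probabilities of boxes *)

Section trigpoly.
Context {R : realType}.

Inductive trigpoly : (R -> R) -> Prop :=
| trig_cos s : trigpoly (fun x => cos (s * x))
| trigD f g : trigpoly f -> trigpoly g -> trigpoly (fun x => f x + g x)
| trigZ a f : trigpoly f -> trigpoly (fun x => a * f x).

Lemma trig_cst a : trigpoly (fun=> a).
Proof.
have -> : (fun=> a) = (fun x : R => a * cos (0 * x)).
  by apply/funext => x; rewrite mul0r cos0 mulr1.
exact/trigZ/trig_cos.
Qed.

Lemma cos_mul (a b : R) : cos a * cos b = 2^-1 * cos (a + b) + 2^-1 * cos (a - b).
Proof. by rewrite cosD cosB; field. Qed.

Lemma trigM f g : trigpoly f -> trigpoly g -> trigpoly (fun x => f x * g x).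
Proof.
move=> tf tg; elim: tf => {f} [s|f1 f2 _ IH1 _ IH2|a f _ IH].
- elim: tg => {g} [t|g1 g2 _ IH1 _ IH2|a g _ IH].
  + have -> : (fun x => cos (s * x) * cos (t * x)) =
        (fun x => 2^-1 * cos ((s + t) * x) + 2^-1 * cos ((s - t) * x)).
      by apply/funext => x; rewrite cos_mul mulrDl mulrBl.
    by apply: trigD; apply: trigZ; exact: trig_cos.
  + by under eq_fun do rewrite mulrDr; exact: trigD.
  + by under eq_fun do rewrite mulrCA; exact: trigZ.
- by under eq_fun do rewrite mulrDl; exact: trigD.
- by under eq_fun do rewrite -mulrA; exact: trigZ.
Qed.

Lemma trigX f n : trigpoly f -> trigpoly (fun x => f x ^+ n).
Proof.
move=> tf; elim: n => [|n IH]; first by under eq_fun do rewrite expr0; exact: trig_cst.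
by under eq_fun do rewrite exprS; exact: trigM.
Qed.

Lemma trig_meas f : trigpoly f -> measurable_fun setT f.
Proof.
elim=> {f} [s|f g _ mf _ mg|a f _ mf]; first exact: measurable_cosM.
- exact: measurable_funD.
- exact: measurable_funM.
Qed.

Lemma trig_bounded f : trigpoly f -> exists C, forall x, `|f x| <= C.
Proof.
elim=> {f} [s|f g _ [C fC] _ [D gD]|a f _ [C fC]].
- by exists 1 => x; exact: cos_max.
- by exists (C + D) => x; apply: le_trans (ler_normD _ _) _; exact: lerD.
- by exists (`|a| * C) => x; rewrite normrM ler_wpM2l.
Qed.

Lemma gaussE_int f : trigpoly f ->
  (@lebesgue_measure R).-integrable setT (EFin \o (fun x => f x * normal_pdf 0 1 x)).
Proof.
move=> tf; have [C fC] := trig_bounded tf.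
by apply: (@integrable_stdpdf_bounded _ _ C) => //; exact: trig_meas.
Qed.

Lemma gaussED f g : trigpoly f -> trigpoly g ->
  gaussE (fun x => f x + g x) = gaussE f + gaussE g.
Proof.
move=> tf tg; rewrite /gaussE -RintegralD//; [|exact: gaussE_int..].
by apply: eq_Rintegral => x _; rewrite mulrDl.
Qed.

Lemma gaussEZ a f : trigpoly f -> gaussE (fun x => a * f x) = a * gaussE f.
Proof.
move=> tf; rewrite /gaussE -RintegralZl//; last exact: gaussE_int.
by apply: eq_Rintegral => x _; rewrite mulrA.
Qed.

End trigpoly.

Section trig_cvg.
Context d (T : measurableType d) (R : realType) (P : probability T R).
Notation Ex := (Ex P).
Notation itg := (itg P).
Variables (m : nat) (V : nat -> 'I_m -> T -> R).
Hypothesis mV : forall n k, measurable_fun setT (V n k).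
Hypothesis cvg_cos : forall (c : R) (t : 'I_m -> R),
  (fun n => Ex (fun w => cos (c + \sum_k t k * V n k w))) @ \oo -->
  cos c * expR (- (\sum_k t k ^+ 2) / 2).

Let mprod (f : 'I_m -> R -> R) n (s : seq 'I_m) : (forall k, measurable_fun setT (f k)) ->
  measurable_fun setT (fun w => \prod_(k <- s) f k (V n k w)).
Proof.
move=> mf; elim: s => [|k s IH]; first by under eq_fun do rewrite big_nil; exact: measurable_cst.
under eq_fun do rewrite big_cons.
by apply: measurable_funM => //; exact: measT_comp (mf k) (mV n k).
Qed.

Let bprod (f : 'I_m -> R -> R) (s : seq 'I_m) : (forall k, exists C, forall x, `|f k x| <= C) ->
  exists C, forall n w, `|\prod_(k <- s) f k (V n k w)| <= C.
Proof.
move=> bf; elim: s => [|k s [C IH]].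
  by exists 1 => n w; rewrite big_nil normr1.
have [D fD] := bf k; exists (D * C) => n w.
by rewrite big_cons normrM ler_pM.
Qed.

(* By the product formula, the frequencies of the [f k] are absorbed into [t]. *)
Lemma trig_cvg (f : 'I_m -> R -> R) (s : seq 'I_m) (c : R) (t : 'I_m -> R) :
  uniq s -> (forall k, k \in s -> t k = 0) -> (forall k, trigpoly (f k)) ->
  (fun n => Ex (fun w => cos (c + \sum_k t k * V n k w) * \prod_(k <- s) f k (V n k w)))
    @ \oo --> cos c * expR (- (\sum_k t k ^+ 2) / 2) * \prod_(k <- s) gaussE (f k).
Proof.
move=> us ts tf; elim: s c t us ts => [|k s IH] c t us ts.
  rewrite big_nil mulr1.
  rewrite [X in X @ _ --> _](_ : _ = (fun n => Ex (fun w => cos (c + \sum_k t k * V n k w)))).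
    exact: cvg_cos.
  by apply/funext => n; congr Ex; apply/funext => w; rewrite big_nil mulr1.
have [nks us'] := andP us.
pose W n w := \prod_(j <- s) f j (V n j w).
have mW n : measurable_fun setT (W n) by apply: mprod => j; exact: trig_meas.
have [D WD] : exists C, forall n w, `|W n w| <= C.
  by apply: bprod => j; exact: trig_bounded.
have mc n (t' : 'I_m -> R) : measurable_fun setT (fun w => cos (c + \sum_k t' k * V n k w)).
  apply: meas_cos; apply: measurable_funD => //.
  by apply: measurable_sum => j; exact: measurable_funM.
suff H g : trigpoly g ->
    (fun n => Ex (fun w => cos (c + \sum_k t k * V n k w) * (g (V n k w) * W n w)))
    @ \oo --> cos c * expR (- (\sum_k t k ^+ 2) / 2) * (gaussE g * \prod_(k <- s) gaussE (f k)).
  rewrite big_cons.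
  rewrite [X in X @ _ --> _](_ : _ =
    (fun n => Ex (fun w => cos (c + \sum_k t k * V n k w) * (f k (V n k w) * W n w)))).
    exact: H.
  by apply/funext => n; congr Ex; apply/funext => w; rewrite big_cons.
have iW n g0 (t' : 'I_m -> R) : trigpoly g0 ->
    itg (fun w => cos (c + \sum_k t' k * V n k w) * (g0 (V n k w) * W n w)).
  move=> tg; have [C gC] := trig_bounded tg.
  apply: (@itg_bounded _ _ _ P _ (C * D)).
    apply: measurable_funM; first exact: mc.
    by apply: measurable_funM => //; exact: measT_comp (trig_meas tg) (mV n k).
  move=> w; rewrite normrM -[leRHS]mul1r ler_pM ?cos_max// normrM ler_pM//.
have tk0 : t k = 0 by apply: ts; rewrite mem_head.
elim=> {g} [a|g1 g2 tg1 IH1 tg2 IH2|a g tg IHg].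
- pose tt (b : R) j := if j == k then b else t j.
  have ttE b n w : \sum_j tt b j * V n j w = \sum_j t j * V n j w + b * V n k w.
    rewrite (bigD1 k)//= [in RHS](bigD1 k)//= tk0 mul0r add0r /tt eqxx addrC.
    by congr (_ + _); apply: eq_bigr => j /negbTE ->.
  have tt2 b : \sum_j tt b j ^+ 2 = \sum_j t j ^+ 2 + b ^+ 2.
    rewrite (bigD1 k)//= [in RHS](bigD1 k)//= tk0 expr0n/= add0r /tt eqxx addrC.
    by congr (_ + _); apply: eq_bigr => j /negbTE ->.
  have tts b j : j \in s -> tt b j = 0.
    move=> js; rewrite /tt; case: eqP => [jk|_]; first by move: nks; rewrite -jk js.
    by apply: ts; rewrite inE js orbT.
  have C1 := IH c (tt a) us' (tts a); have C2 := IH c (tt (- a)) us' (tts (- a)).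
  have itt b n : itg (fun w => cos (c + \sum_j tt b j * V n j w) * W n w).
    apply: (@itg_bounded _ _ _ P _ D); first by apply: measurable_funM.
    by move=> w; rewrite normrM -[leRHS]mul1r ler_pM ?cos_max.
  have E : (fun n => Ex (fun w => cos (c + \sum_j t j * V n j w) * (cos (a * V n k w) * W n w)))
     = (fun n => 2^-1 * Ex (fun w => cos (c + \sum_j tt a j * V n j w) * W n w) +
                 2^-1 * Ex (fun w => cos (c + \sum_j tt (- a) j * V n j w) * W n w)).
    apply/funext => n; rewrite -!ExZ// -ExD; [|exact/itgZ..].
    congr Ex; apply/funext => w.
    rewrite !ttE mulrA cos_mul mulrDl !addrA mulNr; ring.
  rewrite E.
  have := cvgD (cvgM (cvg_cst (2^-1 : R)) C1) (cvgM (cvg_cst (2^-1 : R)) C2).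
  rewrite !tt2 sqrrN gaussE_cos.
  have -> : expR (- (\sum_j t j ^+ 2 + a ^+ 2) / 2) =
     expR (- (\sum_j t j ^+ 2) / 2) * expR (- a ^+ 2 / 2).
    by rewrite -expRD; congr expR; ring.
  set Pi := \prod_(_ <- _) _; set e1 := expR _; set e2 := expR _.
  rewrite (_ : 2^-1 * (cos c * (e1 * e2) * Pi) + 2^-1 * (cos c * (e1 * e2) * Pi) =
    cos c * e1 * (e2 * Pi)); last by field.
  exact.
- rewrite gaussED// mulrDl mulrDr.
  rewrite [X in X @ _ --> _](_ : _ = (fun n => Ex (fun w => cos (c + \sum_k t k * V n k w) * (g1 (V n k w) * W n w)) + Ex (fun w => cos (c + \sum_k t k * V n k w) * (g2 (V n k w) * W n w)))).
    exact: cvgD.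
  apply/funext => n; rewrite -ExD; [|exact: iW..].
  by congr Ex; apply/funext => w; rewrite -mulrDr -mulrDl.
- rewrite gaussEZ// -(mulrA a) mulrCA.
  rewrite [X in X @ _ --> _](_ : _ = (fun n => a * Ex (fun w => cos (c + \sum_k t k * V n k w) * (g (V n k w) * W n w)))).
    by apply: cvgM => //; exact: cvg_cst.
  apply/funext => n; rewrite -ExZ; [|exact: iW].
  by congr Ex; apply/funext => w; ring.
Qed.

End trig_cvg.

Section test_functions.
Context {R : realType}.
Notation G := (@normal_prob R 0 1).

Lemma bernoulli_ge (a : R) m : 0 <= a -> 1 + m%:R * a <= (1 + a) ^+ m.
Proof.
move=> a0; elim: m => [|m IH]; first by rewrite mul0r addr0 expr0.
rewrite exprS; apply: (@le_trans _ _ ((1 + a) * (1 + m%:R * a))).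
  have h : 0 <= m%:R * a * a by rewrite !mulr_ge0.
  by rewrite -natr1; nra.
by rewrite ler_wpM2l// addr_ge0.
Qed.

Lemma bernoulli_le (a : R) m : 0 <= a <= 1 -> 1 - m%:R * a <= (1 - a) ^+ m.
Proof.
move=> /andP[a0 a1]; elim: m => [|m IH]; first by rewrite mul0r subr0 expr0.
rewrite exprS; apply: (@le_trans _ _ ((1 - a) * (1 - m%:R * a))).
  have h : 0 <= m%:R * a * a by rewrite !mulr_ge0.
  by rewrite -natr1; nra.
by rewrite ler_wpM2l// subr_ge0.
Qed.

Lemma bernoulli_inv (a : R) m : 0 <= a <= 1 -> (1 - a) ^+ m * (1 + m%:R * a) <= 1.
Proof.
move=> /andP[a0 a1]; apply: (@le_trans _ _ ((1 - a) ^+ m * (1 + a) ^+ m)).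
  by rewrite ler_wpM2l ?bernoulli_ge// exprn_ge0// subr_ge0.
rewrite -exprMn exprn_ile1//; last by have := sqr_ge0 a; nra.
by rewrite mulr_ge0 ?subr_ge0// addr_ge0.
Qed.

(* [(1 - t ^ n) ^ m] with [m ~ t0 ^ (- n)] tends to 1 for [t < t0] and to 0 for [t > t0];
   here [t] is (1 - cos (pi x / L)) / 2, which increases with |x| on [0, L] *)
Lemma trig_step (z e L eta : R) : 0 < e -> e < z -> z + e <= L -> 0 < eta ->
  exists f, [/\ trigpoly f, forall x, 0 <= f x <= 1,
    forall x, `|x| <= z - e -> 1 - eta <= f x &
    forall x, z + e <= `|x| <= L -> f x <= eta].
Proof.
move=> e0 ez zL eta0.
have z0 : 0 < z by exact: lt_trans ez.
have L0 : 0 < L by apply: lt_le_trans zL; rewrite addr_gt0.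
pose om := pi / L : R.
have om0 : 0 < om by rewrite divr_gt0// pi_gt0.
pose t x := (1 - cos (om * x)) / 2.
have t01 x : 0 <= t x <= 1.
  by have := cos_le1 (om * x); have := cos_geN1 (om * x); rewrite /t; lra.
have tabs x : t x = t `|x|.
  by rewrite /t -[in LHS]cos_norm normrM (gtr0_norm om0).
have inpi x : 0 <= x <= L -> om * x \in `[0, pi].
  move=> /andP[x0 xL]; rewrite in_itv/= mulr_ge0//= ?(ltW om0)//.
  by rewrite /om mulrAC ler_pdivrMr// ler_pM2l ?pi_gt0.
have tlt x y : 0 <= x -> x < y -> y <= L -> t x < t y.
  move=> x0 xy yL; rewrite /t ltr_pM2r ?invr_gt0// ltrD2l ltrN2.
  rewrite ltr_cos ?ltr_pM2l//; apply: inpi; first by rewrite x0 (le_trans (ltW xy)).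
  by rewrite yL andbT (le_trans x0)// ltW.
have tle x y : 0 <= x -> x <= y -> y <= L -> t x <= t y.
  by move=> x0; rewrite le_eqVlt => /predU1P[->//|xy] yL; exact/ltW/tlt.
have zL' : z <= L by apply: le_trans zL; rewrite lerDl ltW.
have ze0 : 0 <= z - e by rewrite subr_ge0 ltW.
have t1 : t (z - e) < t z by apply: tlt => //; lra.
have t2 : t z < t (z + e) by apply: tlt => //; [exact: ltW|lra].
have t0 : 0 < t z by have /andP[] := t01 (z - e) => ? _; exact: le_lt_trans t1.
have t20 : 0 < t (z + e) by exact: lt_trans t2.
have [r1 r2] : `|t (z - e) / t z| < 1 /\ `|t z / t (z + e)| < 1.
  have /andP[? _] := t01 (z - e).
  by split; rewrite ger0_norm ?divr_ge0 ?(ltW t0) ?(ltW t20)// ltr_pdivrMr// mul1r.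
have [n [n1 n2]] : exists n, 2 * (t (z - e) / t z) ^+ n <= eta /\ (t z / t (z + e)) ^+ n <= eta.
  have /cvgrPdist_le C1 := cvg_expr r1; have /cvgrPdist_le C2 := cvg_expr r2.
  have e2 : 0 < eta / 2 by rewrite divr_gt0.
  near \oo => n; exists n; split.
    rewrite mulrC -ler_pdivlMr//.
    have : `|0 - (t (z - e) / t z) ^+ n| <= eta / 2 by near: n; exact: C1.
    by rewrite sub0r normrN; apply: le_trans; exact: ler_norm.
  have : `|0 - (t z / t (z + e)) ^+ n| <= eta by near: n; exact: C2.
  by rewrite sub0r normrN; apply: le_trans; exact: ler_norm.
pose c := (t z)^-1 ^+ n.
have c0 : 0 <= c by rewrite exprn_ge0// invr_ge0 ltW.
pose mm := (Num.truncn c).+1.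
have mc : c <= mm%:R by apply: ltW; exact: truncnS_gt.
have cm : mm%:R <= c + 1.
  by rewrite -natr1 lerD2r; have /andP[] := truncn_itv c0.
pose f x := (1 - t x ^+ n) ^+ mm.
have tn01 x : 0 <= t x ^+ n <= 1.
  by have /andP[a b] := t01 x; rewrite exprn_ge0//= exprn_ile1.
exists f; split.
- apply: trigX.
  have -> : (fun x => 1 - t x ^+ n) = (fun x => 1 + (-1) * t x ^+ n).
    by apply/funext => x; rewrite mulN1r.
  apply: trigD; first exact: trig_cst.
  apply/trigZ/trigX.
  have -> : t = (fun x => 2^-1 + (- 2^-1) * cos (om * x)).
    by apply/funext => x; rewrite /t; field.
  by apply: trigD; [exact: trig_cst|apply/trigZ/trig_cos].
- move=> x; have /andP[a b] := tn01 x.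
  by rewrite exprn_ge0 ?subr_ge0//= exprn_ile1 ?subr_ge0// gerBl.
- move=> x xz; apply: le_trans (bernoulli_le mm (tn01 x)).
  rewrite lerD2l lerN2; apply: le_trans n1.
  have tx : t x <= t (z - e).
    by rewrite [t x]tabs; apply: tle => //; lra.
  have /andP[tx0 tx1] := t01 x; have /andP[tz0 tz1] := t01 z.
  have a1 : t x ^+ n <= t (z - e) ^+ n by rewrite lerXn2r// nnegrE// (le_trans tx0).
  have /andP[an0 _] := tn01 x.
  apply: (@le_trans _ _ ((c + 1) * t x ^+ n)); first by rewrite ler_wpM2r.
  have -> : 2 * (t (z - e) / t z) ^+ n = c * t (z - e) ^+ n + c * t (z - e) ^+ n.
    by rewrite (exprMn n (t (z - e))) -/c; ring.
  rewrite mulrDl mul1r; apply: lerD; first exact: ler_wpM2l.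
  apply: le_trans a1 _; rewrite ler_peMl//; first by rewrite exprn_ge0// (le_trans tx0).
  by rewrite /c exprVn invf_ge1 ?exprn_gt0// exprn_ile1.
- move=> x /andP[zx xL].
  have tx : t (z + e) <= t x by rewrite [t x]tabs; apply: tle => //; rewrite addr_ge0// ltW.
  have /andP[an0 an1] := tn01 x.
  pose q := (t (z + e) / t z) ^+ n.
  have q0 : 0 < q by rewrite exprn_gt0// divr_gt0.
  have qm : q <= mm%:R * t x ^+ n.
    apply: (@le_trans _ _ (c * t x ^+ n)); last by rewrite ler_wpM2r.
    rewrite /q (exprMn n (t (z + e))) -/c mulrC ler_wpM2l//.
    by rewrite lerXn2r// nnegrE ltW// (lt_le_trans t20).
  have B := bernoulli_inv mm (tn01 x); rewrite -/(f x) in B.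
  have f0 : 0 <= f x by rewrite exprn_ge0// subr_ge0.
  have : f x * q <= 1.
    by apply: le_trans B; rewrite ler_wpM2l//; apply: le_trans qm _; rewrite lerDr.
  rewrite -ler_pdivlMr// mul1r => /le_trans; apply.
  by rewrite /q -exprVn invf_div.
Unshelve. all: by end_near. Qed.

Lemma pr_gauss_symE (z : R) : pr G `]-z, z[ = gaussE (fun x => \1_`]-z, z[ x).
Proof. by rewrite pr_gaussE. Qed.

Lemma trig_bounded1 (f : R -> R) : (forall x, 0 <= f x <= 1) -> forall x, `|f x| <= 1.
Proof. by move=> f01 x; have /andP[a b] := f01 x; rewrite ger0_norm. Qed.

Lemma gaussED_bd (f g : R -> R) C : measurable_fun setT f -> measurable_fun setT g ->
  (forall x, `|f x| <= C) -> (forall x, `|g x| <= C) ->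
  gaussE (fun x => f x + g x) = gaussE f + gaussE g.
Proof.
move=> mf mg fC gC; rewrite /gaussE -RintegralD//;
  [|exact: (@integrable_stdpdf_bounded _ _ C)..].
by apply: eq_Rintegral => x _; rewrite mulrDl.
Qed.

Lemma gaussE_cst (c : R) : gaussE (fun=> c) = c.
Proof.
rewrite /gaussE RintegralZl//; last exact: integrable_normal_pdf.
by rewrite /Rintegral integral_normal_pdf mulr1.
Qed.

Lemma in_sym_itv (x z : R) : (x \in `]-z, z[) = (`|x| < z).
Proof. by rewrite in_itv/= ltr_norml. Qed.

Lemma indic_sym (x z : R) : \1_`]-z, z[ x = ((`|x| < z)%R)%:R :> R.
Proof. by rewrite indicE mem_setE in_sym_itv. Qed.

Lemma trig_above (z eta : R) : 0 < z -> 0 < eta -> exists f,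
  [/\ trigpoly f, forall x, 0 <= f x <= 1, forall x, (`|x| < z)%R%:R <= f x + eta &
    gaussE f <= pr G `]-z, z[ + eta].
Proof.
move=> z0 eta0; have p0 : 0 < normal_peak 1 :> R by rewrite normal_peak_gt0// oner_neq0.
pose K := 4 * normal_peak 1 + 1 : R.
have K0 : 0 < K by rewrite /K; lra.
pose e := Num.min (z / 2) (eta / 3 / K).
have e0 : 0 < e by rewrite lt_min !divr_gt0.
have ez : e <= z / 2 by rewrite ge_min lexx.
have eK : 4 * normal_peak 1 * e <= eta / 3.
  apply: (@le_trans _ _ (K * (eta / 3 / K))); last by rewrite mulrC divfK// gt_eqF.
  apply: ler_pM; [by rewrite mulr_ge0// ltW|exact: ltW|by rewrite /K lerDl|by rewrite ge_min lexx orbT].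
have g0 := @gauss_abs1_ge0 R.
pose L := z + 2 * e + 3 * gauss_abs1 / eta.
have L1 : z + 2 * e <= L by rewrite lerDl divr_ge0// ?mulr_ge0// ltW.
have L0 : 0 < L by lra.
have gL : gauss_abs1 / L <= eta / 3.
  rewrite ler_pdivrMr// /L mulrDr.
  have -> : eta / 3 * (3 * gauss_abs1 / eta) = gauss_abs1 by field; exact: lt0r_neq0.
  by rewrite lerDr mulr_ge0// ?divr_ge0 ?(ltW eta0)//; lra.
have eta3 : 0 < eta / 3 by rewrite divr_gt0.
have [||f [tf f01 f1 f2]] := @trig_step (z + e) e L (eta / 3) e0 _ _ eta3; [lra|lra|].
exists f; split => //.
  move=> x; have /andP[fx0 fx1] := f01 x; have [xz|xz] := ltP `|x| z; rewrite /= ?mulr1n ?mulr0n; last by lra.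
  by have := f1 x; rewrite addrK => /(_ (ltW xz)); lra.
have mI (y : R) : measurable_fun setT (\1_`]-y, y[ : R -> R) by exact: measurable_indic.
have mT : measurable_fun setT (\1_[set x : R | L <= `|x|] : R -> R).
  by apply: measurable_indic; exact: measurable_abs_ge.
have b1 (A : set R) x : `|\1_A x : R| <= 1 by rewrite indicE normr_nat lern1 leq_b1.
apply: (@le_trans _ _ (gaussE (fun x => \1_`]-(z + 2 * e), z + 2 * e[ x +
    (\1_[set x : R | L <= `|x|] x + eta / 3)))).
  apply: (@gaussE_le _ _ _ (1 + (1 + eta / 3))).
  - exact: trig_meas.
  - by apply: measurable_funD => //; apply: measurable_funD.
  - by move=> x; apply: le_trans (trig_bounded1 f01 x) _; lra.
  - move=> x; apply: le_trans (ler_normD _ _) _; apply: lerD => //.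
    apply: le_trans (ler_normD _ _) _; apply: lerD => //.
    by rewrite ger0_norm// ltW.
  - move=> x; rewrite indic_sym indicE.
    have /andP[fx0 fx1] := f01 x.
    have [xz|xz] := ltP `|x| (z + 2 * e); rewrite /= ?mulr1n ?mulr0n.
      have : 0 <= (x \in [set x : R | L <= `|x|])%:R :> R by []. lra.
    have [xL|xL] := leP L `|x|.
      by rewrite mem_set// mulr1n; lra.
    have xz' : z + e + e <= `|x| by lra.
    have := f2 x; rewrite xz' (ltW xL) => /(_ isT).
    have : 0 <= (x \in [set x : R | L <= `|x|])%:R :> R by []. lra.
rewrite (@gaussED_bd _ _ (1 + eta / 3))//; last 3 first.
- by apply: measurable_funD.
- by move=> x; apply: le_trans (b1 _ _) _; lra.
- move=> x; apply: le_trans (ler_normD _ _) _; apply: lerD => //.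
  by rewrite ger0_norm// ltW.
rewrite (@gaussED_bd _ _ (1 + eta / 3))//; last 2 first.
- by move=> x; apply: le_trans (b1 _ _) _; lra.
- by move=> x; rewrite ger0_norm//; lra.
rewrite gaussE_cst -pr_gauss_symE -[gaussE \1_[set x : R | L <= `|x|]]pr_gaussE; last exact: measurable_abs_ge.
have : pr G [set x : R | L <= `|x|] <= eta / 3.
  exact: le_trans (pr_gauss_tail L0) gL.
have : pr G `]-(z + 2 * e), z + 2 * e[ <= pr G `]-z, z[ + eta / 3.
  apply: le_trans (pr_gauss_sym_le z0 _) _; first by lra.
  rewrite lerD2l addrAC subrr add0r; lra.
lra.
Qed.

Lemma trig_below (z eta : R) : 0 < z -> 0 < eta -> exists f,
  [/\ trigpoly f, forall x, 0 <= f x <= 1,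
    forall x, f x <= (`|x| < z)%R%:R + eta * (1 + x ^+ 2) &
    pr G `]-z, z[ <= gaussE f + eta].
Proof.
move=> z0 eta0; have p0 : 0 < normal_peak 1 :> R by rewrite normal_peak_gt0// oner_neq0.
pose K := 4 * normal_peak 1 + 1 : R.
have K0 : 0 < K by rewrite /K; lra.
pose e := Num.min (z / 4) (eta / 3 / K).
have e0 : 0 < e by rewrite lt_min !divr_gt0.
have ez : e <= z / 4 by rewrite ge_min lexx.
have eK : 4 * normal_peak 1 * e <= eta / 3.
  apply: (@le_trans _ _ (K * (eta / 3 / K))); last by rewrite mulrC divfK// gt_eqF.
  apply: ler_pM; [by rewrite mulr_ge0// ltW|exact: ltW|by rewrite /K lerDl|by rewrite ge_min lexx orbT].
pose L := z + eta^-1 + 1.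
have ei : 0 < eta^-1 by rewrite invr_gt0.
have eta3 : 0 < eta / 3 by rewrite divr_gt0.
have [||f [tf f01 f1 f2]] := @trig_step (z - e) e L (eta / 3) e0 _ _ eta3; [lra|rewrite /L; lra|].
exists f; split => //.
  move=> x; have /andP[fx0 fx1] := f01 x.
  have x2 : 0 <= eta * x ^+ 2 by rewrite mulr_ge0 ?sqr_ge0// ltW.
  have [xz|xz] := ltP `|x| z; rewrite /= ?mulr1n ?mulr0n; first by rewrite mulrDr mulr1; lra.
  rewrite mulrDr mulr1; have [xL|xL] := leP `|x| L.
    by have := f2 x; rewrite subrK xz xL => /(_ isT); lra.
  suff : 1 <= eta * x ^+ 2 by lra.
  rewrite -(real_normK (num_real x)).
  have : eta^-1 * 1 <= `|x| * `|x|.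
    by apply: ler_pM => //; [exact: ltW|apply: ltW; apply: le_lt_trans xL; rewrite /L; lra..].
  by rewrite mulr1 -expr2 -[eta^-1]mul1r ler_pdivrMr// mulrC.
have mI (y : R) : measurable_fun setT (\1_`]-y, y[ : R -> R) by exact: measurable_indic.
have b1 (A : set R) x : `|\1_A x : R| <= 1 by rewrite indicE normr_nat lern1 leq_b1.
have H1 : pr G `]-(z - 2 * e), z - 2 * e[ <= gaussE f + eta / 3.
  rewrite pr_gauss_symE -[eta / 3]gaussE_cst -(@gaussED_bd _ _ (1 + eta / 3)) //; first last.
  - by move=> x; rewrite ger0_norm//; lra.
  - by move=> x; apply: le_trans (trig_bounded1 f01 x) _; lra.
  - exact: trig_meas.
  apply: (@gaussE_le _ _ _ (1 + eta / 3)) => //.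
  - by apply: measurable_funD => //; exact: trig_meas.
  - by move=> x; apply: le_trans (b1 _ _) _; lra.
  - move=> x; apply: le_trans (ler_normD _ _) _; apply: lerD; first exact: trig_bounded1.
    by rewrite ger0_norm// ltW.
  - move=> x; rewrite indic_sym; have /andP[fx0 fx1] := f01 x.
    have [xz|xz] := ltP `|x| (z - 2 * e); rewrite /= ?mulr1n ?mulr0n; last by lra.
    have xz' : `|x| <= z - e - e by lra.
    have := f1 x xz'; lra.
have : pr G `]-z, z[ <= pr G `]-(z - 2 * e), z - 2 * e[ + eta / 3.
  apply: le_trans (pr_gauss_sym_le (z := z - 2 * e) _ _) _; [by lra|by lra|].
  rewrite lerD2l subKr; lra.
lra.
Qed.

End test_functions.

Lemma prod_le_sum (R : realType) (I : Type) (s : seq I) (a b h : I -> R) :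
  (forall k, 0 <= a k <= 1) -> (forall k, 0 <= b k <= 1) -> (forall k, 0 <= h k) ->
  (forall k, a k <= b k + h k) ->
  \prod_(k <- s) a k <= \prod_(k <- s) b k + \sum_(k <- s) h k.
Proof.
move=> a01 b01 h0 ab.
have p01 (g : I -> R) l : (forall k, 0 <= g k <= 1) -> 0 <= \prod_(k <- l) g k <= 1.
  move=> g01; elim: l => [|i l /andP[IH0 IH1]]; first by rewrite big_nil ler01 lexx.
  by have /andP[? ?] := g01 i; rewrite big_cons mulr_ge0//= mulr_ile1.
elim: s => [|i s IH]; first by rewrite !big_nil addr0.
rewrite !big_cons.
have /andP[a0 a1] := a01 i; have /andP[b0 b1] := b01 i.
have /andP[A0 A1] := p01 a s a01; have /andP[B0 B1] := p01 b s b01.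
have := ab i; have hi := h0 i.
have H0 : 0 <= \sum_(k <- s) h k by rewrite sumr_ge0.
move: IH A0 A1 B0 B1 H0; set A := \prod_(_ <- _) a _; set B := \prod_(_ <- _) b _.
set H := \sum_(_ <- _) _ => IH A0 A1 B0 B1 H0 abi.
apply: (@le_trans _ _ (b i * A + h i * A)).
  by rewrite -mulrDl ler_wpM2r.
apply: (@le_trans _ _ (b i * (B + H) + h i)).
  by apply: lerD; [rewrite ler_wpM2l|rewrite ler_piMr].
by rewrite mulrDr -addrA [h i + H]addrC lerD2l lerD2r ler_piMl.
Qed.

Section box_cvg.
Context d (T : measurableType d) (R : realType) (P : probability T R).
Notation Ex := (Ex P).
Notation itg := (itg P).
Notation G := (@normal_prob R 0 1).
Variables (m : nat) (V : nat -> 'I_m -> T -> R).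
Hypothesis mV : forall n k, measurable_fun setT (V n k).
Hypothesis cvg_cos : forall (c : R) (t : 'I_m -> R),
  (fun n => Ex (fun w => cos (c + \sum_k t k * V n k w))) @ \oo -->
  cos c * expR (- (\sum_k t k ^+ 2) / 2).
Variable N : nat.
Hypothesis V2 : forall n k, (N <= n)%N -> itg (fun w => V n k w ^+ 2) /\
  Ex (fun w => V n k w ^+ 2) <= 1.
Variables (z : 'I_m -> R) (s : seq 'I_m).
Hypothesis z0 : forall k, 0 < z k.
Hypothesis us : uniq s.

Let box n := [set w | all (fun k => `|V n k w| < z k) s].

Let box_bigcap n : box n = \bigcap_(k in [set k | k \in s]) (V n k @^-1` `]-z k, z k[).
Proof.
apply/seteqP; split=> w /= H.
  by move=> k /= ks /=; rewrite in_sym_itv; exact: (allP H).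
by apply/allP => k ks; have := H k ks; rewrite /= in_sym_itv.
Qed.

Lemma measurable_box n : measurable (box n).
Proof.
rewrite box_bigcap bigcap_seq; apply: bigsetI_measurable => k _.
by rewrite -[X in measurable X]setTI; exact: mV.
Qed.

Let pr_box n : pr P (box n) = Ex (fun w => \prod_(k <- s) (`|V n k w| < z k)%R%:R).
Proof.
rewrite -Ex_indic; last exact: measurable_box.
congr Ex; apply/funext => w; rewrite indicE /box.
have -> : (w \in [set w | all (fun k => `|V n k w| < z k) s]) = all (fun k => `|V n k w| < z k) s.
  by apply/idP/idP; rewrite inE.
by elim: (s) => [|k l IH] /=; rewrite ?big_nil// big_cons -IH; case: (_ < _); rewrite ?mul1r ?mul0r.
Qed.

Let ExP (f : 'I_m -> R -> R) : (forall k, trigpoly (f k)) ->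
  (fun n => Ex (fun w => \prod_(k <- s) f k (V n k w))) @ \oo --> \prod_(k <- s) gaussE (f k).
Proof.
move=> tf; have := trig_cvg mV cvg_cos (f := f) (s := s) (t := fun=> 0) us (fun _ _ => erefl) tf (c := 0).
rewrite cos0 mul1r big1 ?oppr0 ?mul0r ?expR0 ?mul1r; last by move=> i _; rewrite expr0n.
move=> C; rewrite [X in X @ _ --> _](_ : _ = (fun n : nat => Ex (fun w =>
  cos (0 + \sum_k 0 * V n k w) * \prod_(k <- s) f k (V n k w)))); first exact: C.
apply/funext => n; congr Ex; apply/funext => w.
have -> : \sum_k 0 * V n k w = 0 by rewrite big1// => i _; rewrite mul0r.
by rewrite addr0 cos0 mul1r.
Qed.

Let gauss01 (f : R -> R) : trigpoly f -> (forall x, 0 <= f x <= 1) -> 0 <= gaussE f <= 1.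
Proof.
move=> tf f01; have b := trig_bounded1 f01.
apply/andP; split; [rewrite -[leLHS](@gaussE_cst R)|rewrite -[leRHS](@gaussE_cst R)]; apply: (@gaussE_le _ _ _ 1) => //.
- exact: trig_meas.
- by move=> _; rewrite normr0.
- by move=> x; have /andP[] := f01 x.
- exact: trig_meas.
- by move=> _; rewrite normr1.
- by move=> x; have /andP[] := f01 x.
Qed.

Lemma box_cvg : (fun n => pr P (box n)) @ \oo --> \prod_(k <- s) pr G `]-z k, z k[.
Proof.
have pG k : 0 <= pr G `]-z k, z k[ <= 1 by rewrite pr_ge0 pr_le1.
pose q := (size s)%:R : R.
have q0 : 0 <= q by [].
have b01 (b : bool) : 0 <= (b%:R : R) <= 1 by case: b; rewrite ?ler01 ?lexx.
apply/cvgrPdist_le => e e0.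
pose h := e / (3 * q + 1).
have h0 : 0 < h by rewrite divr_gt0//; lra.
have he : (3 * q + 1) * h = e by rewrite mulrC divfK//; apply: lt0r_neq0; lra.
have hs : \sum_(k <- s) h = q * h by rewrite big_const_seq count_predT iter_addr_0 mulr_natl.
have /choice[f fP] : forall k, exists f : R -> R, [/\ trigpoly f, forall x, 0 <= f x <= 1,
    forall x : R, (`|x| < z k)%R%:R <= f x + h & gaussE f <= pr G `]-z k, z k[ + h].
  by move=> k; exact: trig_above.
have /choice[g gP] : forall k, exists f : R -> R, [/\ trigpoly f, forall x, 0 <= f x <= 1,
    forall x : R, f x <= (`|x| < z k)%R%:R + h * (1 + x ^+ 2) & pr G `]-z k, z k[ <= gaussE f + h].
  by move=> k; exact: trig_below.
have tf k : trigpoly (f k) by have [] := fP k.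
have tg k : trigpoly (g k) by have [] := gP k.
have f01 k x : 0 <= f k x <= 1 by have [_ ->] := fP k.
have g01 k x : 0 <= g k x <= 1 by have [_ ->] := gP k.
have itP (a : 'I_m -> R -> R) n : (forall k, trigpoly (a k)) -> (forall k x, 0 <= a k x <= 1) ->
    itg (fun w => \prod_(k <- s) a k (V n k w)).
  move=> ta a01; apply: (@itg_bounded _ _ _ P _ 1).
    elim: (s) => [|k l IH].
      by under eq_fun do rewrite big_nil; exact: measurable_cst.
    under eq_fun do rewrite big_cons.
    by apply: measurable_funM => //; exact: measT_comp (trig_meas (ta k)) (mV n k).
  move=> w; rewrite normr_prod; elim: (s) => [|i l IHl]; first by rewrite big_nil.
  by rewrite big_cons mulr_ile1// ?prodr_ge0// trig_bounded1.
have itB n : itg (fun w => \prod_(k <- s) (`|V n k w| < z k)%R%:R).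
  have := itg_indic P (measurable_box n); congr itg; apply/funext => w; rewrite indicE /box.
  have -> : (w \in [set w | all (fun k => `|V n k w| < z k) s]) = all (fun k => `|V n k w| < z k) s.
    by apply/idP/idP; rewrite inE.
  by elim: (s) => [|k l IH] /=; rewrite ?big_nil// big_cons -IH; case: (_ < _); rewrite ?mul1r ?mul0r.
have up n : pr P (box n) <= Ex (fun w => \prod_(k <- s) f k (V n k w)) + q * h.
  rewrite pr_box -[q * h](Ex_cst P) -ExD; [|exact: itP|exact: itg_cst].
  apply: le_Ex => //; first by apply: itgD; [exact: itP|exact: itg_cst].
  move=> w; rewrite -hs; apply: prod_le_sum => // k; first exact: ltW.
  by have [_ _ ->] := fP k.
have down n : (N <= n)%N -> Ex (fun w => \prod_(k <- s) g k (V n k w)) <= pr P (box n) + 2 * (q * h).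
  move=> Nn.
  have i1 k : itg (fun w => h * (1 + V n k w ^+ 2)).
    by apply/itgZ/itgD; [exact: itg_cst|have [] := V2 k Nn].
  apply: (@le_trans _ _ (pr P (box n) + Ex (fun w => \sum_(k <- s) h * (1 + V n k w ^+ 2)))).
    rewrite pr_box -ExD//; last exact: itg_sum.
    apply: le_Ex; [exact: itP|apply: itgD => //; exact: itg_sum|].
    move=> w; apply: prod_le_sum => // k.
      by rewrite mulr_ge0 ?(ltW h0)// addr_ge0// sqr_ge0.
    by have [_ _ ->] := gP k.
  rewrite lerD2l Ex_sum// -hs mulr_sumr; apply: ler_sum => k _.
  have [iV EV] := V2 k Nn.
  rewrite ExZ; last by apply: itgD => //; exact: itg_cst.
  rewrite mulrC ler_wpM2r ?(ltW h0)// ExD//; last exact: itg_cst.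
  by rewrite Ex_cst; lra.
have G1 : \prod_(k <- s) gaussE (f k) <= \prod_(k <- s) pr G `]-z k, z k[ + q * h.
  rewrite -hs; apply: prod_le_sum => // k; first exact: gauss01.
    exact: ltW.
  by have [_ _ _ ->] := fP k.
have G2 : \prod_(k <- s) pr G `]-z k, z k[ <= \prod_(k <- s) gaussE (g k) + q * h.
  rewrite -hs; apply: prod_le_sum => // k; first exact: gauss01.
    exact: ltW.
  by have [_ _ _ ->] := gP k.
have /cvgrPdist_le C1 := ExP tf; have /cvgrPdist_le C2 := ExP tg.
near=> n.
have Nn : (N <= n)%N by near: n; exact: nbhs_infty_ge.
have D1 : `|\prod_(k <- s) gaussE (f k) - Ex (fun w => \prod_(k <- s) f k (V n k w))| <= h.
  by near: n; exact: C1.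
have D2 : `|\prod_(k <- s) gaussE (g k) - Ex (fun w => \prod_(k <- s) g k (V n k w))| <= h.
  by near: n; exact: C2.
move: D1 D2 (up n) (down n Nn) G1 G2; rewrite !ler_norml -he.
set a1 := Ex _; set a2 := Ex _; set a3 := \prod_(_ <- _) _; set a4 := \prod_(_ <- _) _.
set a5 := \prod_(_ <- _) _; set a6 := pr P _; set qh := q * h.
have -> : (3 * q + 1) * h = 3 * qh + h by rewrite /qh; ring.
have qh0 : 0 <= qh by rewrite mulr_ge0 ?(ltW h0).
by move=> /andP[? ?] /andP[? ?] ? ? ? ?; apply/andP; split; lra.
Unshelve. all: by end_near. Qed.

End box_cvg.

(** * Positive definite matrices and Gram-Schmidt vectors *)

Section posdef.
Context {R : realType}.

Lemma posdefmx_unit p (A : 'M[R]_p) : posdefmx A -> A \in unitmx.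
Proof.
move=> pA; rewrite unitmxE unitfE; apply/negP => /det0P[v v0 vA].
have := pA v^T; rewrite trmx_eq0 v0 trmxK vA mul0mx mxE ltxx.
by move=> /(_ isT).
Qed.

Definition normsq p (v : 'cV[R]_p) : R := \sum_i v i 0 ^+ 2.

Lemma normsqE p (v : 'cV[R]_p) : (v^T *m v) 0 0 = normsq v.
Proof. by rewrite mxE; apply: eq_bigr => i _; rewrite mxE expr2. Qed.

Lemma normsq_ge0 p (v : 'cV[R]_p) : 0 <= normsq v.
Proof. by apply: sumr_ge0 => i _; rewrite sqr_ge0. Qed.

Lemma le_normsq p (v : 'cV[R]_p) i : v i 0 ^+ 2 <= normsq v.
Proof. by rewrite /normsq (bigD1 i)//= lerDl sumr_ge0// => j _; rewrite sqr_ge0. Qed.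

Lemma normsq_eq0 p (v : 'cV[R]_p) : normsq v = 0 -> v = 0.
Proof.
move=> v0; apply/matrixP => i j; rewrite ord1 mxE; apply/eqP; rewrite -sqrf_eq0 eq_le sqr_ge0 andbT.
by rewrite -v0 le_normsq.
Qed.

Lemma dot_le_normsq p (x : 'rV[R]_p) (v : 'cV[R]_p) :
  ((x *m v) 0 0) ^+ 2 <= (\sum_k x 0 k ^+ 2) * normsq v.
Proof.
have H (r : R) : 0 <= \sum_k x 0 k ^+ 2 - 2 * r * (x *m v) 0 0 + r ^+ 2 * normsq v.
  have -> : \sum_k x 0 k ^+ 2 - 2 * r * (x *m v) 0 0 + r ^+ 2 * normsq v =
      \sum_k (x 0 k - r * v k 0) ^+ 2.
    rewrite mxE /normsq !mulr_sumr -sumrB -big_split/=; apply: eq_bigr => k _; ring.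
  by apply: sumr_ge0 => k _; rewrite sqr_ge0.
set q := (x *m v) 0 0 in H *; set a := \sum_k _ in H *.
have := normsq_ge0 v; rewrite le_eqVlt => /predU1P[/esym v0|v0].
  by rewrite /q (normsq_eq0 v0) mulmx0 mxE /normsq big1 ?mulr0 ?expr0n// => i _; rewrite mxE expr0n.
have := H (q / normsq v).
have -> : a - 2 * (q / normsq v) * q + (q / normsq v) ^+ 2 * normsq v = a - q ^+ 2 / normsq v.
  by field; exact: lt0r_neq0.
by rewrite subr_ge0 ler_pdivrMr.
Qed.

Lemma mxE11 p (A : 'M[R]_p) (v w : 'cV[R]_p) :
  (v^T *m A *m w) 0 0 = \sum_i \sum_j v i 0 * A i j * w j 0.
Proof.
rewrite mxE exchange_big/=; apply: eq_bigr => j _; rewrite mxE mulr_suml.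
by apply: eq_bigr => i _; rewrite mxE.
Qed.

(* [v j] is the A-inner product of [v] and [A^-1 e_j]: apply Cauchy-Schwarz for A. *)
Lemma posdefmx_coercive p (A : 'M[R]_p) : posdefmx A -> A^T = A ->
  exists2 c, 0 < c & forall v : 'cV[R]_p, c * normsq v <= (v^T *m A *m v) 0 0.
Proof.
move=> pA sA; have uA := posdefmx_unit pA.
have A_ge0 (v : 'cV[R]_p) : 0 <= (v^T *m A *m v) 0 0.
  have [->|v0] := eqVneq v 0; last exact/ltW/pA.
  by rewrite mulmx0 mxE.
pose a j : 'cV[R]_p := invmx A *m delta_mx j 0.
have Aa j : A *m a j = delta_mx j 0 by rewrite mulmxA mulmxV// mul1mx.
have a0 j : a j != 0.
  apply/eqP => a0; have := Aa j; rewrite a0 mulmx0 => /matrixP/(_ j 0).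
  by rewrite !mxE !eqxx => /esym/eqP; rewrite oner_eq0.
pose q j := ((a j)^T *m A *m a j) 0 0.
have q0 j : 0 < q j by exact: pA.
have aAv j (v : 'cV[R]_p) : ((a j)^T *m A *m v) 0 0 = v j 0.
  rewrite -{1}sA -trmx_mul Aa mxE (bigD1 j)//= big1 ?addr0.
    by rewrite !mxE !eqxx mul1r.
  by move=> i ij; rewrite !mxE (negbTE ij) mul0r.
have key j (v : 'cV[R]_p) : v j 0 ^+ 2 <= q j * (v^T *m A *m v) 0 0.
  have := A_ge0 (v - (v j 0 / q j) *: a j).
  have vAa : (v^T *m A *m a j) 0 0 = v j 0.
    rewrite -mulmxA Aa mxE (bigD1 j)//= big1 ?addr0; first by rewrite !mxE !eqxx mulr1.
    by move=> i ij; rewrite !mxE (negbTE ij) mulr0.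
  have -> : ((v - v j 0 / q j *: a j)^T *m A *m (v - v j 0 / q j *: a j)) 0 0 =
     (v^T *m A *m v) 0 0 - v j 0 / q j * (v^T *m A *m a j) 0 0
     - v j 0 / q j * ((a j)^T *m A *m v) 0 0 + (v j 0 / q j) ^+ 2 * q j.
    move: (v j 0 / q j) => t.
    have -> : (v - t *: a j)^T = v^T - t *: (a j)^T by rewrite linearB/= linearZ.
    rewrite !mulmxBl !mulmxBr -!scalemxAl -!scalemxAr scalerA.
    rewrite /q; move: (v^T *m A *m v) (v^T *m A *m a j) ((a j)^T *m A *m v).
    move: ((a j)^T *m A *m a j) => m1 m2 m3 m4; rewrite !mxE; ring.
  rewrite vAa aAv.
  have -> : (v^T *m A *m v) 0 0 - v j 0 / q j * v j 0 - v j 0 / q j * v j 0 + (v j 0 / q j) ^+ 2 * q j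
    = (v^T *m A *m v) 0 0 - v j 0 ^+ 2 / q j by field; exact: lt0r_neq0.
  by rewrite subr_ge0 ler_pdivrMr// mulrC.
pose C := \sum_j q j.
have C0 : 0 <= C by apply: sumr_ge0 => j _; exact: ltW.
have C1 : 0 < C + 1 by rewrite ltr_wpDl.
exists (C + 1)^-1; first by rewrite invr_gt0.
move=> v; rewrite mulrC ler_pdivrMr// mulrC.
apply: (@le_trans _ _ (C * (v^T *m A *m v) 0 0)); last by rewrite ler_wpM2r// lerDl.
by rewrite /C mulr_suml; apply: ler_sum => j _; exact: key.
Qed.

Lemma quad_perturb p (A B : 'M[R]_p) (e : R) (v : 'cV[R]_p) :
  (forall i j, `|A i j - B i j| <= e) ->
  `|(v^T *m A *m v) 0 0 - (v^T *m B *m v) 0 0| <= p%:R * e * normsq v.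
Proof.
move=> AB; rewrite !mxE11 -sumrB.
apply: le_trans (ler_norm_sum _ _ _) _.
have -> : p%:R * e * normsq v = \sum_(i < p) \sum_(j < p) e * ((v i 0 ^+ 2 + v j 0 ^+ 2) / 2).
  under eq_bigr do rewrite -mulr_sumr -mulr_suml big_split/= sumr_const card_ord.
  rewrite -mulr_sumr -mulr_suml big_split/= sumr_const card_ord sumrMnl -/(normsq v).
  by rewrite -(mulr_natr (normsq v) p); field.
apply: ler_sum => i _; rewrite -sumrB; apply: le_trans (ler_norm_sum _ _ _) _.
apply: ler_sum => j _.
rewrite -mulrBl -mulrBr mulrAC mulrC normrM ler_pM// normrM.
rewrite -(real_normK (num_real (v i 0))) -(real_normK (num_real (v j 0))).
have := sqr_ge0 (`|v i 0| - `|v j 0|); lra.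
Qed.

End posdef.

Lemma insub_ord p i (ip : (i < p)%N) : insub i = Some (Ordinal ip) :> option 'I_p.
Proof. by rewrite insubT. Qed.

Section gram_schmidt.
Context {R : realType}.
Variables (n K : nat) (X : 'M[R]_(n, K)).
Hypothesis pG : posdefmx (X^T *m X).

Definition embed_mx p q : 'M[R]_(p, q) := \matrix_(i, j) ((i : nat) == j)%:R.

Lemma firstcolsE k : (k <= K)%N -> firstcols X k = X *m embed_mx K k.
Proof.
move=> kK; apply/matrixP => i j; rewrite !mxE.
have jK : (j < K)%N := leq_trans (ltn_ord j) kK.
rewrite (insub_ord jK)/= (bigD1 (Ordinal jK))//= big1 ?addr0; first by rewrite mxE eqxx mulr1.
move=> l lj; rewrite mxE; case: eqP => [e|_]; last by rewrite mulr0.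
by move: lj; rewrite -val_eqE/= e eqxx.
Qed.

Lemma embed_mx_mul p q (v : 'cV[R]_q) (i : 'I_p) :
  (embed_mx p q *m v) i 0 = oapp (fun j => v j 0) 0 (insub (i : nat) : option 'I_q).
Proof.
rewrite mxE; case: insubP => /= [j jq ji|qi].
  rewrite (bigD1 j)//= big1 ?addr0; first by rewrite mxE ji eqxx mul1r.
  move=> l lj; rewrite mxE; case: eqP => [e|_]; last by rewrite mul0r.
  by move: lj; rewrite -val_eqE/= -e ji eqxx.
rewrite big1// => j _; rewrite mxE; case: eqP => [e|_]; last by rewrite mul0r.
by move: qi; rewrite e ltn_ord.
Qed.

Lemma embed_mx_tr_mul p q (v : 'cV[R]_p) (j : 'I_q) :
  ((embed_mx p q)^T *m v) j 0 = oapp (fun i => v i 0) 0 (insub (j : nat) : option 'I_p).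
Proof.
rewrite -embed_mx_mul; congr (fun_of_matrix (_ *m v) j 0).
by apply/matrixP => a b; rewrite !mxE eq_sym.
Qed.

Lemma gram_firstcols k : (k <= K)%N ->
  (firstcols X k)^T *m firstcols X k = (embed_mx K k)^T *m (X^T *m X) *m embed_mx K k.
Proof. by move=> kK; rewrite firstcolsE// trmx_mul !mulmxA. Qed.

Lemma gram_firstcols_posdef k : (k <= K)%N ->
  posdefmx ((firstcols X k)^T *m firstcols X k).
Proof.
move=> kK v v0; rewrite gram_firstcols//.
have -> : v^T *m ((embed_mx K k)^T *m (X^T *m X) *m embed_mx K k) *m v =
    (embed_mx K k *m v)^T *m (X^T *m X) *m (embed_mx K k *m v).
  by rewrite trmx_mul !mulmxA.
apply: pG; apply: contra_neq v0 => Ev; apply/matrixP => i j.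
have iK : (i < K)%N := leq_trans (ltn_ord i) kK.
have := embed_mx_mul v (Ordinal iK); rewrite Ev mxE (insub_ord (ltn_ord i))/= => e.
by rewrite ord1 mxE e; congr (v _ 0); apply: val_inj.
Qed.

Variable k : 'I_K.
Let kK : (k.+1 <= K)%N := ltn_ord k.
Let Gk := (firstcols X k.+1)^T *m firstcols X k.+1.
Let uG : Gk \in unitmx. Proof. exact/posdefmx_unit/gram_firstcols_posdef. Qed.
Let e : 'cV[R]_k.+1 := delta_mx ord_max 0.

(* [X *m gs_vec] is, up to scaling, the residual of column [k] of [X] on the columns before it *)
Definition gs_vec : 'cV[R]_K := embed_mx K k.+1 *m (invmx Gk *m e).

Let sGk : (invmx Gk)^T = invmx Gk.
Proof. by rewrite trmx_inv /Gk trmx_mul trmxK. Qed.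

Lemma gs_vec_supp (j : 'I_K) : (k < j)%N -> gs_vec j 0 = 0.
Proof. by move=> kj; rewrite /gs_vec embed_mx_mul insubF//= ltnS leqNgt kj. Qed.

Lemma gs_vec_gram (j : 'I_K) : (j <= k)%N -> (X^T *m X *m gs_vec) j 0 = (j == k)%:R.
Proof.
move=> jk; have jk1 : (j < k.+1)%N by [].
have := embed_mx_tr_mul (X^T *m X *m gs_vec) (Ordinal jk1).
rewrite /= (insub_ord (ltn_ord j))/=.
have -> : (embed_mx K k.+1)^T *m (X^T *m X *m gs_vec) = e.
  rewrite -[RHS](mulKVmx uG) [X in _ = X *m _](gram_firstcols kK).
  by rewrite /gs_vec !mulmxA.
have -> : Ordinal (ltn_ord j) = j by exact: val_inj.
by move=> <-; rewrite /e mxE eqxx andbT -!val_eqE.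
Qed.

Definition gs_scale : R := gs_vec k 0.

Lemma gs_scaleE : gs_scale = (invmx Gk) ord_max ord_max.
Proof.
rewrite /gs_scale /gs_vec embed_mx_mul (insub_ord (ltnSn k))/= mxE (bigD1 ord_max)//= big1 ?addr0.
  rewrite mxE !eqxx mulr1; congr (invmx Gk _ _); exact: val_inj.
by move=> i im; rewrite mxE (negbTE im) mulr0.
Qed.

Lemma gs_scale_quad : (gs_vec^T *m (X^T *m X) *m gs_vec) 0 0 = gs_scale.
Proof.
rewrite -mulmxA mxE (bigD1 k)//= big1 ?addr0.
  by rewrite gs_vec_gram// eqxx mulr1 mxE.
move=> j jk; rewrite [gs_vec^T _ _]mxE; have [jlek|kj] := leqP j k.
  by rewrite gs_vec_gram// (negbTE jk) mulr0.
by rewrite gs_vec_supp// mul0r.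
Qed.

Lemma gs_scale_gt0 : 0 < gs_scale.
Proof.
rewrite -gs_scale_quad; apply: pG; apply/eqP => b0.
by have := gs_vec_gram (leqnn k); rewrite b0 mulmx0 mxE eqxx => /esym/eqP; rewrite oner_eq0.
Qed.

Definition gs_unit : 'cV[R]_n := (Num.sqrt gs_scale)^-1 *: (X *m gs_vec).

Lemma gs_unit_tr : gs_unit^T = (Num.sqrt gs_scale)^-1 *: (X *m gs_vec)^T.
Proof. by rewrite /gs_unit; apply/matrixP => i j; rewrite !mxE. Qed.

Lemma lastcoord_ols (Y : 'cV[R]_n) :
  lastcoord (ols (firstcols X k.+1) Y) = ((X *m gs_vec)^T *m Y) 0 0.
Proof.
rewrite /lastcoord /= (insub_ord (ltnSn k))/= /ols -/Gk.
have -> : X *m gs_vec = firstcols X k.+1 *m (invmx Gk *m e).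
  by rewrite firstcolsE// /gs_vec !mulmxA.
rewrite !trmx_mul sGk -!mulmxA [RHS]mxE (bigD1 ord_max)//= big1 ?addr0.
  by rewrite /e !mxE !eqxx mul1r; apply: eq_bigr => i _; congr (invmx Gk _ _ * _); exact: val_inj.
by move=> i im; rewrite /e !mxE (negbTE im) mul0r.
Qed.

Lemma Ztilde_gs (Y : 'cV[R]_n) : (0 < n)%N ->
  Ztilde X Y k.+1 = (gs_unit^T *m Y) 0 0 / Num.sqrt (sigma2hat X Y).
Proof.
move=> n0; have nR : 0 < n%:R :> R by rewrite ltr0n.
rewrite /Ztilde /= ltnNge kK /= lastcoord_ols.
have uZ : n%:R^-1 *: Gk \in unitmx.
  by rewrite unitmxZ ?unitfE ?invr_eq0 ?gt_eqF.
rewrite -/Gk invmxZ// invrK.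
have -> : lastdiag (n%:R *: invmx Gk) = n%:R * gs_scale.
  rewrite /lastdiag/= (insub_ord (ltnSn k))/= mxE gs_scaleE; congr (_ * invmx Gk _ _); exact: val_inj.
rewrite [Num.sqrt (n%:R * _)]sqrtrM ?ler0n// gs_unit_tr -scalemxAl [in RHS]mxE.
have sn : Num.sqrt n%:R != 0 :> R by rewrite gt_eqF// sqrtr_gt0.
have ss : Num.sqrt gs_scale != 0 by rewrite gt_eqF// sqrtr_gt0 gs_scale_gt0.
rewrite [Num.sqrt (sigma2hat X Y) * _]mulrC invfM invfM.
set q := ((X *m gs_vec)^T *m Y) 0 0; set w := (Num.sqrt (sigma2hat X Y))^-1.
by field; rewrite sn ss.
Qed.

Lemma gs_unit_entry (c : R) i : 0 < c ->
  (forall v : 'cV[R]_K, c * normsq v <= (v^T *m (X^T *m X) *m v) 0 0) ->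
  `|gs_unit i 0| <= Num.sqrt (\sum_l X i l ^+ 2) / Num.sqrt c.
Proof.
move=> c0 cG; have s0 := gs_scale_gt0.
have x0 : 0 <= \sum_l X i l ^+ 2 by apply: sumr_ge0 => l _; rewrite sqr_ge0.
have bs : normsq gs_vec <= gs_scale / c.
  by rewrite ler_pdivlMr// mulrC -gs_scale_quad.
rewrite -(@ler_pXn2r _ 2)// ?nnegrE ?divr_ge0 ?sqrtr_ge0//.
rewrite real_normK ?num_real// expr_div_n !sqr_sqrtr// ?(ltW c0)//.
have -> : gs_unit i 0 = (Num.sqrt gs_scale)^-1 * (X *m gs_vec) i 0 by rewrite /gs_unit mxE.
rewrite exprMn exprVn sqr_sqrtr ?(ltW s0)//.
have := dot_le_normsq (row i X) gs_vec.
have -> : (row i X *m gs_vec) 0 0 = (X *m gs_vec) i 0 by rewrite -row_mul mxE.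
under eq_bigr do rewrite mxE.
move=> /le_trans /(_ (ler_wpM2l x0 bs)) H.
by rewrite mulrC ler_pdivrMr// mulrAC -mulrA.
Qed.

Lemma gs_scale_le (c : R) : 0 < c ->
  (forall v : 'cV[R]_K, c * normsq v <= (v^T *m (X^T *m X) *m v) 0 0) ->
  gs_scale <= c^-1.
Proof.
move=> c0 cG; have s0 := gs_scale_gt0.
have := cG gs_vec; rewrite gs_scale_quad => H.
have : c * gs_scale ^+ 2 <= gs_scale.
  by apply: le_trans H; rewrite ler_wpM2l ?(ltW c0)// /gs_scale le_normsq.
by rewrite expr2 mulrA ger_pMl// -[c^-1]mul1r ler_pdivlMr// mulrC.
Qed.

Lemma gs_unit_mean (beta : 'cV[R]_K) :
  (gs_unit^T *m (X *m beta)) 0 0 =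
  (Num.sqrt gs_scale)^-1 * \sum_j (X^T *m X *m gs_vec) j 0 * beta j 0.
Proof.
rewrite gs_unit_tr -scalemxAl mxE; congr (_ * _).
have -> : (X *m gs_vec)^T *m (X *m beta) = (X^T *m X *m gs_vec)^T *m beta.
  by rewrite !trmx_mul trmxK !mulmxA.
by rewrite mxE; apply: eq_bigr => j _; rewrite mxE.
Qed.

End gram_schmidt.

Section gram_schmidt2.
Context {R : realType}.
Variables (n K : nat) (X : 'M[R]_(n, K)).
Hypothesis pG : posdefmx (X^T *m X).

Lemma gs_unit_orthonormal (k l : 'I_K) :
  ((gs_unit X k)^T *m gs_unit X l) 0 0 = (k == l)%:R.
Proof.
wlog kl : k l / (k <= l)%N.
  move=> H; have [/H//|/ltnW lk] := leqP k l.
  rewrite eq_sym -(H l k lk) [LHS]mxE [RHS]mxE; apply: eq_bigr => i _.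
  by rewrite [(gs_unit X k)^T _ _]mxE [(gs_unit X l)^T _ _]mxE mulrC.
have s0 j := gs_scale_gt0 pG j.
have E : ((X *m gs_vec X k)^T *m (X *m gs_vec X l)) 0 0 = (k == l)%:R * gs_scale X k.
  have -> : (X *m gs_vec X k)^T *m (X *m gs_vec X l) = (gs_vec X k)^T *m (X^T *m X *m gs_vec X l).
    by rewrite trmx_mul !mulmxA.
  rewrite mxE (bigD1 k)//= big1 ?addr0; first by rewrite mxE gs_vec_gram// mulrC.
  move=> j jk; rewrite [(gs_vec X k)^T _ _]mxE; have [jlek|kj] := leqP j k.
    rewrite gs_vec_gram ?(leq_trans jlek)//.
    have -> : (j == l) = false.
      apply/eqP => jl; move: jk; rewrite jl -val_eqE/= eqn_leq kl -jl.
      by rewrite jlek.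
    by rewrite mulr0.
  by rewrite gs_vec_supp// mul0r.
rewrite gs_unit_tr /gs_unit -scalemxAl -scalemxAr scalerA mxE E.
have [->|_] := eqVneq k l; last by rewrite mul0r mulr0.
have r2 := sqr_sqrtr (ltW (s0 l)).
have r0 : Num.sqrt (gs_scale X l) != 0 by rewrite gt_eqF// sqrtr_gt0.
move: r2 r0; set r := Num.sqrt _ => r2 r0; rewrite mul1r -r2.
by rewrite mulr1n; field.
Qed.

End gram_schmidt2.

Section hat_matrix.
Context {R : realType}.
Variables (n K : nat) (X : 'M[R]_(n, K)).
Hypothesis pG : posdefmx (X^T *m X).
Let uG := posdefmx_unit pG.

Definition hat_mx : 'M[R]_n := X *m invmx (X^T *m X) *m X^T.

Lemma hat_mx_tr : hat_mx^T = hat_mx.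
Proof. by rewrite /hat_mx !trmx_mul trmx_inv trmx_mul !trmxK mulmxA. Qed.

Lemma hat_mxX : hat_mx *m X = X.
Proof. by rewrite /hat_mx -!mulmxA mulVmx// mulmx1. Qed.

Lemma hat_mx_idem : hat_mx *m hat_mx = hat_mx.
Proof. by rewrite {2}/hat_mx !mulmxA hat_mxX. Qed.

Lemma hat_mx_trace : \tr hat_mx = K%:R.
Proof. by rewrite /hat_mx mxtrace_mulC mulmxA mulmxV// mxtrace1. Qed.

Lemma hat_mx_ge0 (E : 'cV[R]_n) : 0 <= (E^T *m hat_mx *m E) 0 0.
Proof.
rewrite -hat_mx_idem -{1}hat_mx_tr.
have -> : E^T *m (hat_mx^T *m hat_mx) *m E = (hat_mx *m E)^T *m (hat_mx *m E).
  by move: hat_mx => H; rewrite trmx_mul !mulmxA.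
by rewrite normsqE normsq_ge0.
Qed.

Lemma sigma2hatE (beta : 'cV[R]_K) (E : 'cV[R]_n) :
  sigma2hat X (X *m beta + E) =
  (normsq E - (E^T *m hat_mx *m E) 0 0) / (n - K)%:R.
Proof.
rewrite /sigma2hat; congr (_ / _).
rewrite -[LHS]/(normsq _).
have -> : X *m beta + E - X *m ols X (X *m beta + E) = E - hat_mx *m E.
  have -> : X *m ols X (X *m beta + E) = hat_mx *m (X *m beta + E).
    by rewrite /ols /hat_mx !mulmxA.
  rewrite mulmxDr [hat_mx *m (X *m beta)]mulmxA hat_mxX.
  by rewrite opprD addrACA subrr add0r.
rewrite -!normsqE.
have -> : (E - hat_mx *m E)^T *m (E - hat_mx *m E) = E^T *m E - E^T *m hat_mx *m E.
  have -> : (E - hat_mx *m E)^T = E^T - E^T *m hat_mx.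
    by rewrite linearB/= trmx_mul hat_mx_tr.
  have := hat_mx_idem; move: hat_mx => H HH.
  rewrite mulmxBl !mulmxBr !mulmxA -[E^T *m H *m H]mulmxA HH.
  by rewrite subrr subr0.
by rewrite !mxE.
Qed.

End hat_matrix.

Section orthonormal_design.
Context {R : realType}.
Variables (n K : nat) (X : 'M[R]_(n, K)).
Hypothesis pG : posdefmx (X^T *m X).
Hypothesis n0 : (0 < n)%N.
Hypothesis oX : n%:R^-1 *: (X^T *m X) = 1%:M.

Let nR : n%:R != 0 :> R. Proof. by rewrite pnatr_eq0 -lt0n. Qed.

Let GE : X^T *m X = n%:R%:M.
Proof. by rewrite -[LHS](scalerK (a := n%:R^-1)) ?invr_eq0// oX invrK scalemx1. Qed.

Lemma gs_vec_orth (k : 'I_K) : gs_vec X k = n%:R^-1 *: delta_mx k 0.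
Proof.
apply/matrixP => j l; rewrite (ord1 l) {l} [RHS]mxE [X in _ * X]mxE eqxx andbT.
have [kj|jk] := ltnP k j.
  rewrite gs_vec_supp//; have -> : (j == k) = false by rewrite -val_eqE/= gtn_eqF.
  by rewrite mulr0.
have := gs_vec_gram pG jk; rewrite GE mul_scalar_mx [LHS]mxE => <-.
by rewrite mulKf.
Qed.

Lemma gs_scale_orth (k : 'I_K) : gs_scale X k = n%:R^-1.
Proof. by rewrite /gs_scale gs_vec_orth !mxE !eqxx mulr1. Qed.

Lemma gs_unit_mean_orth (k : 'I_K) (beta : 'cV[R]_K) :
  ((gs_unit X k)^T *m (X *m beta)) 0 0 = Num.sqrt n%:R * beta k 0.
Proof.
rewrite gs_unit_mean gs_scale_orth sqrtrV ?ler0n// invrK; congr (_ * _).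
rewrite (bigD1 k)//= big1 ?addr0.
  by rewrite GE mul_scalar_mx mxE gs_vec_orth !mxE !eqxx mulr1 mulfV// mul1r.
move=> j jk; rewrite GE mul_scalar_mx mxE gs_vec_orth !mxE (negbTE jk).
by rewrite !mulr0 mul0r.
Qed.

Lemma Zhat_orth (Y : 'cV[R]_n) (i : 'I_K) : Zhat X Y i = Ztilde X Y i.+1.
Proof.
rewrite (Ztilde_gs pG)// gs_unit_tr gs_scale_orth sqrtrV ?ler0n// invrK.
have -> : Zhat X Y i = Num.sqrt n%:R * ols X Y i 0 / Num.sqrt (sigma2hat X Y).
  have E1 : (1%:M : 'M[R]_K) i i = 1 by rewrite mxE eqxx.
  by rewrite /Zhat oX invmx1 E1 sqrtr1 mulr1.
congr (_ / _).
rewrite /ols GE invmx_scalar gs_vec_orth -scalemxAr.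
have -> : (n%:R^-1 *: (X *m (delta_mx i 0 : 'cV[R]_K)))^T = n%:R^-1 *: (delta_mx 0 i *m X^T).
  have <- : (delta_mx i 0 : 'cV[R]_K)^T = delta_mx 0 i by exact: trmx_delta.
  by rewrite -trmx_mul; apply/matrixP => a b; rewrite !mxE.
rewrite mul_scalar_mx -!scalemxAl -mulmxA -rowE !mxE; congr (_ * (_ * _)).
Qed.

End orthonormal_design.

(** * Linear and quadratic forms in the errors *)

Section errors.
Context d (T : measurableType d) (R : realType) (P : probability T R).
Notation Ex := (Ex P).
Notation itg := (itg P).
Variable eps : nat -> T -> R.
Hypothesis meps : forall i, measurable_fun setT (eps i).
Hypothesis ieps : mutual_indep P setT eps.
Variables (sigma M : R).
Hypothesis sigma0 : 0 < sigma.
Hypothesis eps1 : forall i, Ex (eps i) = 0.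
Hypothesis eps2 : forall i, Ex (fun w => eps i w ^+ 2) = sigma ^+ 2.
Hypothesis eps4 : forall i, Ex (fun w => eps i w ^+ 4) <= M.
Hypothesis ieps4 : forall i, itg (fun w => eps i w ^+ 4).

Let ieps2 i : itg (fun w => eps i w ^+ 2) := itg_eps_le meps ieps4 i (isT : 2 <= 4)%N.

Lemma itg_mul2 (f g : T -> R) : measurable_fun setT f -> measurable_fun setT g ->
  itg (fun w => f w ^+ 2) -> itg (fun w => g w ^+ 2) -> itg (fun w => f w * g w).
Proof.
move=> mf mg if2 ig2; apply: (@itg_le _ _ _ P _ (fun w => f w ^+ 2 + g w ^+ 2)).
- exact: measurable_funM.
- exact: itgD.
- move=> w; rewrite normrM -(real_normK (num_real (f w))) -(real_normK (num_real (g w))).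
  have := sqr_ge0 (`|f w| - `|g w|); have := normr_ge0 (f w); have := normr_ge0 (g w).
  by set a := `|_|; set b := `|_|; nra.
Qed.

Lemma itg_eps_mul i j : itg (fun w => eps i w * eps j w).
Proof. exact: itg_mul2. Qed.

Lemma Ex_eps_mul i j : Ex (fun w => eps i w * eps j w) = sigma ^+ 2 * (i == j)%:R.
Proof.
have [->|ij] := eqVneq i j.
  by rewrite mulr1 -(eps2 j); congr Ex; apply/funext => w; rewrite expr2.
rewrite mulr0 (indep_mul (I := setT) (fun i _ => meps i) ieps (f := id) (g := id) ij)//.
by rewrite !eps1 mulr0.
Qed.

Definition errv n (w : T) : 'cV[R]_n := \col_(i < n) eps i w.

Lemma quad_errvE n (A : 'M[R]_n) w :
  ((errv n w)^T *m A *m errv n w) 0 0 = \sum_(i < n) \sum_(j < n) A i j * (eps i w * eps j w).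
Proof.
rewrite mxE11; apply: eq_bigr => i _; apply: eq_bigr => j _.
by rewrite !mxE mulrAC mulrC.
Qed.

Lemma itg_quad n (A : 'M[R]_n) : itg (fun w => ((errv n w)^T *m A *m errv n w) 0 0).
Proof.
under eq_fun do rewrite quad_errvE.
by apply: itg_sum => i; apply: itg_sum => j; exact/itgZ/itg_eps_mul.
Qed.

Lemma Ex_quad n (A : 'M[R]_n) :
  Ex (fun w => ((errv n w)^T *m A *m errv n w) 0 0) = sigma ^+ 2 * \tr A.
Proof.
under eq_fun do rewrite quad_errvE.
rewrite Ex_sum => [|i]; last by apply: itg_sum => j; exact/itgZ/itg_eps_mul.
rewrite /mxtrace mulr_sumr; apply: eq_bigr => i _.
rewrite Ex_sum => [|j]; last exact/itgZ/itg_eps_mul.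
rewrite (bigD1 i)//= big1 ?addr0 => [|j ji].
  by rewrite ExZ ?Ex_eps_mul ?eqxx ?mulr1 1?mulrC//; exact: itg_eps_mul.
rewrite ExZ ?Ex_eps_mul; last exact: itg_eps_mul.
by rewrite -[(i : nat) == j]/(i == j) eq_sym (negbTE ji) !mulr0.
Qed.

Definition errdot n (u : 'cV[R]_n) (w : T) : R := (u^T *m errv n w) 0 0.

Lemma errdotE n (u : 'cV[R]_n) w : errdot u w = \sum_(j < n) u j 0 * eps j w.
Proof. by rewrite /errdot mxE; apply: eq_bigr => j _; rewrite !mxE. Qed.

Lemma meas_errdot n (u : 'cV[R]_n) : measurable_fun setT (errdot u).
Proof.
rewrite (_ : errdot u = fun w => \sum_(j < n) u j 0 * eps j w); last by apply/funext => w; exact: errdotE.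
by apply: measurable_sum => j; exact: measurable_funM.
Qed.

Lemma errdot_sqrE n (u : 'cV[R]_n) w :
  errdot u w ^+ 2 = ((errv n w)^T *m (u *m u^T) *m errv n w) 0 0.
Proof.
have -> : (errv n w)^T *m (u *m u^T) *m errv n w = (u^T *m errv n w)^T *m (u^T *m errv n w).
  by rewrite trmx_mul trmxK !mulmxA.
by rewrite normsqE /normsq big_ord1.
Qed.

Lemma itg_errdot_sqr n (u : 'cV[R]_n) : itg (fun w => errdot u w ^+ 2).
Proof. by under eq_fun do rewrite errdot_sqrE; exact: itg_quad. Qed.

Lemma Ex_errdot_sqr n (u : 'cV[R]_n) : Ex (fun w => errdot u w ^+ 2) = sigma ^+ 2 * normsq u.
Proof.
under eq_fun do rewrite errdot_sqrE.
by rewrite Ex_quad mxtrace_mulC -normsqE /mxtrace big_ord1.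
Qed.

Let M0 : 0 <= M := M_ge0 eps4.

Let cen i w := eps i w ^+ 2 - sigma ^+ 2.

Let icen i : itg (cen i). Proof. by apply: itgB => //; exact: itg_cst. Qed.

Let cen_sqr i : (fun w => cen i w ^+ 2) =
  (fun w => eps i w ^+ 4 + (- (2 * sigma ^+ 2) * eps i w ^+ 2 + sigma ^+ 4)).
Proof. by apply/funext => w; rewrite /cen; ring. Qed.

Let icen2 i : itg (fun w => cen i w ^+ 2).
Proof. by rewrite cen_sqr; apply: itgD => //; apply: itgD; [exact: itgZ|exact: itg_cst]. Qed.

Let Ecen2 i : Ex (fun w => cen i w ^+ 2) <= M.
Proof.
rewrite cen_sqr ExD//; last by apply: itgD; [exact: itgZ|exact: itg_cst].
rewrite ExD; [|exact: itgZ|exact: itg_cst].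
rewrite ExZ// eps2 Ex_cst.
have := eps4 i; have : 0 <= sigma ^+ 4 by rewrite exprn_ge0// ltW.
have -> : - (2 * sigma ^+ 2) * sigma ^+ 2 = - 2 * sigma ^+ 4 by ring.
lra.
Qed.

Let mcen i : measurable_fun setT (cen i). Proof. exact: itg_meas (icen i). Qed.

Let icen_mul i j : itg (fun w => cen i w * cen j w).
Proof. exact: itg_mul2. Qed.

Let Ecen_mul i j : i != j -> Ex (fun w => cen i w * cen j w) = 0.
Proof.
move=> ij; pose f (x : R) := x ^+ 2 - sigma ^+ 2.
have mf : measurable_fun setT f by apply: measurable_funB => //; exact: measurable_funX.
have -> : Ex (fun w => cen i w * cen j w) = Ex (cen i) * Ex (cen j).
  by apply: (indep_mul (I := setT) (fun i _ => meps i) ieps (f := f) (g := f) ij) => //; exact: icen2.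
by rewrite /cen ExB ?eps2 ?Ex_cst ?subrr ?mul0r//; exact: itg_cst.
Qed.

Definition sqdev n w := \sum_(i < n) cen i w.

Lemma itg_sqdev n : itg (sqdev n). Proof. exact: itg_sum. Qed.

Lemma Ex_abs_sqdev n : (0 < n)%N -> Ex (fun w => `|sqdev n w|) <= Num.sqrt n%:R * (M + 1) / 2.
Proof.
move=> n0; have sn : 0 < Num.sqrt n%:R :> R by rewrite sqrtr_gt0 ltr0n.
set r := Num.sqrt n%:R in sn *; have r2 : r ^+ 2 = n%:R by rewrite sqr_sqrtr.
have E2 w : sqdev n w ^+ 2 = \sum_(i < n) \sum_(j < n) cen i w * cen j w.
  by rewrite expr2 /sqdev mulr_suml; apply: eq_bigr => i _; rewrite mulr_sumr.
have i2 : itg (fun w => sqdev n w ^+ 2).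
  by under eq_fun do rewrite E2; apply: itg_sum => i; exact: itg_sum.
have Es : Ex (fun w => sqdev n w ^+ 2) <= n%:R * M.
  under eq_fun do rewrite E2.
  rewrite Ex_sum => [|i]; last exact: itg_sum.
  rewrite mulr_natl -[X in _ <= M *+ X](card_ord n) -sumr_const; apply: ler_sum => i _.
  rewrite Ex_sum// (bigD1 i)//= big1 ?addr0 => [|j ji].
    by apply: le_trans (Ecen2 i); under [in leRHS]eq_fun do rewrite expr2.
  by apply: Ecen_mul; rewrite -[(i : nat) == j]/(i == j) eq_sym.
(* AM-GM: [|q| <= q ^ 2 / (2 r) + r / 2] *)
apply: (@le_trans _ _ (Ex (fun w => (2 * r)^-1 * sqdev n w ^+ 2 + r / 2))).
  apply: le_Ex.
  - exact/itg_norm/itg_sqdev.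
  - by apply: itgD; [exact: itgZ|exact: itg_cst].
  - move=> w; rewrite -(real_normK (num_real (sqdev n w))).
    rewrite -subr_ge0; have -> : (2 * r)^-1 * `|sqdev n w| ^+ 2 + r / 2 - `|sqdev n w| =
       (2 * r)^-1 * (`|sqdev n w| - r) ^+ 2 by field; exact: lt0r_neq0.
    by rewrite mulr_ge0 ?sqr_ge0// invr_ge0 mulr_ge0// ltW.
rewrite ExD; [|exact: itgZ|exact: itg_cst].
rewrite ExZ// Ex_cst.
apply: (@le_trans _ _ ((2 * r)^-1 * (r ^+ 2 * M) + r / 2)).
  by rewrite lerD2r ler_wpM2l ?r2// invr_ge0 mulr_ge0// ltW.
by rewrite le_eqVlt; apply/orP; left; apply/eqP; field; exact: lt0r_neq0.
Qed.

Section variance_estimator.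
Variables (K : nat) (H : forall n, 'M[R]_n).
Hypothesis H0 : forall n w, (K < n)%N -> 0 <= ((errv n w)^T *m H n *m errv n w) 0 0.
Hypothesis Htr : forall n, (K < n)%N -> \tr (H n) = K%:R.

Definition var_est n w : R :=
  (normsq (errv n w) - ((errv n w)^T *m H n *m errv n w) 0 0) / (n - K)%:R.

Lemma meas_var_est n : measurable_fun setT (var_est n).
Proof.
apply: measurable_funM => //; apply: measurable_funB; last exact: itg_meas (itg_quad (H n)).
rewrite (_ : (fun w => normsq (errv n w)) = fun w => \sum_(i < n) eps i w ^+ 2).
  by apply: measurable_sum => i; exact: measurable_funX.
by apply/funext => w; rewrite /normsq; apply: eq_bigr => i _; rewrite mxE.
Qed.

Lemma var_est_dev n w : (K < n)%N ->
  (n - K)%:R * `|var_est n w - sigma ^+ 2| <=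
  `|sqdev n w| + (K%:R * sigma ^+ 2 + ((errv n w)^T *m H n *m errv n w) 0 0).
Proof.
move=> Kn; have nK : 0 < (n - K)%:R :> R by rewrite ltr0n subn_gt0.
have := H0 w Kn; set h := (_ *m _) 0 0 => h0.
rewrite -{1}(ger0_norm (ltW nK)) -normrM.
have -> : (n - K)%:R * (var_est n w - sigma ^+ 2) = sqdev n w + (K%:R * sigma ^+ 2 - h).
  rewrite mulrBr /var_est mulrCA mulfV ?gt_eqF// mulr1 -/h natrB ?(ltnW Kn)//.
  have -> : sqdev n w = normsq (errv n w) - n%:R * sigma ^+ 2.
    rewrite /sqdev sumrB sumr_const card_ord -mulr_natl; congr (_ - _).
    by apply: eq_bigr => i _; rewrite mxE.
    by ring.
  ring.
apply: le_trans (ler_normD _ _) _; rewrite lerD2l.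
apply: le_trans (ler_normB _ _) _; rewrite !ger0_norm//.
by rewrite mulr_ge0// sqr_ge0.
Qed.

Lemma var_est_consistent (delta : R) : 0 < delta ->
  (fun n => pr P [set w | delta <= `|var_est n w - sigma ^+ 2|]) @ \oo --> (0 : R).
Proof.
move=> d0.
pose C := (M + 1) / 2 + 2 * K%:R * sigma ^+ 2.
have sg2 : 0 <= sigma ^+ 2 by exact: sqr_ge0.
have C0 : 0 <= C.
  by apply: addr_ge0; [apply: divr_ge0 => //; exact: addr_ge0|apply: mulr_ge0 => //; exact: mulr_ge0].
have bound n : (2 * K < n)%N -> (0 < n)%N ->
    pr P [set w | delta <= `|var_est n w - sigma ^+ 2|] <= 2 * C / delta * (Num.sqrt n%:R)^-1.
  move=> Kn n0; have Kn' : (K < n)%N by lia.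
  have nR : 0 < n%:R :> R by rewrite ltr0n.
  have nK : n%:R / 2 <= (n - K)%:R :> R.
    rewrite ler_pdivrMr// -natrM ler_nat; lia.
  have nK0 : 0 < (n - K)%:R :> R by rewrite ltr0n; lia.
  pose X w := `|sqdev n w| + (K%:R * sigma ^+ 2 + ((errv n w)^T *m H n *m errv n w) 0 0).
  have iX : itg X.
    apply: itgD; first exact/itg_norm/itg_sqdev.
    by apply: itgD; [exact: itg_cst|exact: itg_quad].
  have X0 w : 0 <= X w by rewrite addr_ge0// addr_ge0 ?H0// mulr_ge0// sqr_ge0.
  have EX : Ex X <= Num.sqrt n%:R * C.
    rewrite ExD; [|exact/itg_norm/itg_sqdev|by apply: itgD; [exact: itg_cst|exact: itg_quad]].
    rewrite ExD; [|exact: itg_cst|exact: itg_quad].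
    rewrite Ex_cst Ex_quad Htr// /C mulrDr; apply: lerD.
      by rewrite mulrA; exact: Ex_abs_sqdev.
    have -> : K%:R * sigma ^+ 2 + sigma ^+ 2 * K%:R = 2 * K%:R * sigma ^+ 2 by ring.
    rewrite ler_peMl//; first by apply: mulr_ge0 => //; exact: mulr_ge0.
    by rewrite -[leLHS]sqrtr1 ler_sqrt// ler1n.
  have mX : measurable_fun setT X by exact: itg_meas iX.
  have dK : 0 < delta * (n - K)%:R by rewrite mulr_gt0.
  apply: (@le_trans _ _ (pr P [set w | delta * (n - K)%:R <= X w])).
    apply: pr_le; [|exact: measurable_ge_fun|].
      apply: measurable_ge_fun; apply: measurableT_comp => //; apply: measurable_funB => //; exact: meas_var_est.
    move=> w /= dw; apply: le_trans (var_est_dev w Kn').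
    by rewrite mulrC ler_wpM2l// ltW.
  apply: le_trans (pr_markov iX X0 dK) _.
  rewrite ler_pdivrMr//; apply: le_trans EX _.
  set r := Num.sqrt n%:R; have r0 : 0 < r by rewrite sqrtr_gt0.
  apply: (@le_trans _ _ (2 * C / delta / r * (delta * (n%:R / 2)))); last first.
    rewrite ler_wpM2l ?ler_wpM2l ?(ltW d0)//.
    by rewrite !mulr_ge0 ?invr_ge0 ?(ltW d0) ?(ltW r0).
  rewrite -(sqr_sqrtr (ler0n R n)) -/r le_eqVlt; apply/orP; left; apply/eqP.
  by field; rewrite !lt0r_neq0.
have cv : (fun n : nat => 2 * C / delta * (Num.sqrt n%:R)^-1 : R) @ \oo --> (0 : R).
  rewrite -[X in _ --> X](mulr0 (2 * C / delta)); apply: cvgMr.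
  apply/cvgrPdist_le => e e0; near=> n.
  have n0 : (0 < n)%N by near: n; exact: nbhs_infty_gt.
  have nR : 0 < n%:R :> R by rewrite ltr0n.
  rewrite sub0r normrN ger0_norm ?invr_ge0 ?sqrtr_ge0//.
  rewrite -[e]invrK lef_pV2 ?posrE ?invr_gt0 ?sqrtr_gt0//.
  rewrite -[e^-1]ger0_norm ?invr_ge0 ?(ltW e0)// -sqrtr_sqr ler_sqrt//.
  by near: n; exact: nbhs_infty_ger.
apply: (squeeze_cvgr _ (cvg_cst 0) cv); near=> n.
rewrite pr_ge0/=; apply: bound; near: n; exact: nbhs_infty_gt.
Unshelve. all: by end_near. Qed.

End variance_estimator.

Section weights.
Variables (K N : nat) (u : forall n, 'I_K -> 'cV[R]_n).
Hypothesis uo : forall n k l, (N <= n)%N -> ((u n k)^T *m u n l) 0 0 = (k == l)%:R.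
Hypothesis us : forall e : R, 0 < e -> \forall n \near \oo, forall k i, `|u n k i 0| <= e.

Definition score n k w : R := sigma^-1 * errdot (u n k) w.

Lemma meas_score n k : measurable_fun setT (score n k).
Proof. by apply: measurable_funM => //; exact: meas_errdot. Qed.

Lemma score_sqr n k : (N <= n)%N -> itg (fun w => score n k w ^+ 2) /\ Ex (fun w => score n k w ^+ 2) <= 1.
Proof.
move=> Nn; have E : (fun w => score n k w ^+ 2) = (fun w => (sigma^-1) ^+ 2 * errdot (u n k) w ^+ 2).
  by apply/funext => w; rewrite /score exprMn.
rewrite E; split; first exact/itgZ/itg_errdot_sqr.
rewrite ExZ ?Ex_errdot_sqr -?normsqE ?uo ?eqxx ?mulr1//; last exact: itg_errdot_sqr.
by rewrite -exprMn mulVf ?expr1n// lt0r_neq0.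
Qed.

Lemma score_cos (c : R) (t : 'I_K -> R) :
  (fun n => Ex (fun w => cos (c + \sum_k t k * score n k w))) @ \oo -->
  cos c * expR (- (\sum_k t k ^+ 2) / 2).
Proof.
pose tt : R := \sum_k t k ^+ 2.
have tt0 : 0 <= tt by apply: sumr_ge0 => k _; rewrite sqr_ge0.
pose D := 2 * taylor_cst sigma M * (sigma^-1 ^+ 2 * tt) + 1.
have tc := taylor_cst_ge0 sigma eps4.
have st0 : 0 <= sigma^-1 ^+ 2 * tt by rewrite mulr_ge0// sqr_ge0.
have D0 : 0 < D by rewrite ltr_wpDl// mulr_ge0// mulr_ge0.
pose A := sigma^-1 * (\sum_k `|t k|) + 1.
have A0 : 0 < A by rewrite ltr_wpDl// mulr_ge0 ?invr_ge0 ?sumr_ge0// ltW.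
apply/cvgrPdist_le => e e0.
pose e1 := Num.min 1 (e / D).
have e10 : 0 < e1 by rewrite lt_min ltr01 divr_gt0.
have eA : 0 < e1 / A by rewrite divr_gt0.
near=> n.
have Nn : (N <= n)%N by near: n; exact: nbhs_infty_ge.
have un : forall k i, `|u n k i 0| <= e1 / A by near: n; exact: us.
pose v : 'cV[R]_n := sigma^-1 *: \sum_k t k *: u n k.
have vE i : v i 0 = sigma^-1 * \sum_k t k * u n k i 0.
  by rewrite mxE summxE; congr (_ * _); apply: eq_bigr => k _; rewrite mxE.
have ve i : `|v i 0| <= e1.
  rewrite vE normrM (ger0_norm (_ : 0 <= sigma^-1)) ?invr_ge0 ?(ltW sigma0)//.
  apply: (@le_trans _ _ (A * (e1 / A))); last by rewrite mulrC divfK// gt_eqF.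
  apply: (@le_trans _ _ (sigma^-1 * ((\sum_k `|t k|) * (e1 / A)))).
    rewrite ler_wpM2l ?invr_ge0 ?(ltW sigma0)// mulr_suml.
    apply: le_trans (ler_norm_sum _ _ _) _; apply: ler_sum => k _.
    by rewrite normrM ler_wpM2l.
  by rewrite mulrA ler_wpM2r ?(ltW eA)// lerDl.
pose a (j : nat) : R := oapp (fun i : 'I_n => v i 0) 0 (insub j).
have aE (i : 'I_n) : a i = v i 0 by rewrite /a valK.
have sum_a w : \sum_k t k * score n k w = \sum_(j < n) a j * eps j w.
  transitivity (errdot v w).
    rewrite errdotE; under [RHS]eq_bigr do rewrite vE.
    under [LHS]eq_bigr do rewrite /score errdotE mulrCA mulr_sumr.
    rewrite -mulr_sumr exchange_big/= mulr_sumr; apply: eq_bigr => j _.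
    rewrite -mulrA; congr (_ * _); rewrite mulr_suml; apply: eq_bigr => k _.
    by rewrite mulrA.
  by rewrite errdotE; apply: eq_bigr => j _; rewrite aE.
have a2 : \sum_(j < n) a j ^+ 2 = sigma^-1 ^+ 2 * tt.
  transitivity (normsq v); first by apply: eq_bigr => j _; rewrite aE.
  rewrite -normsqE.
  have vT : v^T = sigma^-1 *: \sum_k t k *: (u n k)^T.
    apply/matrixP => i j; rewrite (ord1 i) mxE vE mxE summxE; congr (_ * _).
    by apply: eq_bigr => k _; rewrite !mxE.
  rewrite vT /v -scalemxAl -scalemxAr scalerA -expr2 mxE; congr (_ * _).
  rewrite mulmx_suml summxE; apply: eq_bigr => k _.
  rewrite mulmx_sumr summxE (bigD1 k)//= big1 ?addr0 => [|l lk].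
    by rewrite -scalemxAl -scalemxAr scalerA mxE uo// eqxx mulr1 expr2.
  by rewrite -scalemxAl -scalemxAr scalerA mxE uo// eq_sym (negbTE lk) mulr0.
have a1 (j : nat) : (j < n)%N -> `|a j| <= 1.
  move=> jn; rewrite -[j]/(val (Ordinal jn)) aE; apply: le_trans (ve _) _.
  by rewrite ge_min lexx.
have a3 : \sum_(j < n) `|a j| ^+ 3 <= e1 * (sigma^-1 ^+ 2 * tt).
  rewrite -a2 mulr_sumr; apply: ler_sum => j _.
  rewrite exprS -(real_normK (num_real (a j))) ler_wpM2r ?exprn_ge0//.
  by rewrite aE.
have -> : (fun w => cos (c + \sum_k t k * score n k w)) =
    (fun w => cos (c + \sum_(j < n) a j * eps j w)).
  by apply/funext => w; rewrite sum_a.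
have := cos_sum_approx meps ieps eps1 eps2 eps4 ieps4 c a1.
rewrite a2 -/tt.
have -> : sigma ^+ 2 * (sigma^-1 ^+ 2 * tt) = tt.
  by rewrite mulrA -exprMn mulfV ?expr1n ?mul1r// lt0r_neq0.
rewrite distrC [expR _ * cos c]mulrC mulNr => /le_trans; apply.
apply: (@le_trans _ _ (2 * taylor_cst sigma M * (e1 * (sigma^-1 ^+ 2 * tt)))).
  by rewrite ler_wpM2l// mulr_ge0.
apply: (@le_trans _ _ (D * e1)).
  by rewrite mulrCA mulrC ler_wpM2r ?(ltW e10)// /D lerDl.
apply: (@le_trans _ _ (D * (e / D))); last by rewrite mulrC divfK// gt_eqF.
by rewrite ler_wpM2l ?(ltW D0)// ge_min lexx orbT.
Unshelve. all: by end_near. Qed.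

Lemma score_box (z : 'I_K -> R) (s : seq 'I_K) : (forall k, 0 < z k) -> uniq s ->
  (fun n => pr P [set w | all (fun k => `|score n k w| < z k) s]) @ \oo -->
  \prod_(k <- s) pr (@normal_prob R 0 1) `]-z k, z k[.
Proof. by move=> z0 uns; have := box_cvg meas_score score_cos score_sqr z0 uns; exact. Qed.

End weights.

End errors.

(** * Studentized scores *)

Section studentized_scores.
Context d (T : measurableType d) (R : realType) (P : probability T R).
Notation Ex := (Ex P).
Notation itg := (itg P).
Notation G := (@normal_prob R 0 1).
Variables (K N : nat) (V : nat -> 'I_K -> T -> R) (S2 : nat -> T -> R) (sigma : R).
Hypothesis sigma0 : 0 < sigma.
Hypothesis mV : forall n k, measurable_fun setT (V n k).
Hypothesis mS : forall n, measurable_fun setT (S2 n).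
Hypothesis V2 : forall n k, (N <= n)%N -> itg (fun w => V n k w ^+ 2) /\
  Ex (fun w => V n k w ^+ 2) <= 1.
Hypothesis Vbox : forall (z : 'I_K -> R) (s : seq 'I_K), (forall k, 0 < z k) -> uniq s ->
  (fun n => pr P [set w | all (fun k => `|V n k w| < z k) s]) @ \oo -->
  \prod_(k <- s) pr G `]-z k, z k[.
Hypothesis S2c : forall delta : R, 0 < delta ->
  (fun n => pr P [set w | delta <= `|S2 n w - sigma ^+ 2|]) @ \oo --> (0 : R).
Variables (m : nat -> 'I_K -> R) (z : 'I_K -> R).
Hypothesis z0 : forall k, 0 < z k.

Definition studentized n k w : R := (m n k + sigma * V n k w) / Num.sqrt (S2 n w).

Lemma meas_sqrt (f : T -> R) : measurable_fun setT f -> measurable_fun setT (fun w => Num.sqrt (f w)).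
Proof. by move=> mf; apply: measurableT_comp mf; apply: continuous_measurable_fun; exact: sqrt_continuous. Qed.

Lemma meas_studentized n k : measurable_fun setT (studentized n k).
Proof.
apply: measurable_funM.
  by apply: measurable_funD => //; exact: measurable_funM.
rewrite (_ : (fun w => _) = (@powR R ^~ (-1)) \o (fun w => Num.sqrt (S2 n w))).
  by apply: measurableT_comp; [exact: measurable_powR|exact: meas_sqrt].
by apply/funext => w /=; rewrite powR_inv1// sqrtr_ge0.
Qed.

Lemma measurable_lt (f : T -> R) (a : R) : measurable_fun setT f -> measurable [set w | `|f w| < a].
Proof.
move=> mf; rewrite (_ : [set _ | _] = (fun w => `|f w|) @^-1` `]-oo, a[).
  rewrite -[X in measurable X]setTI; apply: measurableT_comp => //.
by apply/seteqP; split => w /=; rewrite in_itv/=.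
Qed.

Lemma measurable_ge (f : T -> R) (a : R) : measurable_fun setT f -> measurable [set w | a <= `|f w|].
Proof. by move=> mf; apply: measurable_ge_fun; apply: measurableT_comp. Qed.

Lemma measurable_all (f : 'I_K -> T -> R) (a : 'I_K -> R) (s : seq 'I_K) :
  (forall k, measurable_fun setT (f k)) -> measurable [set w | all (fun k => `|f k w| < a k) s].
Proof.
move=> mf; elim: s => [|k s IH]; first by rewrite (_ : [set _ | _] = setT)//; apply/seteqP; split.
rewrite (_ : [set _ | _] = [set w | `|f k w| < a k] `&` [set w | all (fun k => `|f k w| < a k) s]).
  by apply: measurableI => //; exact: measurable_lt.
by apply/seteqP; split => w /=; [move=> /andP|move=> [-> ->]].
Qed.

Let bad (delta : R) n := [set w | sigma ^+ 2 * delta <= `|S2 n w - sigma ^+ 2|].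

Let mbad delta n : measurable (bad delta n).
Proof. by apply: measurable_ge; exact: measurable_funB. Qed.

Let badc (delta : R) : 0 < delta -> (fun n => pr P (bad delta n)) @ \oo --> (0 : R).
Proof. by move=> d0; apply: S2c; rewrite mulr_gt0// exprn_gt0. Qed.

Let good (delta : R) n w : 0 < delta < 1 -> ~ bad delta n w ->
  sigma * (1 - delta) < Num.sqrt (S2 n w) < sigma * (1 + delta).
Proof.
move=> /andP[d0 d1] /negP; rewrite -ltNge ltr_norml => /andP[l1 l2].
have s20 : 0 < sigma ^+ 2 by rewrite exprn_gt0.
have S0 : 0 < S2 n w by nra.
have d0' : 0 <= sigma * (1 - delta) by rewrite mulr_ge0 ?subr_ge0 ?(ltW sigma0) ?(ltW d1).
have d1' : 0 <= sigma * (1 + delta) by rewrite mulr_ge0 ?addr_ge0 ?(ltW d0) ?(ltW sigma0).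
apply/andP; split.
  rewrite -(@ltr_pXn2r _ 2)// ?nnegrE ?sqrtr_ge0// sqr_sqrtr ?(ltW S0)// exprMn.
  by apply: le_lt_trans (_ : sigma ^+ 2 * (1 - delta) < _); [rewrite ler_wpM2l ?(ltW s20)//; nra|lra].
rewrite -(@ltr_pXn2r _ 2)// ?nnegrE ?sqrtr_ge0// sqr_sqrtr ?(ltW S0)// exprMn.
by apply: lt_le_trans (_ : _ < sigma ^+ 2 * (1 + delta)) _; [lra|rewrite ler_wpM2l ?(ltW s20)//; nra].
Qed.

Lemma studentized_box (s : seq 'I_K) : uniq s ->
  (\forall n \near \oo, forall k, k \in s -> m n k = 0) ->
  (fun n => pr P [set w | all (fun k => `|studentized n k w| < z k) s]) @ \oo -->
  \prod_(k <- s) pr G `]-z k, z k[.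
Proof.
move=> us m0.
have p0 : 0 < normal_peak 1 :> R by rewrite normal_peak_gt0// oner_neq0.
pose C := \sum_(k <- s) 4 * normal_peak 1 * z k.
have C0 : 0 <= C by apply: sumr_ge0 => k _; rewrite !mulr_ge0 ?ltW.
apply/cvgrPdist_le => e e0.
pose del := Num.min (2^-1) (e / 3 / (C + 1)).
have C1 : 0 < C + 1 by rewrite ltr_wpDl.
have d0 : 0 < del by rewrite lt_min invr_gt0 ltr0n/= !divr_gt0.
have d2 : del <= 2^-1 by rewrite ge_min lexx.
have d01 : 0 < del < 1 by rewrite d0/=; lra.
have dC : C * del <= e / 3.
  apply: (@le_trans _ _ ((C + 1) * (e / 3 / (C + 1)))); last by rewrite mulrC divfK// gt_eqF.
  by apply: ler_pM => //; [exact: ltW|rewrite lerDl|rewrite ge_min lexx orbT].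
pose zu k := z k * (1 + del); pose zl k := z k * (1 - del).
have zu0 k : 0 < zu k by rewrite mulr_gt0// addr_gt0.
have zl0 k : 0 < zl k by rewrite mulr_gt0// subr_gt0; lra.
have pG y : 0 <= pr G `]-y, y[ <= 1 by rewrite pr_ge0 pr_le1.
have CE : C * del = \sum_(k <- s) 4 * normal_peak 1 * z k * del by rewrite mulr_suml.
have h0 k : 0 <= 4 * normal_peak 1 * z k * del by rewrite !mulr_ge0 ?(ltW d0) ?(ltW p0) ?(ltW (z0 k)).
have Gu : \prod_(k <- s) pr G `]-zu k, zu k[ <= \prod_(k <- s) pr G `]-z k, z k[ + e / 3.
  apply: (@le_trans _ _ (\prod_(k <- s) pr G `]-z k, z k[ + C * del)); last by rewrite lerD2l.
  rewrite CE; apply: prod_le_sum => // k.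
  have zk := z0 k; have zd : 0 <= normal_peak 1 * z k * del by rewrite !mulr_ge0 ?ltW.
  apply: le_trans (pr_gauss_sym_le (z0 k) _) _; first by rewrite /zu mulrDr mulr1 lerDl mulr_ge0 ?ltW.
  rewrite lerD2l /zu; nra.
have Gl : \prod_(k <- s) pr G `]-z k, z k[ <= \prod_(k <- s) pr G `]-zl k, zl k[ + e / 3.
  apply: (@le_trans _ _ (\prod_(k <- s) pr G `]-zl k, zl k[ + C * del)); last by rewrite lerD2l.
  rewrite CE; apply: prod_le_sum => // k.
  have zk := z0 k; have zd : 0 <= normal_peak 1 * z k * del by rewrite !mulr_ge0 ?ltW.
  apply: le_trans (pr_gauss_sym_le (zl0 k) _) _.
    by rewrite /zl ler_piMr ?(ltW zk)//; lra.
  rewrite lerD2l /zl; nra.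
have /cvgrPdist_le Cu := Vbox zu0 us; have /cvgrPdist_le Cl := Vbox zl0 us.
have /cvgrPdist_le Cb := badc d0.
have e3 : 0 < e / 3 by rewrite divr_gt0.
near=> n.
have m0n k : k \in s -> m n k = 0 by move: k; near: n; exact: m0.
have D1 : `|\prod_(k <- s) pr G `]-zu k, zu k[
    - pr P [set w | all (fun k => `|V n k w| < zu k) s]| <= e / 3 by near: n; exact: Cu.
have D2 : `|\prod_(k <- s) pr G `]-zl k, zl k[
    - pr P [set w | all (fun k => `|V n k w| < zl k) s]| <= e / 3 by near: n; exact: Cl.
have D3 : `|0 - pr P (bad del n)| <= e / 3 by near: n; exact: Cb.
pose A := [set w | all (fun k => `|studentized n k w| < z k) s].
pose Bu := [set w | all (fun k => `|V n k w| < zu k) s].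
pose Bl := [set w | all (fun k => `|V n k w| < zl k) s].
have mA : measurable A by apply: measurable_all => k; exact: meas_studentized.
have mBu : measurable Bu by exact: measurable_all.
have mBl : measurable Bl by exact: measurable_all.
have Zlt w k : ~ bad del n w -> k \in s -> (`|studentized n k w| < z k) = (sigma * `|V n k w| < z k * Num.sqrt (S2 n w)).
  move=> nb ks; have /andP[s1 s2] := good d01 nb.
  have S0 : 0 < Num.sqrt (S2 n w) by apply: le_lt_trans s1; rewrite mulr_ge0 ?(ltW sigma0)//; lra.
  rewrite /studentized m0n// add0r normrM normfV (gtr0_norm S0) ltr_pdivrMr// normrM.
  by rewrite (gtr0_norm sigma0).
have AB : A `<=` Bu `|` bad del n.
  move=> w /= Aw; have [bw|nb] := pselect (bad del n w); [by right|left].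
  apply/allP => k ks; have := allP Aw k ks; rewrite /= Zlt//.
  have /andP[s1 s2] := good d01 nb.
  move=> H; have : sigma * `|V n k w| < z k * (sigma * (1 + del)).
    by apply: lt_trans H _; rewrite ltr_pM2l.
  by rewrite mulrCA ltr_pM2l.
have BA : Bl `<=` A `|` bad del n.
  move=> w /= Bw; have [bw|nb] := pselect (bad del n w); [by right|left].
  apply/allP => k ks; have := allP Bw k ks; rewrite /= Zlt//.
  have /andP[s1 s2] := good d01 nb.
  move=> H; apply: (@lt_trans _ _ (z k * (sigma * (1 - del)))); last by rewrite ltr_pM2l.
  by rewrite mulrCA ltr_pM2l.
have mb := mbad del n.
have P1 : pr P A <= pr P Bu + pr P (bad del n).
  by apply: le_trans (pr_setU_le P mBu mb); apply: pr_le => //; exact: measurableU.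
have P2 : pr P Bl <= pr P A + pr P (bad del n).
  by apply: le_trans (pr_setU_le P mA mb); apply: pr_le => //; exact: measurableU.
move: D1 D2 D3 Gu Gl P1 P2; rewrite -/A -/Bu -/Bl !ler_norml.
set a1 := \prod_(_ <- _) _; set a2 := \prod_(_ <- _) _; set a3 := \prod_(_ <- _) _.
set b1 := pr P Bu; set b2 := pr P Bl; set b3 := pr P (bad _ _); set b4 := pr P A.
by move=> /andP[? ?] /andP[? ?] /andP[? ?] ? ? ? ?; apply/andP; split; lra.
Unshelve. all: by end_near. Qed.

Lemma studentized_diverge k : (forall A : R, \forall n \near \oo, A <= `|m n k|) ->
  (fun n => pr P [set w | `|studentized n k w| < z k]) @ \oo --> (0 : R).
Proof.
move=> mk; apply/cvgrPdist_le => e e0.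
have half : 0 < (2^-1 : R) < 1 by lra.
have /cvgrPdist_le Cb := badc (proj1 (andP half)).
have e2 : 0 < e / 2 by rewrite divr_gt0.
pose L := Num.sqrt (2 / e).
have L2 : L ^+ 2 = 2 / e by rewrite sqr_sqrtr// divr_ge0// ltW.
have L20 : 0 < L ^+ 2 by rewrite L2 divr_gt0.
have zk := z0 k.
near=> n.
have Nn : (N <= n)%N by near: n; exact: nbhs_infty_ge.
have mn : sigma * L + 2 * sigma * z k <= `|m n k| by near: n; exact: mk.
have D3 : `|0 - pr P (bad (2^-1) n)| <= e / 2 by near: n; exact: Cb.
have [iV EV] := V2 k Nn.
pose A := [set w | `|studentized n k w| < z k].
pose B := [set w | L ^+ 2 <= V n k w ^+ 2].
have mA : measurable A by apply: measurable_lt; exact: meas_studentized.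
have mB : measurable B.
  rewrite (_ : B = [set w | L ^+ 2 <= `|V n k w ^+ 2|]); last first.
    by apply/seteqP; split => w /=; rewrite (ger0_norm (sqr_ge0 _)).
  by apply: measurable_ge; exact: measurable_funX.
have mb := mbad (2^-1) n.
have AB : A `<=` B `|` bad (2^-1) n.
  move=> w /= Aw; have [bw|nb] := pselect (bad (2^-1) n w); [by right|left].
  have /andP[s1 s2] := good half nb.
  have S0 : 0 < Num.sqrt (S2 n w) by apply: le_lt_trans s1; rewrite mulr_ge0 ?(ltW sigma0)//; lra.
  move: Aw; rewrite /A/= /studentized normrM normfV (gtr0_norm S0) ltr_pdivrMr// => Aw.
  have Aw2 : `|m n k + sigma * V n k w| < z k * (2 * sigma).
    by apply: lt_trans Aw _; rewrite ltr_pM2l//; lra.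
  have : `|m n k| <= `|m n k + sigma * V n k w| + `|sigma * V n k w|.
    by rewrite -{1}(addrK (sigma * V n k w) (m n k)); exact: ler_normB.
  rewrite normrM (gtr0_norm sigma0) => tri.
  have LV : sigma * L <= sigma * `|V n k w| by lra.
  rewrite /B/= -(real_normK (num_real (V n k w))) lerXn2r// ?nnegrE ?sqrtr_ge0//.
  by rewrite -(ler_pM2l sigma0).
have P1 : pr P A <= pr P B + pr P (bad (2^-1) n).
  by apply: le_trans (pr_setU_le P mB mb); apply: pr_le => //; exact: measurableU.
have P2 : pr P B <= e / 2.
  apply: le_trans (pr_markov iV (fun w => sqr_ge0 _) L20) _.
  rewrite L2 ler_pdivrMr ?divr_gt0//; apply: le_trans EV _.
  by rewrite le_eqVlt; apply/orP; left; apply/eqP; field; exact: lt0r_neq0.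
rewrite sub0r normrN ger0_norm ?pr_ge0//; apply: le_trans P1 _.
by move: D3; rewrite sub0r normrN ger0_norm ?pr_ge0// => D3; lra.
Unshelve. all: by end_near. Qed.

Variables (zer : pred 'I_K) (dom : pred 'I_K).
Hypothesis mzer : \forall n \near \oo, forall k, dom k -> zer k -> m n k = 0.
Hypothesis mdiv : forall k, dom k -> ~~ zer k -> forall A : R, \forall n \near \oo, A <= `|m n k|.

(* limit of the probability of [`|Z k| < z k]: the mean of [Z k] vanishes if [zer k] and
   diverges otherwise *)
Definition acc_prob k : R := if zer k then pr G `]-z k, z k[ else 0.

Lemma studentized_accept (s : seq 'I_K) : uniq s -> all dom s ->
  (fun n => pr P [set w | all (fun k => `|studentized n k w| < z k) s]) @ \oo -->
  \prod_(k <- s) acc_prob k.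
Proof.
move=> us ds; have [az|/allPn[k ks nz]] := boolP (all zer s).
  have -> : \prod_(k <- s) acc_prob k = \prod_(k <- s) pr G `]-z k, z k[.
    by apply: eq_big_seq => k ks; rewrite /acc_prob (allP az).
  apply: studentized_box => //; near=> n => k ks.
  suff : forall k, dom k -> zer k -> m n k = 0 by apply; [exact: (allP ds)|exact: (allP az)].
  by near: n; exact: mzer.
rewrite (big_rem k)//= {1}/acc_prob (negbTE nz) mul0r.
have C := studentized_diverge (mdiv (allP ds k ks) nz).
apply: (squeeze_cvgr _ (cvg_cst 0) C); near=> n.
rewrite pr_ge0/=; apply: pr_le.
- by apply: measurable_all => j; exact: meas_studentized.
- by apply: measurable_lt; exact: meas_studentized.
- by move=> w /= /allP/(_ k ks).
Unshelve. all: by end_near. Qed.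

Definition pattern n (s1 s2 : seq 'I_K) : set T :=
  [set w | all (fun k => z k <= `|studentized n k w|) s1 && all (fun k => `|studentized n k w| < z k) s2].

Lemma measurable_pattern n s1 s2 : measurable (pattern n s1 s2).
Proof.
rewrite (_ : pattern n s1 s2 = [set w | all (fun k => z k <= `|studentized n k w|) s1] `&`
  [set w | all (fun k => `|studentized n k w| < z k) s2]).
  apply: measurableI; last by apply: measurable_all => k; exact: meas_studentized.
  elim: s1 => [|k s IH]; first by rewrite (_ : [set _ | _] = setT)//; apply/seteqP; split.
  rewrite (_ : [set _ | _] = [set w | z k <= `|studentized n k w|] `&` [set w | all (fun k => z k <= `|studentized n k w|) s]).
    by apply: measurableI => //; apply: measurable_ge; exact: meas_studentized.
  by apply/seteqP; split => w /=; [move=> /andP|move=> [-> ->]].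
by apply/seteqP; split => w; rewrite /pattern/=; [move=> /andP|move=> [-> ->]].
Qed.

Lemma pattern_cvg (s1 s2 : seq 'I_K) : uniq (s1 ++ s2) -> all dom (s1 ++ s2) ->
  (fun n => pr P (pattern n s1 s2)) @ \oo -->
  \prod_(k <- s1) (1 - acc_prob k) * \prod_(k <- s2) acc_prob k.
Proof.
elim: s1 s2 => [|k s1 IH] s2 us ds.
  rewrite big_nil mul1r; have := studentized_accept us ds.
  congr (_ @ _ --> _).
have C1 : (fun n => pr P (pattern n s1 s2)) @ \oo -->
    \prod_(k <- s1) (1 - acc_prob k) * \prod_(k <- s2) acc_prob k.
  by apply: IH; [case/andP: us|case/andP: ds].
have C2 : (fun n => pr P (pattern n s1 (k :: s2))) @ \oo -->
    \prod_(k <- s1) (1 - acc_prob k) * \prod_(k <- k :: s2) acc_prob k.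
  apply: IH; first by rewrite -[k :: s2]cat1s uniq_catCA.
  by move: ds; rewrite /= !all_cat/= andbCA.
have E n : pr P (pattern n (k :: s1) s2) = pr P (pattern n s1 s2) - pr P (pattern n s1 (k :: s2)).
  have mlt : measurable [set w | `|studentized n k w| < z k] by apply: measurable_lt; exact: meas_studentized.
  rewrite (pr_setID P (measurable_pattern n s1 s2) mlt).
  rewrite (_ : pattern n s1 s2 `&` _ = pattern n s1 (k :: s2)); last first.
    apply/seteqP; split => w; rewrite /pattern/=; first by move=> [/andP[-> ->] ->].
    by move=> /andP[-> /andP[-> ->]].
  rewrite addrAC subrr add0r; congr pr; apply/seteqP; split => w; rewrite /pattern/=.
    by move=> /andP[/andP[h ->] ->]; split => //; apply/negP; rewrite -leNgt.
  by move=> [/andP[-> ->]] /negP; rewrite -leNgt => ->.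
rewrite (funext E) !big_cons mulrBl mul1r mulrBl.
have := cvgB C1 C2; rewrite big_cons mulrCA mulrA; exact.
Unshelve. all: by end_near. Qed.

End studentized_scores.

(** * The estimators as acceptance patterns *)

Lemma bigmin_le_mem (I : eqType) (r : seq I) (P : pred I) (F : I -> nat) x i :
  i \in r -> P i -> (\big[minn/x]_(j <- r | P j) F j <= F i)%N.
Proof.
elim: r => // j r IH; rewrite inE big_cons => /predU1P[<-{j}|ir] Pi.
  by rewrite Pi geq_minl.
by case: ifP => _; rewrite ?geq_min IH ?orbT.
Qed.

Lemma leq_bigmin (I : Type) (r : seq I) (P : pred I) (F : I -> nat) x m :
  (m <= x)%N -> (forall i, P i -> (m <= F i)%N) -> (m <= \big[minn/x]_(j <- r | P j) F j)%N.
Proof. by move=> mx mF; elim/big_ind: _ => // a b; rewrite leq_min => -> ->. Qed.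

Section estimators.
Context {R : realType}.
Variables (K : nat) (alpha : nat -> R) (z : 'I_K -> R).
Hypothesis zE : forall k : 'I_K, zq (alpha k.+1 / 2) = (z k)%:E.

(* [Z k], for [k : 'I_K], is the statistic of index k + 1 *)
Variables (n : nat) (X : 'M[R]_(n, K)) (Y : 'cV[R]_n) (Z : 'I_K -> R).

Let acc k := (`|Z k| < z k)%R.
Let rej k := (z k <= `|Z k|)%R.

Let rejN k : rej k = ~~ acc k. Proof. by rewrite /rej leNgt. Qed.

Lemma khatO_eq k : (forall k : 'I_K, Zhat X Y k = Z k) ->
  (khatO alpha X Y == k) = (#|[pred i | rej i]| == k).
Proof.
move=> ZE; rewrite /khatO; congr (_ == _); apply: eq_card => i.
by apply/idP/idP; rewrite in_setE/= inE zE ZE lee_fin.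
Qed.

Hypothesis ZE : forall k : 'I_K, Ztilde X Y k.+1 = Z k.

Let thrE (k : 'I_K) : (thr alpha k.+1 <= (`|Ztilde X Y k.+1|)%:E)%E = rej k.
Proof. by rewrite /thr/= zE ZE lee_fin. Qed.

Let thrlt (k : 'I_K) : ((`|Ztilde X Y k.+1|)%:E < thr alpha k.+1)%E = acc k.
Proof. by rewrite /thr/= zE ZE lte_fin. Qed.

Lemma khatB_eq (k : 'I_K) : (khatB alpha X Y == k.+1) =
  all rej [:: k] && all acc (enum [pred j : 'I_K | (k < j)%N]).
Proof.
rewrite /= andbT; apply/eqP/andP => [kB|[rk /allP aj]].
  have le (i : 'I_K.+1) : (thr alpha i <= (`|Ztilde X Y i|)%:E)%E -> (i <= k.+1)%N.
    by move=> Pi; rewrite -kB; apply: (leq_bigmax_cond i).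
  split.
    apply/negPn/negP => nr.
    suff : (khatB alpha X Y <= k)%N by rewrite kB ltnn.
    apply/bigmax_leqP => i Pi; have := le i Pi; rewrite leq_eqVlt => /predU1P[ik|//].
    by move: Pi; rewrite ik thrE (negbTE nr).
  apply/allP => j; rewrite mem_enum inE => kj.
  rewrite -[acc j]negbK -rejN -thrE; apply/negP => Pj.
  have jK : (j.+1 < K.+1)%N by rewrite ltnS.
  by have := le (Ordinal jK) Pj; rewrite /= ltnS leqNgt kj.
apply/eqP; rewrite eqn_leq; apply/andP; split.
  apply/bigmax_leqP => i Pi; case: i Pi => [[//|j] jK] /= Pj; rewrite ltnS leqNgt; apply/negP => kj.
  have jK' : (j < K)%N by [].
  have := aj (Ordinal jK'); rewrite mem_enum inE/= => /(_ kj).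
  by rewrite -[acc _]negbK -rejN -thrE Pj.
have kK : (k.+1 < K.+1)%N by rewrite ltnS.
by apply: (leq_bigmax_cond (Ordinal kK)); rewrite thrE.
Qed.

Hypothesis aK : alpha K.+1 = 0.

Lemma khatF_eq k : (k <= K)%N -> (khatF alpha X Y == k) =
  all rej (enum [pred j : 'I_K | (j < k)%N]) && all acc (enum [pred j : 'I_K | (j : nat) == k]).
Proof.
move=> kK.
have last_acc : ((`|Ztilde X Y K.+1|)%:E < thr alpha K.+1)%E.
  by rewrite /thr/= aK mul0r zq0 ltry.
have leF (j : 'I_K) : acc j -> (khatF alpha X Y <= j)%N.
  move=> aj; have jK : (j.+1 < K.+2)%N by rewrite ltnS ltnW// ltnS.
  apply: (@bigmin_le_mem _ _ _ (fun i : 'I_K.+2 => i.-1) K (Ordinal jK)).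
    exact: mem_index_enum.
  by rewrite /= thrlt.
have leK : (khatF alpha X Y <= K)%N.
  apply: (@bigmin_le_mem _ _ _ (fun i : 'I_K.+2 => i.-1) K ord_max); first exact: mem_index_enum.
  exact: last_acc.
have Fle m : (m <= K)%N -> (forall j : 'I_K, acc j -> (m <= j)%N) -> (m <= khatF alpha X Y)%N.
  move=> mK mj; apply: leq_bigmin => // -[[//|i] iK]/= Pi.
  have [iK'|Ki] := ltnP i K; last by rewrite (leq_trans mK).
  by have := mj (Ordinal iK'); apply; rewrite -thrlt.
apply/eqP/andP => [kF|[/allP rj /allP ak]].
  split; apply/allP => j; rewrite mem_enum inE => jk.
    by rewrite rejN; apply/negP => /leF; rewrite kF leqNgt jk.
  apply/negPn/negP => naj.
  have kltK : (k < K)%N by rewrite -(eqP jk).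
  suff : (k < khatF alpha X Y)%N by rewrite kF ltnn.
  apply: Fle => // i ai; have := leF i ai; rewrite kF leq_eqVlt => /predU1P[ki|//].
  by move: naj; rewrite (_ : j = i) ?ai//; apply: val_inj; rewrite /= (eqP jk).
apply/eqP; rewrite eqn_leq; apply/andP; split.
  move: kK; rewrite leq_eqVlt => /predU1P[->//|kK].
  by apply: (leF (Ordinal kK)); apply: ak; rewrite mem_enum inE/=.
apply: Fle => // j aj; rewrite leqNgt; apply/negP => jk.
by have := rj j; rewrite mem_enum inE rejN aj => /(_ jk).
Qed.

End estimators.

(** * Sums of independent Bernoulli variables *)

Section disjoint_union.
Context d (T : measurableType d) (R : realType) (P : probability T R).

Lemma pr_disjoint_union (I : eqType) (F : I -> set T) (s : seq I) :
  (forall i, measurable (F i)) -> (forall i j w, F i w -> F j w -> i = j) -> uniq s ->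
  measurable [set w | exists2 i, i \in s & F i w] /\
  pr P [set w | exists2 i, i \in s & F i w] = \sum_(i <- s) pr P (F i).
Proof.
move=> mF dF; elim: s => [|i s IH] us.
  rewrite big_nil (_ : [set _ | _] = set0); first by rewrite /pr measure0.
  by apply/seteqP; split => w // -[].
have [nis us'] := andP us; have [mU EU] := IH us'.
rewrite big_cons -EU -pr_setU//; last first.
  by apply/seteqP; split => // w [Fi [j js Fj]]; move: nis; rewrite (dF i j w Fi Fj) js.
have E : [set w | exists2 j, j \in i :: s & F j w] = F i `|` [set w | exists2 j, j \in s & F j w].
  apply/seteqP; split => w /=.
    by move=> [j]; rewrite inE => /predU1P[->|js] Fj; [left|right; exists j].
  by move=> [Fi|[j js Fj]]; [exists i; rewrite ?mem_head|exists j; rewrite ?inE ?js ?orbT].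
by rewrite E; split => //; exact: measurableU.
Qed.

End disjoint_union.

Section bernoulli_sum.
Context d (T : measurableType d) (R : realType) (Q : probability T R).
Variables (K k0 : nat) (B : nat -> T -> R) (alpha : nat -> R).
Hypothesis k0K : (k0 <= K)%N.
Hypothesis mB : forall j, (k0 < j <= K)%N -> measurable_fun setT (B j).
Hypothesis iB : mutual_indep Q [set j | (k0 < j <= K)%N] B.
Hypothesis B01 : forall j, (k0 < j <= K)%N ->
  Q [set w | B j w = 1] = (alpha j)%:E /\ Q [set w | B j w = 0] = (1 - alpha j)%:E.

Let a (i : 'I_K) : R := if (k0 <= i)%N then 1 - alpha i.+1 else 0.

(* The coordinates below [k0] count as sure successes, hence belong to [A] when [D A] is not
   empty, and [#|A|] is then [k0] plus the number of successes. *)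
Let D (A : {set 'I_K}) : set T := [set w | forall i : 'I_K,
  if i \in A then (k0 <= i)%N -> B i.+1 w = 1 else (k0 <= i)%N /\ B i.+1 w = 0].

Let idx := [seq (nat_of_ord i).+1 | i <- enum [pred i : 'I_K | (k0 <= i)%N]].

Let C (A : {set 'I_K}) (j : nat) : set R :=
  if [exists i : 'I_K, (i.+1 == j) && (i \in A)] then [set 1] else [set 0].

Let CE A (i : 'I_K) : C A i.+1 = if i \in A then [set 1] else [set 0].
Proof.
rewrite /C; case: existsP => [[j /andP[/eqP[ji] jA]]|nE].
  by rewrite (_ : i = j) ?jA//; exact: val_inj.
by case: ifP => // iA; case: nE; exists i; rewrite eqxx.
Qed.

Let DE (A : {set 'I_K}) : (forall i : 'I_K, (i < k0)%N -> i \in A) ->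
  D A = \bigcap_(j in [set j | j \in idx]) (B j @^-1` C A j).
Proof.
move=> hA; apply/seteqP; split => w.
  move=> Dw j /= /mapP[i]; rewrite mem_enum inE => k0i ->; rewrite /= CE.
  by have := Dw i; case: ifP => _; [apply|case].
move=> Cw i; have [k0i|ik0] := leqP k0 i.
  have : i.+1 \in idx by apply: map_f; rewrite mem_enum.
  by move=> /Cw /=; rewrite CE; case: ifP.
by rewrite hA.
Qed.

Let uidx : uniq idx.
Proof. by rewrite map_inj_uniq ?enum_uniq// => i j [/val_inj]. Qed.

Let idxP j : j \in idx -> (k0 < j <= K)%N.
Proof. by move=> /mapP[i]; rewrite mem_enum inE => k0i ->; rewrite ltnS k0i ltn_ord. Qed.

Let mC A j : measurable (C A j).
Proof. by rewrite /C; case: ifP. Qed.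

Let mD A : measurable (D A).
Proof.
have [/forallP hA|/forallPn[i]] := boolP [forall i : 'I_K, (i < k0)%N ==> (i \in A)].
  rewrite DE => [|i ik0]; last exact: (implyP (hA i)).
  rewrite bigcap_seq big_seq; apply: bigsetI_measurable => j /idxP jK.
  by rewrite -[X in measurable X]setTI; apply: mB.
rewrite negb_imply => /andP[ik0 iA].
rewrite (_ : D A = set0)//; apply/seteqP; split => // w /(_ i).
by rewrite (negbTE iA) leqNgt ik0 => -[].
Qed.

Definition pattern_prob (b : 'I_K -> R) (A : {set 'I_K}) : R :=
  \prod_i (if i \in A then 1 - b i else b i).

Lemma sum_pattern_prob b : \sum_(A : {set 'I_K}) pattern_prob b A = 1.
Proof. by rewrite -bigA_distr/= big1// => i _; rewrite subrK. Qed.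

Let pr_D A : pr Q (D A) = pattern_prob a A.
Proof.
have [/forallP hA|/forallPn[i]] := boolP [forall i : 'I_K, (i < k0)%N ==> (i \in A)]; last first.
  rewrite negb_imply => /andP[ik0 iA].
  rewrite (_ : D A = set0); last first.
    apply/seteqP; split => // w /(_ i); by rewrite (negbTE iA) leqNgt ik0 => -[].
  by rewrite /pr measure0 /pattern_prob (bigD1 i)//= (negbTE iA) /a leqNgt ik0 mul0r.
rewrite DE => [|i ik0]; last exact: (implyP (hA i)).
rewrite /pr iB//.
rewrite big_map big_enum/= /pattern_prob [RHS](bigID (fun i : 'I_K => (k0 <= i)%N))/=.
rewrite [X in _ = _ * X]big1 ?mulr1 => [|i]; last first.
  rewrite -ltnNge => ik0; have := implyP (hA i) ik0 => ->.
  by rewrite /a leqNgt ik0 subr0.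
rewrite (eq_bigr (fun i : 'I_K => (if i \in A then 1 - a i else a i)%:E)).
  by rewrite prodEFin.
move=> i; rewrite inE => k0i; have iK : (k0 < i.+1 <= K)%N by rewrite ltnS k0i ltn_ord.
have [B1 B0] := B01 iK.
rewrite CE /a k0i; case: ifP => _; first by rewrite subKr.
exact: B0.
Qed.

Let sumB w (A : {set 'I_K}) : D A w -> (k0 <= #|A|)%N /\ \sum_(k0.+1 <= j < K.+1) B j w = (#|A| - k0)%:R.
Proof.
move=> Dw.
have hA (i : 'I_K) : (i < k0)%N -> i \in A.
  by move=> ik0; apply/negPn/negP => iA; have := Dw i; rewrite (negbTE iA) leqNgt ik0 => -[].
have E : #|A| = (k0 + \sum_(i < K | (k0 <= i)%N) (i \in A))%N.
  rewrite -sum1_card big_mkcond/= (bigID (fun i : 'I_K => (k0 <= i)%N))/= [LHS]addnC.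
  congr (_ + _)%N.
  rewrite (eq_bigr (fun=> 1%N)); last by move=> i; rewrite -ltnNge => /hA ->.
  rewrite (eq_bigl (fun i : 'I_K => (i < k0)%N)); last by move=> i; rewrite ltnNge.
  by rewrite (big_ord_narrow k0K)/= sum_nat_const card_ord muln1.
split; first by rewrite E leq_addr.
rewrite E addKn big_add1/= big_geq_mkord natr_sum; apply: eq_bigr => i k0i.
by have := Dw i; case: (i \in A) => [/(_ k0i)|[]].
Qed.

Lemma pr_bernoulli_sum k : (k0 <= k)%N ->
  Q [set w | \sum_(k0.+1 <= j < K.+1) B j w = (k - k0)%:R] =
  (\sum_(A : {set 'I_K} | #|A| == k) pattern_prob a A)%:E.
Proof.
move=> k0k; set S := [set w | _].
have mS : measurable S.
  pose f w := \sum_(j <- index_iota k0.+1 K.+1) B j w.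
  have mf : measurable_fun setT f.
    have : forall j, j \in index_iota k0.+1 K.+1 -> measurable_fun setT (B j).
      by move=> j; rewrite mem_index_iota ltnS => /mB.
    rewrite /f; elim: (index_iota _ _) => [|j s IH] H.
      by under eq_fun do rewrite big_nil; exact: measurable_cst.
    under eq_fun do rewrite big_cons; apply: measurable_funD; first by apply: H; rewrite mem_head.
    by apply: IH => i js; apply: H; rewrite inE js orbT.
  by rewrite (_ : S = f @^-1` [set (k - k0)%:R])// -[X in measurable X]setTI; apply: mf.
have dD A A' w : D A w -> D A' w -> A = A'.
  move=> h h'; apply/setP => i; have := h i; have := h' i.
  case: (i \in A); case: (i \in A') => //.
    by move=> [k0i B0] /(_ k0i) B1; move: B1; rewrite B0 => /esym/eqP; rewrite oner_eq0.
  by move=> /(_ _) H [k0i B0]; have := H k0i; rewrite B0 => /esym/eqP; rewrite oner_eq0.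
have [mU EU] := pr_disjoint_union Q mD dD (enum_uniq {set 'I_K}).
set U := [set w | _] in mU EU.
have U1 : pr Q U = 1.
  by rewrite EU big_enum/=; under eq_bigr do rewrite pr_D; exact: sum_pattern_prob.
have us := enum_uniq [pred A : {set 'I_K} | #|A| == k].
have [mW EW] := pr_disjoint_union Q mD dD us.
set W := [set w | _] in mW EW.
rewrite prE//; congr EFin.
rewrite (pr_setID Q mS mU).
have -> : pr Q (S `\` U) = 0.
  apply/eqP; rewrite eq_le pr_ge0 andbT.
  apply: (@le_trans _ _ (pr Q (~` U))); last by rewrite pr_setC// U1 subrr.
  by apply: pr_le; [exact: measurableD|exact: measurableC|move=> w []].
rewrite addr0 (_ : S `&` U = W).
  by rewrite EW big_enum/=; apply: eq_bigr => A _; rewrite pr_D.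
apply/seteqP; split => w.
  move=> [Sw [A _ DA]]; exists A => //; rewrite mem_enum inE.
  have [k0A sA] := sumB DA; move: Sw; rewrite /S/= sA => /eqP.
  by rewrite eqr_nat => /eqP AK; rewrite -(subnK k0A) AK subnK.
move=> [A]; rewrite mem_enum inE => /eqP Ak DA; have [k0A sA] := sumB DA.
split; first by rewrite /S/= sA Ak.
by exists A => //; rewrite mem_enum.
Qed.

End bernoulli_sum.

(** * Limits of the selection probabilities *)

Section limits.
Context d (T : measurableType d) (R : realType) (P : probability T R).

Lemma pr_cvg (A B : nat -> set T) (l : R) : (\forall n \near \oo, A n = B n) ->
  (forall n, measurable (B n)) -> (fun n => pr P (B n)) @ \oo --> l ->
  (fun n => P (A n)) @ \oo --> l%:E.
Proof.
move=> AB mB Bl; apply/fine_cvgP; split.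
  near=> n; rewrite (_ : A n = B n); last by near: n.
  exact: fin_num_measure.
apply: cvg_trans Bl; apply: near_eq_cvg; near=> n.
by rewrite /= (_ : A n = B n)//; near: n.
Unshelve. all: by end_near. Qed.

Lemma cvg_fsum (I : Type) (s : seq I) (p : pred I) (f : I -> nat -> R) (l : I -> R) :
  (forall i, f i @ \oo --> l i) ->
  (fun n => \sum_(i <- s | p i) f i n) @ \oo --> \sum_(i <- s | p i) l i.
Proof.
move=> fl; elim: s => [|i s IH].
  rewrite big_nil; under eq_fun do rewrite big_nil; exact: cvg_cst.
rewrite big_cons; under eq_fun do rewrite big_cons.
by case: ifP => // _; exact: cvgD.
Qed.

End limits.

Section design.
Context {R : realType} (K : nat) (X : forall n : nat, 'M[R]_(n, K)) (Sigma0 : 'M[R]_K).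
Hypothesis Xlim : forall i j : 'I_K,
  (fun n => (n%:R^-1 *: ((X n)^T *m X n)) i j) @ \oo --> Sigma0 i j.
Hypothesis pS : posdefmx Sigma0.

Lemma gram_limit_sym : Sigma0^T = Sigma0.
Proof.
apply/matrixP => i j; rewrite mxE.
have E : (fun n => (n%:R^-1 *: ((X n)^T *m X n)) i j) = (fun n => (n%:R^-1 *: ((X n)^T *m X n)) j i).
  apply/funext => n; rewrite [LHS]mxE [RHS]mxE; congr (_ * _); rewrite [LHS]mxE [RHS]mxE.
  by apply: eq_bigr => l _; rewrite ![(X n)^T _ _]mxE mulrC.
have := @Xlim i j; rewrite E => C; exact: (cvg_unique _ (@Xlim j i) C).
Qed.

Lemma design_coercive : exists2 c : R, 0 < c & \forall n \near \oo, forall v : 'cV[R]_K,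
  c * n%:R * normsq v <= (v^T *m ((X n)^T *m X n) *m v) 0 0.
Proof.
have [c c0 cS] := posdefmx_coercive pS gram_limit_sym.
exists (c / 2); first by rewrite divr_gt0.
pose e := c / 2 / K.+1%:R.
have e0 : 0 < e by rewrite !divr_gt0.
have H : \forall n \near \oo, forall ij : 'I_K * 'I_K,
    `|(n%:R^-1 *: ((X n)^T *m X n)) ij.1 ij.2 - Sigma0 ij.1 ij.2| <= e.
  apply: filter_forall => -[i j] /=.
  have /cvgrPdist_le/(_ _ e0) := @Xlim i j; apply: filterS => n.
  by rewrite distrC.
near=> n => v.
have nR : 0 < n%:R :> R by rewrite ltr0n; near: n; exact: nbhs_infty_gt.
have Hn i j : `|(n%:R^-1 *: ((X n)^T *m X n)) i j - Sigma0 i j| <= e.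
  suff /(_ (i, j)) : forall ij : 'I_K * 'I_K,
    `|(n%:R^-1 *: ((X n)^T *m X n)) ij.1 ij.2 - Sigma0 ij.1 ij.2| <= e by [].
  by near: n.
have := quad_perturb v Hn; rewrite ler_norml => /andP[+ _].
have -> : (v^T *m (n%:R^-1 *: ((X n)^T *m X n)) *m v) 0 0 =
    n%:R^-1 * (v^T *m ((X n)^T *m X n) *m v) 0 0.
  by rewrite -scalemxAr -scalemxAl mxE.
have n0 := normsq_ge0 v.
have : K%:R * e * normsq v <= c / 2 * normsq v.
  apply: ler_wpM2r => //.
  have -> : K%:R * e = c / 2 * (K%:R / K.+1%:R) by rewrite /e; ring.
  by rewrite ler_piMr ?divr_ge0 ?(ltW c0)// ler_pdivrMr ?ltr0n// mul1r ler_nat.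
have := cS v; set q := (v^T *m Sigma0 *m v) 0 0; set g := (_ *m v) 0 0 => h1 h2 h3.
have : c / 2 * normsq v <= n%:R^-1 * g by lra.
by rewrite [n%:R^-1 * g]mulrC ler_pdivlMr// [c / 2 * n%:R * _]mulrAC.
Unshelve. all: by end_near. Qed.

Hypothesis Xmax : (fun n => \big[Num.max/0]_(i < n)
  (Num.sqrt (\sum_(k < K) X n i k ^+ 2) / Num.sqrt n%:R)) @ \oo --> 0.
Hypothesis pG : forall n, (K < n)%N -> posdefmx ((X n)^T *m X n).

Lemma gs_unit_small (e : R) : 0 < e ->
  \forall n \near \oo, forall k i, `|gs_unit (X n) k i 0| <= e.
Proof.
move=> e0; have [c c0 cG] := design_coercive.
have sc : 0 < Num.sqrt c by rewrite sqrtr_gt0.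
have esc : 0 < e * Num.sqrt c by rewrite mulr_gt0.
have /cvgrPdist_le/(_ _ esc) Xm := Xmax.
near=> n => k i.
have Kn : (K < n)%N by near: n; exact: nbhs_infty_gt.
have nR : 0 < n%:R :> R by rewrite ltr0n (leq_trans _ Kn).
have cn : 0 < c * n%:R by rewrite mulr_gt0.
have cGn : forall v : 'cV[R]_K, c * n%:R * normsq v <= (v^T *m ((X n)^T *m X n) *m v) 0 0.
  by near: n.
apply: le_trans (gs_unit_entry (pG Kn) k i cn cGn) _.
have : `|0 - \big[Num.max/0]_(i < n) (Num.sqrt (\sum_(k < K) X n i k ^+ 2) / Num.sqrt n%:R)|
    <= e * Num.sqrt c by near: n.
rewrite sub0r normrN => /(le_trans (ler_norm _)) H.
have := le_trans (le_bigmax_cond 0 (fun i : 'I_n => Num.sqrt (\sum_(k < K) X n i k ^+ 2) / Num.sqrt n%:R) (isT : xpredT i)) H.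
rewrite sqrtrM ?(ltW c0)// => {}H.
by rewrite invfM mulrA mulrAC ler_pdivrMr.
Unshelve. all: by end_near. Qed.

Lemma gs_scale_small : exists2 c : R, 0 < c & \forall n \near \oo, forall k,
  c * Num.sqrt n%:R <= (Num.sqrt (gs_scale (X n) k))^-1.
Proof.
have [c c0 cG] := design_coercive; exists (Num.sqrt c); first by rewrite sqrtr_gt0.
near=> n => k.
have Kn : (K < n)%N by near: n; exact: nbhs_infty_gt.
have nR : 0 < n%:R :> R by rewrite ltr0n (leq_trans _ Kn).
have cn : 0 < c * n%:R by rewrite mulr_gt0.
have cGn : forall v : 'cV[R]_K, c * n%:R * normsq v <= (v^T *m ((X n)^T *m X n) *m v) 0 0.
  by near: n.
have s0 := gs_scale_gt0 (pG Kn) k.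
have := gs_scale_le (pG Kn) k cn cGn.
rewrite -sqrtrM ?(ltW c0)// -sqrtrV ?(ltW s0)// => H.
by rewrite ler_sqrt ?invr_ge0 ?(ltW s0)// -[c * _]invrK lef_pV2 ?posrE ?invr_gt0.
Unshelve. all: by end_near. Qed.

End design.

Section assembly.
Context (R : realType) (d : measure_display) (T : measurableType d)
  (P : probability T R) (K k0 : nat) (beta0 : 'cV[R]_K)
  (X : forall n : nat, 'M[R]_(n, K)) (Sigma0 : 'M[R]_K)
  (eps : nat -> T -> R) (sigma0 M : R) (alpha : nat -> R).
Hypothesis k0K : (1 <= k0 <= K)%N.
Hypothesis beta_nz : forall j : 'I_K, (j < k0)%N -> beta0 j 0 != 0.
Hypothesis beta_z : forall j : 'I_K, (k0 <= j)%N -> beta0 j 0 = 0.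
Hypothesis Xmax : (fun n => \big[Num.max/0]_(i < n)
  (Num.sqrt (\sum_(k < K) X n i k ^+ 2) / Num.sqrt n%:R)) @ \oo --> 0.
Hypothesis pG : forall n, (K < n)%N -> posdefmx ((X n)^T *m X n).
Hypothesis Xlim : forall i j : 'I_K,
  (fun n => (n%:R^-1 *: ((X n)^T *m X n)) i j) @ \oo --> Sigma0 i j.
Hypothesis pS : posdefmx Sigma0.
Hypothesis meps : forall i, measurable_fun setT (eps i).
Hypothesis ieps : mutual_indep P setT eps.
Hypothesis eps1 : forall i, ('E_P[eps i] = 0)%E.
Hypothesis s0 : 0 < sigma0.
Hypothesis eps2 : forall i, ('E_P[(fun w => eps i w ^+ 2)%R] = (sigma0 ^+ 2)%:E)%E.
Hypothesis eps4 : forall i, ('E_P[(fun w => eps i w ^+ 4)%R] <= M%:E)%E.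
Hypothesis alpha01 : forall k, (1 <= k <= K)%N -> 0 < alpha k < 1.

Let itg4 i : itg P (fun w => eps i w ^+ 4).
Proof.
have := eps4 i; rewrite unlock => H.
apply/integrableP; split; first by apply/measurable_EFinP; exact: measurable_funX.
apply: le_lt_trans (ltry M); apply: le_trans H.
rewrite le_eqVlt; apply/orP; left; apply/eqP; apply: eq_integral => w _.
by rewrite /= ger0_norm// exprn_even_ge0.
Qed.

Let Ex1 i : Ex P (eps i) = 0.
Proof. by have := eps1 i; rewrite unlock /Ex /Rintegral => ->. Qed.

Let Ex2 i : Ex P (fun w => eps i w ^+ 2) = sigma0 ^+ 2.
Proof. by have := eps2 i; rewrite unlock /Ex /Rintegral => ->. Qed.

Let Ex4 i : Ex P (fun w => eps i w ^+ 4) <= M.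
Proof.
have := eps4 i; rewrite unlock => H; rewrite -lee_fin /Ex /Rintegral fineK//.
exact: (integrable_fin_num measurableT (itg4 i)).
Qed.

Let u n k := gs_unit (X n) k.
Let V := score eps sigma0 u.
Let S2 := var_est eps K (fun n => hat_mx (X n)).
Let m n k := ((u n k)^T *m (X n *m beta0)) 0 0.

Variable z : 'I_K -> R.
Hypothesis z0 : forall k, 0 < z k.
Hypothesis zE : forall k : 'I_K, zq (alpha k.+1 / 2) = (z k)%:E.
Hypothesis zP : forall k : 'I_K, pr (@normal_prob R 0 1) `]-z k, z k[ = 1 - alpha k.+1.

Let Z n k w := studentized V S2 sigma0 m n k w.

Lemma Ztilde_studentized n w (k : 'I_K) : (K < n)%N ->
  Ztilde (X n) (Yvec (X n) beta0 eps w) k.+1 = Z n k w.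
Proof.
move=> Kn; rewrite (Ztilde_gs (pG Kn)) ?(leq_trans _ Kn)// /Z /studentized.
have YE : Yvec (X n) beta0 eps w = X n *m beta0 + errv eps n w by [].
rewrite YE (sigma2hatE (pG Kn)); congr (_ / _).
rewrite mulmxDr mxE; congr (_ + _).
by rewrite /V /score mulrA mulfV ?mul1r// lt0r_neq0.
Qed.

Let uo n k l : (K.+1 <= n)%N -> ((u n k)^T *m u n l) 0 0 = (k == l)%:R.
Proof. by move=> Kn; exact: gs_unit_orthonormal (pG Kn) k l. Qed.

Let us (e : R) : 0 < e -> \forall n \near \oo, forall k i, `|u n k i 0| <= e.
Proof. exact: (gs_unit_small Xlim pS Xmax pG). Qed.

Let acc := acc_prob z (fun k : 'I_K => (k0 <= k)%N).

Let accE (k : 'I_K) : acc k = if (k0 <= k)%N then 1 - alpha k.+1 else 0.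
Proof. by rewrite /acc /acc_prob zP. Qed.

Let mzer n (k : 'I_K) : (K < n)%N -> (k0 <= k)%N -> m n k = 0.
Proof.
move=> Kn k0k; rewrite /m gs_unit_mean big1 ?mulr0// => j _.
have [jk|kj] := leqP j k; last by rewrite beta_z ?mulr0// (leq_trans k0k)// ltnW.
rewrite (gs_vec_gram (pG Kn))//; have [jk'|_] := eqVneq j k; last by rewrite mul0r.
by rewrite jk' beta_z ?mulr0.
Qed.

Lemma pattern_limit (dom : pred 'I_K) (s1 s2 : seq 'I_K) :
  (forall k : 'I_K, dom k -> (k < k0)%N -> forall A : R, \forall n \near \oo, A <= `|m n k|) ->
  uniq (s1 ++ s2) -> all dom (s1 ++ s2) ->
  (fun n => pr P (pattern V S2 sigma0 m z n s1 s2)) @ \oo -->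
  \prod_(k <- s1) (1 - acc k) * \prod_(k <- s2) acc k.
Proof.
move=> mdiv us' ds.
have mV : forall n k, measurable_fun setT (V n k) by move=> n k; exact: meas_score.
have mS : forall n, measurable_fun setT (S2 n) by move=> n; rewrite /S2; apply: (meas_var_est meps itg4).
have V2 := score_sqr meps ieps s0 Ex1 Ex2 itg4 uo.
have Vbox (z' : 'I_K -> R) (s : seq 'I_K) (z'0 : forall k, 0 < z' k) (us'' : uniq s) :=
  score_box meps ieps s0 Ex1 Ex2 Ex4 itg4 uo us z'0 us''.
have H0 n w (Kn : (K < n)%N) := hat_mx_ge0 (pG Kn) (errv eps n w).
have Htr n (Kn : (K < n)%N) := hat_mx_trace (pG Kn).
have S2c (delta : R) (d0 : 0 < delta) :=
  var_est_consistent meps ieps s0 Ex1 Ex2 Ex4 itg4 H0 Htr d0.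
apply: (pattern_cvg s0 mV mS V2 Vbox S2c z0 _ _ us' ds).
- by near=> n => k _ k0k; apply: mzer => //; near: n; exact: nbhs_infty_gt.
- by move=> k dk; rewrite -ltnNge; exact: mdiv.
Unshelve. all: by end_near. Qed.

Let sqrtn_ge (a : R) : \forall n \near \oo, a <= Num.sqrt n%:R.
Proof.
near=> n; apply: le_trans (ler_norm a) _; rewrite -sqrtr_sqr ler_sqrt ?ler0n//.
by near: n; exact: nbhs_infty_ger.
Unshelve. all: by end_near. Qed.

Let scaled_div (f : nat -> R) (c : R) : 0 < c -> (\forall n \near \oo, c * Num.sqrt n%:R <= f n) ->
  forall A : R, \forall n \near \oo, A <= f n.
Proof.
move=> c0 cf A; near=> n.
have h : c * Num.sqrt n%:R <= f n by near: n.
apply: le_trans h; rewrite -ler_pdivrMl//.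
by near: n; exact: sqrtn_ge.
Unshelve. all: by end_near. Qed.

Lemma mean_diverges (k : 'I_K) : (k0.-1 <= k)%N -> (k < k0)%N ->
  forall A : R, \forall n \near \oo, A <= `|m n k|.
Proof.
move=> k0k kk0; have [c c0 cs] := gs_scale_small Xlim pS pG.
have b0 : 0 < `|beta0 k 0| by rewrite normr_gt0 beta_nz.
apply: (@scaled_div _ (c * `|beta0 k 0|)); first by rewrite mulr_gt0.
near=> n; have Kn : (K < n)%N by near: n; exact: nbhs_infty_gt.
have h : forall k, c * Num.sqrt n%:R <= (Num.sqrt (gs_scale (X n) k))^-1 by near: n.
rewrite /m gs_unit_mean (bigD1 k)//= big1 ?addr0.
  rewrite (gs_vec_gram (pG Kn))// eqxx mul1r normrM mulrAC ler_wpM2r//.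
  by rewrite (le_trans (h k))// ler_norm.
move=> j jk; have [jlek|kj] := leqP j k.
  by rewrite (gs_vec_gram (pG Kn))// (negbTE jk) mul0r.
by rewrite beta_z ?mulr0//; case/andP: k0K => k00 _; lia.
Unshelve. all: by end_near. Qed.

Lemma mean_diverges_orth (oX : forall n, (K < n)%N -> n%:R^-1 *: ((X n)^T *m X n) = 1%:M)
  (k : 'I_K) : (k < k0)%N -> forall A : R, \forall n \near \oo, A <= `|m n k|.
Proof.
move=> kk0; have b0 : 0 < `|beta0 k 0| by rewrite normr_gt0 beta_nz.
apply: (@scaled_div _ `|beta0 k 0|) => //.
near=> n; have Kn : (K < n)%N by near: n; exact: nbhs_infty_gt.
rewrite /m (gs_unit_mean_orth (pG Kn) (leq_ltn_trans (leq0n K) Kn) (oX n Kn))//.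
by rewrite normrM (ger0_norm (sqrtr_ge0 _)) mulrC.
Unshelve. all: by end_near. Qed.

Let pat n s1 s2 := pattern V S2 sigma0 m z n s1 s2.

Let mpat n s1 s2 : measurable (pat n s1 s2).
Proof.
by apply: measurable_pattern => k; [exact: meas_score|apply: (meas_var_est meps itg4)].
Qed.

Lemma khatB_pattern (k : 'I_K) : \forall n \near \oo,
  [set w | khatB alpha (X n) (Yvec (X n) beta0 eps w) = k.+1] =
  pat n [:: k] (enum [pred j : 'I_K | (k < j)%N]).
Proof.
near=> n; have Kn : (K < n)%N by near: n; exact: nbhs_infty_gt.
apply/seteqP; split => w /=.
  by move=> /eqP; rewrite (khatB_eq zE (fun k => Ztilde_studentized w k Kn)).
by move=> H; apply/eqP; rewrite (khatB_eq zE (fun k => Ztilde_studentized w k Kn)).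
Unshelve. all: by end_near. Qed.

Lemma khatF_pattern k : (k <= K)%N -> alpha K.+1 = 0 -> \forall n \near \oo,
  [set w | khatF alpha (X n) (Yvec (X n) beta0 eps w) = k] =
  pat n (enum [pred j : 'I_K | (j < k)%N]) (enum [pred j : 'I_K | (j : nat) == k]).
Proof.
move=> kK aK; near=> n; have Kn : (K < n)%N by near: n; exact: nbhs_infty_gt.
apply/seteqP; split => w /=.
  by move=> /eqP; rewrite (khatF_eq zE (fun k => Ztilde_studentized w k Kn)).
by move=> H; apply/eqP; rewrite (khatF_eq zE (fun k => Ztilde_studentized w k Kn)).
Unshelve. all: by end_near. Qed.

Lemma khatO_pattern k (oX : forall n, (K < n)%N -> n%:R^-1 *: ((X n)^T *m X n) = 1%:M) :
  \forall n \near \oo,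
  [set w | khatO alpha (X n) (Yvec (X n) beta0 eps w) = k] =
  [set w | exists2 A : {set 'I_K}, A \in enum [pred A : {set 'I_K} | #|A| == k] &
    pat n (enum A) (enum (~: A)) w].
Proof.
near=> n; have Kn : (K < n)%N by near: n; exact: nbhs_infty_gt.
have n0 : (0 < n)%N by exact: leq_trans Kn.
have E w := khatO_eq zE (Y := Yvec (X n) beta0 eps w) (Z := fun k => Z n k w) k
  (fun k => etrans (Zhat_orth (pG Kn) n0 (oX n Kn) _ k) (Ztilde_studentized w k Kn)).
apply/seteqP; split => w /=.
  move=> /eqP; rewrite E => /eqP cA.
  pose A := finset (fun i : 'I_K => z i <= `|Z n i w|).
  exists A; first by rewrite mem_enum inE -cA; apply/eqP/eq_card => i; rewrite !inE.
  apply/andP; split; apply/allP => i; rewrite mem_enum !inE//.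
  by rewrite -ltNge.
move=> [A]; rewrite mem_enum inE => /eqP cA /andP[/allP h1 /allP h2].
apply/eqP; rewrite E -cA; apply/eqP/eq_card => i; rewrite !inE.
apply/idP/idP => h; last by apply: h1; rewrite mem_enum.
by apply: contraTT h => iA; rewrite -ltNge; apply: h2; rewrite mem_enum inE.
Unshelve. all: by end_near. Qed.

Let shift_prod (F : nat -> R) (a b : nat) :
  \prod_(a.+1 <= j < b.+1) F j = \prod_(j < b | (a <= j)%N) F j.+1.
Proof. by rewrite big_add1/= big_geq_mkord. Qed.

Lemma backward_limit k : (1 <= k <= K)%N ->
  let p := fun n => P [set w | khatB alpha (X n) (Yvec (X n) beta0 eps w) = k] in
  ((k < k0)%N -> p @ \oo --> 0%E) /\
  (k = k0 -> p @ \oo --> (\prod_(k0.+1 <= j < K.+1) (1 - alpha j))%:E) /\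
  ((k0 < k)%N -> p @ \oo --> (alpha k * \prod_(k.+1 <= j < K.+1) (1 - alpha j))%:E).
Proof.
move=> k1K p; have [k00 k0K'] := andP k0K.
case: k k1K @p => [//|k] kK p.
pose k' := Ordinal (kK : (k < K)%N).
have Ep := khatB_pattern k'.
have ulist (l : 'I_K) : uniq ([:: l] ++ enum [pred j : 'I_K | (l < j)%N]).
  by rewrite /= enum_uniq andbT mem_enum inE ltnn.
have main : (k0 <= k.+1)%N -> p @ \oo -->
    ((1 - acc k') * \prod_(k.+2 <= j < K.+1) (1 - alpha j))%:E.
  move=> k0k; apply: (pr_cvg Ep) => //.
  have := @pattern_limit [pred j : 'I_K | (k0.-1 <= j)%N] [:: k'] (enum [pred j : 'I_K | (k < j)%N]).
  rewrite big_seq1 big_enum/=.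
  have -> : \prod_(j < K | (k < j)%N) acc j = \prod_(k.+2 <= j < K.+1) (1 - alpha j).
    rewrite shift_prod; apply: eq_bigr => j kj.
    by rewrite accE (leq_trans k0k).
  apply; [exact: mean_diverges|exact: (ulist k')|].
  apply/andP; split; first by rewrite /=; lia.
  by apply/allP => j; rewrite mem_enum !inE => kj; lia.
split; last split.
- move=> kk0; apply: (pr_cvg Ep) => //.
  have lK : (k0.-1 < K)%N by lia.
  pose l := Ordinal lK.
  have := @pattern_limit [pred j : 'I_K | (k0.-1 <= j)%N] [::] [:: l].
  have al : acc l = 0 by rewrite accE /= (_ : (k0 <= k0.-1)%N = false)//; lia.
  rewrite big_nil big_seq1 mul1r al => C.
  have {}C := C mean_diverges isT; rewrite /= leqnn in C.
  apply: (squeeze_cvgr _ (cvg_cst 0) (C isT)); near=> n.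
  rewrite pr_ge0/=; apply: pr_le; [exact: mpat|exact: mpat|].
  move=> w /andP[_ /allP h]; rewrite /pattern/= andbT; apply: h.
  by rewrite mem_enum inE/=; lia.
- move=> kk0; have := main; rewrite kk0 leqnn => /(_ isT).
  by rewrite accE /= (_ : (k0 <= k)%N = false) ?subr0 ?mul1r//; lia.
- move=> k0k; have := main (ltnW k0k).
  by rewrite accE /= (_ : (k0 <= k)%N) ?subKr//; lia.
Unshelve. all: by end_near. Qed.

Section orthonormal.
Hypothesis oX : forall n, (K < n)%N -> n%:R^-1 *: ((X n)^T *m X n) = 1%:M.

Let pattern_limit_orth s1 s2 : uniq (s1 ++ s2) ->
  (fun n => pr P (pat n s1 s2)) @ \oo --> \prod_(k <- s1) (1 - acc k) * \prod_(k <- s2) acc k.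
Proof.
move=> us'; apply: (@pattern_limit xpredT) => //; last exact/allP.
by move=> k _; exact: mean_diverges_orth.
Qed.

Lemma forward_limit (aK : alpha K.+1 = 0) k : (1 <= k <= K)%N ->
  let p := fun n => P [set w | khatF alpha (X n) (Yvec (X n) beta0 eps w) = k] in
  ((k < k0)%N -> p @ \oo --> 0%E) /\
  (k = k0 -> p @ \oo --> (1 - alpha k0.+1)%:E) /\
  ((k0 < k)%N -> p @ \oo -->
    ((1 - alpha k.+1) * \prod_(k0.+1 <= j < k.+1) alpha j)%:E).
Proof.
move=> /andP[k1 kK] p; have [k00 k0K'] := andP k0K.
have ulist : uniq (enum [pred j : 'I_K | (j < k)%N] ++ enum [pred j : 'I_K | (j : nat) == k]).
  rewrite cat_uniq !enum_uniq andbT/=; apply/hasPn => j; rewrite !mem_enum !inE => /eqP ->.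
  by rewrite ltnn.
have main : p @ \oo -->
    (\prod_(j < K | (j < k)%N) (1 - acc j) * \prod_(j < K | (j : nat) == k) acc j)%:E.
  apply: (pr_cvg (khatF_pattern kK aK)) => //.
  by have := pattern_limit_orth ulist; rewrite !big_enum.
have last_acc : (k0 <= k)%N -> \prod_(j < K | (j : nat) == k) acc j = 1 - alpha k.+1.
  move=> k0k; move: kK; rewrite leq_eqVlt => /predU1P[kK|kK].
    rewrite kK aK subr0 big_pred0// => j; apply/negbTE; have := ltn_ord j; lia.
  rewrite (big_pred1 (Ordinal kK)); first by rewrite accE/= k0k.
  by move=> j; rewrite /= -val_eqE.
have first_acc : (k0 <= k)%N -> \prod_(j < K | (j < k)%N) (1 - acc j) = \prod_(k0.+1 <= j < k.+1) alpha j.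
  move=> k0k; rewrite shift_prod (big_ord_widen_cond K (fun j => k0 <= j)%N (fun j => alpha j.+1))//.
  rewrite [LHS](bigID (fun j : 'I_K => (k0 <= j)%N))/= [X in _ * X]big1 ?mulr1.
    apply: eq_big => [j|j /andP[jk k0j]]; first by rewrite andbC.
    by rewrite accE k0j subKr.
  by move=> j /andP[_ /negbTE k0j]; rewrite accE k0j subr0.
split; last split.
- move=> kk0; have kK' : (k < K)%N by exact: leq_trans k0K'.
  move: main; rewrite [X in (_ * X)%:E](big_pred1 (Ordinal kK')); last by move=> j; rewrite /= -val_eqE.
  by rewrite accE/= leqNgt kk0 mulr0.
- move=> kk0; move: main; rewrite last_acc ?first_acc ?kk0//.
  by rewrite big_geq// mul1r.
- by move=> k0k; move: main; rewrite last_acc ?first_acc ?(ltnW k0k)// mulrC.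
Qed.

Lemma ols_hard_limit k :
  (fun n => P [set w | khatO alpha (X n) (Yvec (X n) beta0 eps w) = k]) @ \oo --> (\sum_(A : {set 'I_K} | #|A| == k) pattern_prob acc A)%:E.
Proof.
have dD n (A A' : {set 'I_K}) w : pat n (enum A) (enum (~: A)) w ->
    pat n (enum A') (enum (~: A')) w -> A = A'.
  move=> /andP[/allP a1 /allP a2] /andP[/allP b1 /allP b2]; apply/setP => i.
  have a1i := a1 i; have a2i := a2 i; have b1i := b1 i; have b2i := b2 i.
  rewrite !mem_enum !inE in a1i a2i b1i b2i.
  case: (i \in A) a1i a2i; case: (i \in A') b1i b2i => //= c1 c2 c3 c4.
    by have := c3 isT; rewrite leNgt c2.
  by have := c1 isT; rewrite leNgt c4.
have uA := enum_uniq [pred A : {set 'I_K} | #|A| == k].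
have U n := pr_disjoint_union P (fun A : {set 'I_K} => mpat n (enum A) (enum (~: A))) (dD n) uA.
apply: (pr_cvg (khatO_pattern k oX)).
  by move=> n; have [] := U n.
under eq_fun do rewrite (proj2 (U _)) big_enum/=.
apply: cvg_fsum => A.
have -> : pattern_prob acc A = \prod_(i <- enum A) (1 - acc i) * \prod_(i <- enum (~: A)) acc i.
  rewrite /pattern_prob !big_enum (bigID (mem A))/=; congr (_ * _).
    by apply: eq_bigr => i ->.
  by apply: eq_big => [i|i /negbTE ->//]; rewrite inE.
apply: pattern_limit_orth.
rewrite cat_uniq !enum_uniq andbT/=; apply/hasPn => i; rewrite !mem_enum !inE.
by [].
Qed.

End orthonormal.

Lemma pattern_prob_acc A : pattern_prob acc A =
  pattern_prob (fun i : 'I_K => if (k0 <= i)%N then 1 - alpha i.+1 else 0) A.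
Proof. by rewrite /pattern_prob; apply: eq_bigr => i _; rewrite accE. Qed.

Lemma pattern_prob_small (A : {set 'I_K}) : (#|A| < k0)%N -> pattern_prob acc A = 0.
Proof.
move=> Ak0; have [k00 k0K'] := andP k0K.
have [/forallP h|/forallPn[i]] := boolP [forall i : 'I_K, (i < k0)%N ==> (i \in A)].
  exfalso; move: Ak0; apply/negP; rewrite -leqNgt.
  have sub : [pred i : 'I_K | (i < k0)%N] \subset A.
    by apply/fintype.subsetP => i; rewrite inE => ik0; exact: (implyP (h i)).
  apply: leq_trans (subset_leq_card sub).
  by rewrite -sum1_card (big_ord_narrow k0K')/= sum_nat_const card_ord muln1.
rewrite negb_imply => /andP[ik0 iA].
by rewrite /pattern_prob (bigD1 i)//= (negbTE iA) accE leqNgt ik0 mul0r.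
Qed.

End assembly.

Theorem theorem8 (R : realType) (d : measure_display) (T : measurableType d)
  (P : probability T R) (K k0 : nat) (beta0 : 'cV[R]_K)
  (X : forall n : nat, 'M[R]_(n, K)) (Sigma0 : 'M[R]_K)
  (eps : nat -> T -> R) (sigma0 M : R) (alpha : nat -> R) :
  (1 <= K)%N -> (1 <= k0 <= K)%N ->
  (forall j : 'I_K, (j < k0)%N -> beta0 j 0 != 0) ->
  (forall j : 'I_K, (k0 <= j)%N -> beta0 j 0 = 0) ->
  (* (i) *)
  (forall n, (K < n)%N -> forall k : 'I_K,
      \sum_(i < n) X n i k = 0 /\ \sum_(i < n) X n i k ^+ 2 = n%:R) ->
  (* (ii) *)
  (fun n => \big[Num.max/0]_(i < n)
              (Num.sqrt (\sum_(k < K) X n i k ^+ 2) / Num.sqrt n%:R)) @ \oo --> 0 ->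
  (* (iii) *)
  (forall n, (K < n)%N -> posdefmx ((X n)^T *m X n)) ->
  (* (iv) *)
  (forall i j : 'I_K, (fun n => (n%:R^-1 *: ((X n)^T *m X n)) i j) @ \oo --> Sigma0 i j) ->
  posdefmx Sigma0 ->
  (* errors *)
  (forall i, measurable_fun setT (eps i)) ->
  mutual_indep P setT eps ->
  (forall i, ('E_P[eps i] = 0)%E) ->
  0 < sigma0 ->
  (forall i, ('E_P[(fun w => eps i w ^+ 2)%R] = (sigma0 ^+ 2)%:E)%E) ->
  (forall i, ('E_P[(fun w => eps i w ^+ 4)%R] <= M%:E)%E) ->
  (* levels *)
  (forall k, (1 <= k <= K)%N -> 0 < alpha k < 1) ->
  alpha K.+1 = 0 ->
  (* (a) *)
  (forall k, (1 <= k <= K)%N ->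
     let p := fun n => P [set w | khatB alpha (X n) (Yvec (X n) beta0 eps w) = k] in
     ((k < k0)%N -> p @ \oo --> 0%E) /\
     (k = k0 -> p @ \oo --> (\prod_(k0.+1 <= j < K.+1) (1 - alpha j))%:E) /\
     ((k0 < k)%N -> p @ \oo --> (alpha k * \prod_(k.+1 <= j < K.+1) (1 - alpha j))%:E)) /\
  (Sigma0 = 1%:M ->
   (forall n, (K < n)%N -> n%:R^-1 *: ((X n)^T *m X n) = 1%:M) ->
   (* (b) *)
   (forall k, (1 <= k <= K)%N ->
     let p := fun n => P [set w | khatF alpha (X n) (Yvec (X n) beta0 eps w) = k] in
     ((k < k0)%N -> p @ \oo --> 0%E) /\
     (k = k0 -> p @ \oo --> (1 - alpha k0.+1)%:E) /\
     ((k0 < k)%N -> p @ \oo -->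
        ((1 - alpha k.+1) * \prod_(k0.+1 <= j < k.+1) alpha j)%:E)) /\
   (* (c) *)
   (forall k, (1 <= k <= K)%N ->
     let p := fun n => P [set w | khatO alpha (X n) (Yvec (X n) beta0 eps w) = k] in
     ((k < k0)%N -> p @ \oo --> 0%E) /\
     ((k0 <= k)%N ->
       forall (d' : measure_display) (T' : measurableType d') (Q : probability T' R)
              (B : nat -> T' -> R),
         (forall j, (k0 < j <= K)%N -> measurable_fun setT (B j)) ->
         mutual_indep Q [set j | (k0 < j <= K)%N] B ->
         (forall j, (k0 < j <= K)%N ->
            Q [set w | B j w = 1] = (alpha j)%:E /\
            Q [set w | B j w = 0] = (1 - alpha j)%:E) ->
         p @ \oo --> Q [set w | \sum_(k0.+1 <= j < K.+1) B j w = (k - k0)%:R]))).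
Proof.
move=> _ k0K beta_nz beta_z _ Xmax pG Xlim pS meps ieps eps1 s0 eps2 eps4 alpha01 aK.
have /choice[z zP] : forall k : 'I_K, exists z, [/\ 0 < z, zq (alpha k.+1 / 2) = z%:E &
    pr (@normal_prob R 0 1) `]-z, z[ = 1 - alpha k.+1].
  by move=> k; apply: zqP; apply: alpha01; rewrite ltn_ord.
have z0 k : 0 < z k by have [] := zP k.
have zE (k : 'I_K) : zq (alpha k.+1 / 2) = (z k)%:E by have [] := zP k.
have zG (k : 'I_K) : pr (@normal_prob R 0 1) `]-z k, z k[ = 1 - alpha k.+1 by have [] := zP k.
split=> [k kK|_ oX].
  exact: (backward_limit k0K beta_nz beta_z Xmax pG Xlim pS meps ieps eps1 s0 eps2 eps4 z0 zE zG kK).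
split=> k kK.
  exact: (forward_limit k0K beta_nz beta_z Xmax pG Xlim pS meps ieps eps1 s0 eps2 eps4 z0 zE zG oX aK kK).
have lim := ols_hard_limit beta_nz beta_z Xmax pG Xlim pS meps ieps eps1 s0 eps2 eps4 z0 zE oX (k := k).
split=> [kk0|k0k d' T' Q B mB iB B01].
  move: lim; rewrite big1// => A /eqP Ak.
  by apply: (pattern_prob_small k0K zG); rewrite Ak.
have k0K' : (k0 <= K)%N by case/andP: k0K.
rewrite (pr_bernoulli_sum k0K' mB iB B01 k0k).
by move: lim; under eq_bigr do rewrite (pattern_prob_acc k0 zG).
Qed.
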